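(* Let $X$ be a set with at least two points, let $x_0\in X$, and let $H_k$ be an irreducible complete Nevanlinna--Pick space on $X$ with reproducing kernel $k$, normalized at $x_0$. Let $\mathrm{Mult}(H_k)$ be its multiplier algebra and let $\Delta(\mathrm{Mult}(H_k))$ be the set of all characters of $\mathrm{Mult}(H_k)$. Then the Gelfand transform $g:\mathrm{Mult}(H_k)\to C(\Delta(\mathrm{Mult}(H_k)))$ is isometric if and only if there exist a set of uniqueness $A\subset\mathbb{D}$ for $H^2$ and a bijection $j:X\to A$ such that $j(x_0)=0$ and $$k(x,y)=\frac{1}{1-j(x)\overline{j(y)}}\qquad (x,y\in X).$$ Hence (in this case) the map $$H^2\to H_k,\qquad f\mapsto f\circ j$$ is a unitary operator. Moreover, in this case, the map $$H^{\infty}(\mathbb{D})\to \mathrm{Mult}(H_k),\qquad \psi\mapsto\psi\circ j$$ is a unital completely isometric isomorphism. In particular, the Gelfand transform of $\mathrm{Mult}(H_k)$ is then completely isometric.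
   Context: All Hilbert spaces are complex. $\mathbb{D}=\{z\in\mathbb{C}: |z|<1\}$. A reproducing kernel Hilbert space (RKHS) $H_k$ on a set $X$ is a Hilbert space of functions $X\to\mathbb{C}$ with bounded point evaluations; its kernel $k:X\times X\to\mathbb{C}$ satisfies $f(y)=\langle f,k(\cdot,y)\rangle$ for $f\in H_k$, $y\in X$. Standing assumption of the paper: $X$ is neither empty nor a singleton, and $\dim H_k>1$. $H_k$ is irreducible if $k(x,y)\neq 0$ for all $x,y\in X$, and $k(\cdot,x)$, $k(\cdot,y)$ are linearly independent in $H_k$ whenever $x\neq y$. $H_k$ is normalized at $x_0\in X$ if $k(x,x_0)=1$ for all $x\in X$. A function $\phi:X\to\mathbb{C}$ is a multiplier of $H_k$ if $\phi f\in H_k$ for all $f\in H_k$; then $M_\phi f=\phi f$ is a bounded operator on $H_k$. The multiplier algebra $\mathrm{Mult}(H_k)$ is the algebra of all multipliers, with norm $\|\phi\|_{\mathrm{Mult}(H_k)}=\|M_\phi\|$; it is identified with a subalgebra of $B(H_k)$ via $\phi\mapsto M_\phi$. For $m\in\mathbb{N}$, $\mathbb{M}_m(\mathbb{C})\otimes \mathrm{Mult}(H_k)$ (matrices with multiplier entries, i.e. matrix-valued functions on $X$) carries the operator norm inherited from $B(\mathbb{C}^m\otimes H_k)$. $H_k$ is a complete Nevanlinna--Pick space if whenever $m,n\in\mathbb{N}$, $x_1,\dots,x_n\in X$ and $W_1,\dots,W_n\in\mathbb{M}_m(\mathbb{C})$ are such that the block matrix $[(I-W_iW_j^* )k(x_i,x_j)]_{i,j=1}^n$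 is positive semidefinite, there exists $\Phi\in\mathbb{M}_m(\mathbb{C})\otimes\mathrm{Mult}(H_k)$ with $\Phi(x_i)=W_i$ for $1\le i\le n$ and $\|\Phi\|_{\mathbb{M}_m(\mathbb{C})\otimes\mathrm{Mult}(H_k)}\le 1$. A character of a unital commutative Banach algebra $\mathcal{A}$ is a nonzero (equivalently unital) multiplicative linear functional $\mathcal{A}\to\mathbb{C}$; the set $\Delta(\mathcal{A})$ of characters carries the weak-$*$ topology. The Gelfand transform $g:\mathcal{A}\to C(\Delta(\mathcal{A}))$ is $g(a)(\chi)=\chi(a)$, where $C(\Delta(\mathcal{A}))$ has the supremum norm. A linear map between operator algebras is completely isometric if for every $m$ the induced entrywise map on $m\times m$ matrices is isometric, where $C(\Delta(\mathcal{A}))$ is regarded as a C*-algebra. $H^2$ is the Hardy space: the RKHS of holomorphic functions on $\mathbb{D}$ whose Taylor coefficients at $0$ are square-summable, with kernel $1/(1-z\overline{w})$. $H^\infty(\mathbb{D})$ is the algebra of bounded holomorphic functions on $\mathbb{D}$ with the supremum norm (and on matrices over it, the supremum over $\mathbb{D}$ of the operator norm). A subset $A\subset\mathbb{D}$ is a set of uniqueness for $H^2$ if the only element of $H^2$ that vanishes on $A$ is the zero function. *)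

(* Defs.v *)
From HB Require Import structures.
From mathcomp Require Import all_boot all_order all_algebra.
From mathcomp Require Import complex.
From mathcomp Require Import all_classical all_reals all_analysis.

Set Implicit Arguments.
Unset Strict Implicit.
Unset Printing Implicit Defensive.

Import Order.TTheory GRing.Theory Num.Theory.
Import numFieldNormedType.Exports.
Import Normc.

Local Open Scope classical_set_scope.
Local Open Scope ring_scope.
Local Open Scope sesquilinear_scope.

(* The complex numbers over [R].  The regular-algebra tag [^o] carries the
   [C]-module structure and the topology of [C]. *)
Notation CC R := (R[i]^o).

Section HilbertFunctionSpaces.
Context {R : realType}.

(* [inner] is linear in its first argument; its values matter only on [carrier]. *)
Record fun_space (X : Type) := FunSpace {
  carrier :> (X -> CC R) -> Prop ;
  inner : (X -> CC R) -> (X -> CC R) -> R[i]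
}.

Definition hnorm X (H : fun_space X) (f : X -> CC R) : R :=
  Num.sqrt (complex.Re (inner H f f)).

Definition hcauchy X (H : fun_space X) (u : nat -> X -> CC R) :=
  forall e : R, 0 < e -> exists N : nat, forall p q : nat,
    (N <= p)%N -> (N <= q)%N -> hnorm H (u p - u q) < e.

Record is_rkhs X (H : fun_space X) : Prop := IsRkhs {
  rkhs0 : H 0 ;
  rkhsP : forall (a : R[i]) f g, H f -> H g -> H (a *: f + g) ;
  innerP : forall (a : R[i]) f g h, H f -> H g -> H h ->
    inner H (a *: f + g) h = a * inner H f h + inner H g h ;
  innerC : forall f g, H f -> H g -> inner H g f = (inner H f g)^* ;
  inner_gt0 : forall f, H f -> f <> 0 -> 0 < inner H f f ;
  hcomplete : forall u, (forall n, H (u n)) -> hcauchy H u ->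
    exists2 f, H f & (fun n => hnorm H (u n - f)) @ \oo --> (0 : R) ;
  bounded_eval : forall y : X, exists M : R, forall f, H f ->
    normc (f y) <= M * hnorm H f
}.

Record rkhs (X : Type) := Rkhs {
  rkhs_space :> fun_space X ;
  rkhs_axioms : is_rkhs rkhs_space
}.

Definition is_kernel X (H : fun_space X) (k : X -> X -> R[i]) :=
  (forall y, H (k^~ y)) /\
  (forall f y, H f -> f y = inner H f (k^~ y)).

Definition irreducible_kernel X (k : X -> X -> R[i]) :=
  (forall x y, k x y <> 0) /\
  (forall x y, x <> y -> forall a b : R[i],
     a *: (k^~ x : X -> CC R) + b *: (k^~ y : X -> CC R) = 0 -> a = 0 /\ b = 0).

Definition normalized X (k : X -> X -> R[i]) (x0 : X) := forall x, k x x0 = 1.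

Definition unitary_op X Y (H : fun_space X) (K : fun_space Y)
    (T : (X -> CC R) -> (Y -> CC R)) :=
  [/\ forall f, H f -> K (T f),
      forall (a : R[i]) f g, H f -> H g -> T (a *: f + g) = a *: T f + T g,
      forall f g, H f -> H g -> inner K (T f) (T g) = inner H f g
    & forall g, K g -> exists2 f, H f & T f = g].

End HilbertFunctionSpaces.

Section Multipliers.
Context {R : realType} {X : Type}.
Implicit Type H : rkhs (R := R) X.

Definition is_multiplier H (phi : X -> CC R) := forall f, H f -> H (phi * f).

Definition multiplier_pred H : pred (X -> CC R) :=
  fun phi => `[< is_multiplier H phi >].

Record mult H := Mult {
  mult_fun :> X -> CC R ;
  multP : multiplier_pred H mult_fun
}.

HB.instance Definition _ H := [isSub for @mult_fun H].
HB.instance Definition _ H := [Choice of mult H by <:].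

Lemma mult_subring H : subring_closed (multiplier_pred H).
Proof.
split=> [|phi psi /asboolP hphi /asboolP hpsi|phi psi /asboolP hphi /asboolP hpsi];
  apply/asboolP => f Hf.
- by rewrite mul1r.
- rewrite mulrBl addrC -scaleN1r; apply: (rkhsP (rkhs_axioms H)).
    exact: hpsi.
  exact: hphi.
- by rewrite -mulrA; apply: hphi; apply: hpsi.
Qed.

Lemma mult_submod H : subsemimod_closed (multiplier_pred H).
Proof.
split; first split.
- apply/asboolP => f _; rewrite mul0r; exact: (rkhs0 (rkhs_axioms H)).
- move=> phi psi /asboolP hphi /asboolP hpsi; apply/asboolP => f Hf.
  rewrite mulrDl -[phi * f]scale1r; apply: (rkhsP (rkhs_axioms H)).
    exact: hphi.
  exact: hpsi.
- move=> a phi /asboolP hphi; apply/asboolP => f Hf.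
  have -> : (a *: phi) * f = a *: (phi * f) + 0.
    by rewrite addr0; apply/funext => x; exact/esym/mulrA.
  by apply: (rkhsP (rkhs_axioms H)); [exact: hphi|exact: (rkhs0 (rkhs_axioms H))].
Qed.

HB.instance Definition _ H :=
  GRing.SubChoice_isSubComPzRing.Build _ (multiplier_pred H) (mult H)
    (mult_subring H).
HB.instance Definition _ H :=
  GRing.SubZmodule_isSubLmodule.Build _ _ (multiplier_pred H) (mult H)
    (mult_submod H).

Definition mult_norm H (phi : mult H) : \bar R :=
  ereal_sup [set (hnorm H (mult_fun phi * f))%:E
            | f in [set f | H f /\ hnorm H f <= 1]].

(* The Hilbert space C^m (x) H is realised as columns of [m] elements of [H]. *)
Definition tensor H m : set 'cV[X -> CC R]_m :=
  [set F | forall i, H (F i 0)].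

Definition tensor_norm H m (F : 'cV[X -> CC R]_m) : R :=
  Num.sqrt (\sum_i hnorm H (F i 0) ^+ 2).

Definition mult_mxnorm H m (Phi : 'M[mult H]_m) : \bar R :=
  ereal_sup [set (tensor_norm H (map_mx (@mult_fun H) Phi *m F))%:E
            | F in [set F | tensor H F /\ tensor_norm H F <= 1]].

Definition psdmx n (A : 'M[R[i]]_n) :=
  forall v : 'cV[R[i]]_n, 0 <= (v ^t* *m A *m v) 0 0.

Definition complete_NP H (k : X -> X -> R[i]) :=
  forall (m n : nat) (x : 'I_n -> X) (W : 'I_n -> 'M[R[i]]_m),
    psdmx (\mxblock_(i < n, j < n)
             (k (x i) (x j) *: (1%:M - W i *m (W j) ^t* ))) ->
    exists Phi : 'M[mult H]_m,
      (forall i, map_mx (fun phi : mult H => phi (x i)) Phi = W i) /\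
      (mult_mxnorm Phi <= 1)%E.

End Multipliers.

Section OperatorNorms.
Context {R : realType}.

Definition l2norm m (v : 'cV[R[i]]_m) : R :=
  Num.sqrt (\sum_i normc (v i 0) ^+ 2).

Definition opnorm m (A : 'M[R[i]]_m) : \bar R :=
  ereal_sup [set (l2norm (A *m v))%:E | v in [set v | l2norm v <= 1]].

Definition sup_norm (T : Type) (f : T -> R[i]) : \bar R :=
  ereal_sup (range (fun t => (normc (f t))%:E)).

Definition sup_mxnorm (T : Type) m (F : T -> 'M[R[i]]_m) : \bar R :=
  ereal_sup (range (fun t => opnorm (F t))).

Definition completely_isometric (A B : Type)
    (normA : forall m, 'M[A]_m -> \bar R) (normB : forall m, 'M[B]_m -> \bar R)
    (T : A -> B) :=
  forall m (a : 'M[A]_m), normB m (map_mx T a) = normA m a.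

End OperatorNorms.

Section Gelfand.
Context {R : realType} {X : Type}.
Implicit Type H : rkhs (R := R) X.

Record is_character H (chi : mult H -> CC R) : Prop := IsCharacter {
  char_linear : linear chi ;
  char_mul : forall a b, chi (a * b) = chi a * chi b ;
  char_neq0 : exists a, chi a <> 0
}.

(* The subtype of the product space carries the topology of pointwise
   convergence, which is the weak-* topology. *)
Definition Delta H : topologicalType :=
  set_type ([set chi | is_character chi] : set {ptws mult H -> CC R}).

Definition char_eval H (a : mult H) (chi : Delta H) : CC R :=
  (set_val chi : mult H -> CC R) a.

Lemma char_eval_continuous H (a : mult H) : continuous (@char_eval H a).
Proof.
move=> chi; apply: (@continuous_comp (Delta H) {ptws mult H -> CC R} (CC R) set_val (fun f => f a)).
  exact: initial_continuous.
exact: proj_continuous.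
Qed.

Definition gelfand H (a : mult H) : continuousType (Delta H) (CC R) :=
  mkcts (@char_eval_continuous H a).

Definition cts_mxnorm (T : topologicalType) m
    (G : 'M[continuousType T (CC R)]_m) : \bar R :=
  sup_mxnorm (fun t => map_mx (fun g : continuousType T (CC R) => g t) G).

Definition gelfand_isometric H :=
  forall phi : mult H, sup_norm (gelfand phi) = mult_norm phi.

Definition gelfand_completely_isometric H :=
  completely_isometric (@mult_mxnorm R X H) (@cts_mxnorm (Delta H))
    (@gelfand H).

End Gelfand.

Section Disc.
Context {R : realType}.

Definition disc : Type := {z : R[i] | `|z| < 1}.

(* Extension by 0 outside the open disc, on which derivatives do not depend. *)
Definition ext0 (f : disc -> CC R) : CC R -> CC R :=
  fun z => oapp f 0 (insub (z : R[i])).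

Definition holomorphic (f : disc -> CC R) :=
  forall z : disc, derivable (ext0 f) (val z : CC R) 1.

Definition taylor (f : disc -> CC R) (n : nat) : R[i] :=
  (derive1n n (ext0 f) 0 : R[i]) / n`!%:R.

(* H^2 carries the inner product of Taylor coefficient sequences in l^2, for
   which 1 / (1 - z w^* ) is the reproducing kernel. *)
Definition hardy2 : fun_space (R := R) disc := FunSpace
  [set f | holomorphic f /\
     (\sum_(0 <= n <oo) ((normc (taylor f n)) ^+ 2)%:E < +oo)%E]
  (fun f g => limn (series (fun n => taylor f n * (taylor g n)^* : CC R))).

Definition uniqueness_set (A : set disc) :=
  forall f, hardy2 f -> (forall z, A z -> f z = 0) -> f = 0.

Definition hinf_pred : pred (disc -> CC R) := fun f =>
  `[< holomorphic f /\ exists M : R, forall z, normc (f z) <= M >].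

Record hinf := Hinf {
  hinf_fun :> disc -> CC R ;
  hinfP : hinf_pred hinf_fun
}.

HB.instance Definition _ := [isSub for hinf_fun].
HB.instance Definition _ := [Choice of hinf by <:].

Lemma ext0_val (f : disc -> CC R) (z : disc) : ext0 f (val z) = f z.
Proof. by rewrite /ext0 valK. Qed.

Lemma ext0P (f : disc -> CC R) (z : R[i]) (hz : `|z| < 1) :
  ext0 f z = f (exist _ z hz).
Proof. by rewrite -ext0_val. Qed.

Lemma ext0D f g : ext0 (f + g) = ext0 f + ext0 g.
Proof.
apply/funext => z; change (ext0 (f + g) z = ext0 f z + ext0 g z).
by rewrite /ext0; case: insub => //=; rewrite addr0.
Qed.

Lemma ext0B f g : ext0 (f - g) = ext0 f - ext0 g.
Proof.
apply/funext => z; change (ext0 (f - g) z = ext0 f z - ext0 g z).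
by rewrite /ext0; case: insub => //=; rewrite subr0.
Qed.

Lemma ext0M f g : ext0 (f * g) = ext0 f * ext0 g.
Proof.
apply/funext => z; change (ext0 (f * g) z = ext0 f z * ext0 g z).
by rewrite /ext0; case: insub => //=; rewrite mulr0.
Qed.

Lemma ext0Z (a : R[i]) f : ext0 (a *: f) = a *: ext0 f.
Proof.
apply/funext => z; change (ext0 (a *: f) z = a *: ext0 f z).
by rewrite /ext0; case: insub => //=; rewrite scaler0.
Qed.

Lemma disc_near (z : disc) : \forall w \near (val z : CC R), `|w : R[i]| < 1.
Proof.
have hz : 0 < 1 - `|val z| by rewrite subr_gt0; exact: (valP z).
apply/nbhs_ballP; exists (1 - `|val z|) => //= w; rewrite -ball_normE /= => hw.
have := ler_normB (val z) (val z - w); rewrite subKr => /le_lt_trans; apply.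
by rewrite -ltrBrDl.
Qed.

Lemma holomorphicD f g : holomorphic f -> holomorphic g -> holomorphic (f + g).
Proof. by move=> hf hg z; rewrite ext0D; apply: derivableD. Qed.

Lemma holomorphicB f g : holomorphic f -> holomorphic g -> holomorphic (f - g).
Proof. by move=> hf hg z; rewrite ext0B; apply: derivableB. Qed.

Lemma holomorphicM f g : holomorphic f -> holomorphic g -> holomorphic (f * g).
Proof. by move=> hf hg z; rewrite ext0M; apply: derivableM. Qed.

Lemma holomorphicZ (a : R[i]) f : holomorphic f -> holomorphic (a *: f).
Proof. by move=> hf z; rewrite ext0Z; apply: derivableZ. Qed.

Lemma holomorphic_cst (a : CC R) : holomorphic (cst a).
Proof.
move=> z; apply: (@near_eq_derivable _ _ _ (cst a)); last exact: derivable_cst.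
by near=> w; rewrite (@ext0P _ w)//; near: w; exact: disc_near.
Unshelve. all: by end_near. Qed.

Lemma holomorphic1 : holomorphic 1.
Proof.
have -> : (1 : disc -> CC R) = cst (1 : CC R) by apply/funext.
exact: holomorphic_cst.
Qed.

Lemma holomorphic0 : holomorphic 0.
Proof.
have -> : (0 : disc -> CC R) = cst (0 : CC R) by apply/funext.
exact: holomorphic_cst.
Qed.

Lemma normcr_ge0 (x : R[i]) : 0 <= normc x.
Proof. by case: x => a b; exact: sqrtr_ge0. Qed.

Lemma hinf_subring : subring_closed hinf_pred.
Proof.
split=> [|f g /asboolP[hf [M fM]] /asboolP[hg [N gN]]
        |f g /asboolP[hf [M fM]] /asboolP[hg [N gN]]]; apply/asboolP; split.
- exact: holomorphic1.
- by exists 1 => z; rewrite normc1.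
- exact: holomorphicB.
- exists (M + N) => z; apply: le_trans (le_normcD (f z) (- g z)) _.
  by rewrite normcN lerD.
- exact: holomorphicM.
- by exists (M * N) => z; rewrite normcM ler_pM ?normcr_ge0.
Qed.

Lemma hinf_submod : subsemimod_closed hinf_pred.
Proof.
split; first split.
- apply/asboolP; split.
    exact: holomorphic0.
  by exists 0 => z; rewrite normc0.
- move=> f g /asboolP[hf [M fM]] /asboolP[hg [N gN]]; apply/asboolP; split.
    exact: holomorphicD.
  exists (M + N) => z; apply: le_trans (le_normcD (f z) (g z)) _.
  exact: lerD.
- move=> a f /asboolP[hf [M fM]]; apply/asboolP; split.
    exact: holomorphicZ.
  by exists (normc a * M) => z; rewrite normcM ler_pM ?normcr_ge0.
Qed.

HB.instance Definition _ :=
  GRing.SubChoice_isSubComPzRing.Build _ hinf_pred hinf hinf_subring.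
HB.instance Definition _ :=
  GRing.SubZmodule_isSubLmodule.Build _ _ hinf_pred hinf hinf_submod.

Definition hinf_mxnorm m (Psi : 'M[hinf]_m) : \bar R :=
  sup_mxnorm (fun z => map_mx (fun psi : hinf => psi z) Psi).

End Disc.

Arguments disc R : clear implicits.
Arguments hardy2 R : clear implicits.
Arguments hinf R : clear implicits.

Section Representation.
Context {R : realType} {X : Type}.

Definition szego_representation (k : X -> X -> R[i]) (x0 : X)
    (A : set (disc R)) (j : X -> disc R) :=
  [/\ uniqueness_set A, set_bij [set: X] A j, val (j x0) = 0
    & forall x y, k x y = 1 / (1 - val (j x) * (val (j y))^*)].

(* A ring morphism is unital, so with [scalable] it is a unital algebra morphism. *)
Definition hinf_composition_isomorphism (H : rkhs (R := R) X)
    (j : X -> disc R) :=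
  exists T : {rmorphism hinf R -> mult H},
    [/\ forall psi, T psi = psi \o j :> (X -> CC R),
        scalable T,
        bijective T
      & completely_isometric (@hinf_mxnorm R) (@mult_mxnorm R X H) T].

End Representation.

(* Main.v *)
Require Import Defs.
From HB Require Import structures.
From mathcomp Require Import all_boot all_order all_algebra.
From mathcomp Require Import complex.
From mathcomp Require Import all_classical all_reals all_analysis.
From mathcomp Require Import ring lra.

(** An isometric Gelfand transform forces the kernel [F = 1 - 1 / k] ([pickF])
    to have rank one. By the complete Pick property, [F] is on finite sets the
    Gram matrix of the values of a row contraction of multipliers
    ([pick_coords_exist]). A point [y] other than [x0] has an extremal
    multiplier: a contraction that vanishes at [x0] and has the largest possible
    modulus [sqrt (F y y)] at [y]. The crucial fact is that all powers of it
    have norm at least 1 in the space ([extremal_pow_norm]). Indeed a power of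
    smaller norm is the first entry, up to a factor, of a column contraction
    ([column_contraction]), whose second entry damps the Moebius transform of
    the extremal multiplier on the characters; the result has norm less than 1
    on the characters and norm at least 1 as a multiplier. For two points,
    extremal multipliers [z1] and [psi] inside one row contraction then give two
    incompatible bounds for [z1^2 + psi^2], from below in the space and from
    above on the characters, unless [|F z y|^2 = F z z * F y y]
    ([pickF_rank_one]). So [F x y] is [j x * (j y)^*], which is the stated form
    of [k] ([szego_of_isometric]). The range of [j] is a set of uniqueness,
    because an element of [H^2] that vanishes on it could be used to lower the
    norm of a power of [z], while the powers of [j] have norm at least 1
    ([l2_vanishing]).

    Conversely let [k] be of this form. Multiplication by [j] is a contraction
    whose range is orthogonal to the constants, so that square summable power
    series in [j] converge in the space ([l2_composition]); each [g] is the sum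
    of such a series, with coefficients [<g, j^n>] ([hcoef_spec]). On a set of
    uniqueness the coefficients are unique, and composition with [j] is unitary
    ([composition_unitary]). Hence elements of the space extend to the disc, and
    evaluation at any point [z] of the disc is represented by a vector. Square
    means over roots of unity show that a matrix of bounded holomorphic
    functions multiplies tuples with norm at most its supremum
    ([bounded_action]), and the vectors of the points give the reverse
    inequality ([mult_mxnorm_compP]). A multiplier is a bounded operator by the
    principle of uniform boundedness, and the same vectors show that its
    extension is bounded by the norm ([comp_mult_surjective]). Finally the
    points of the disc are characters, and no character exceeds the supremum of
    a bounded holomorphic function ([char_bound]).

    Both directions use that holomorphic functions on the disc are the sums of
    their Taylor series. Integrals are replaced by trapezoid sums: Goursat's
    argument applies to them ([goursat]) and yields, for functions on the roots
    of unity, a discrete Cauchy formula ([discrete_cauchy]) whose coefficients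
    converge to those of the power series ([holomorphic_psum]). *)

Set Implicit Arguments.
Unset Strict Implicit.
Unset Printing Implicit Defensive.
Import Order.TTheory GRing.Theory Num.Theory.
Import numFieldNormedType.Exports.
Import Normc.
Local Open Scope classical_set_scope.
Local Open Scope ring_scope.
Local Open Scope sesquilinear_scope.
Local Notation "x %:C" := (real_complex _ x) (format "x %:C") : ring_scope.
Local Notation Re := complex.Re.
Local Notation Im := complex.Im.

(** * Complex numbers *)

Section ComplexNumbers.
Context {R : realType}.
Implicit Types (x y z : R[i]) (a b : R).

Lemma ReD x y : Re (x + y) = Re x + Re y.
Proof. by case: x => ? ?; case: y. Qed.

Lemma ReN x : Re (- x) = - Re x.
Proof. by case: x. Qed.

Lemma ReB x y : Re (x - y) = Re x - Re y.
Proof. by rewrite ReD ReN. Qed.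

Lemma ReZ a x : Re (a%:C * x) = a * Re x.
Proof. by case: x => ? ?; rewrite /= mul0r subr0. Qed.

Lemma ReJ x : Re x^* = Re x.
Proof. by case: x. Qed.

Lemma normc_ge0 x : 0 <= normc x.
Proof. exact: normcr_ge0. Qed.

Lemma normc_conj x : normc x^* = normc x.
Proof. by case: x => a b /=; rewrite sqrrN. Qed.

Lemma normcR a : normc (a%:C) = `|a|.
Proof. by rewrite /= expr0n addr0 sqrtr_sqr. Qed.

Lemma ger0_normcR a : 0 <= a -> normc (a%:C) = a.
Proof. by move=> a0; rewrite normcR ger0_norm. Qed.

Lemma normcX x n : normc (x ^+ n) = normc x ^+ n.
Proof.
by elim: n => [|n IH]; rewrite ?expr0 ?normc1 // !exprS normcM IH.
Qed.

Lemma mulcJ x : x * x^* = (normc x ^+ 2)%:C.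
Proof. by rewrite -normCK (_ : `|x| = (normc x)%:C) // rmorphXn. Qed.

Lemma mulJc x : x^* * x = (normc x ^+ 2)%:C.
Proof. by rewrite mulrC mulcJ. Qed.

Lemma sqr_normc x : normc x ^+ 2 = Re x ^+ 2 + Im x ^+ 2.
Proof.
by case: x => a b /=; rewrite sqr_sqrtr // addr_ge0 // sqr_ge0.
Qed.

Lemma ler_Re_normc x : Re x <= normc x.
Proof.
case: x => a b /=; rewrite (le_trans (ler_norm _)) // -sqrtr_sqr ler_wsqrtr //.
by rewrite lerDl sqr_ge0.
Qed.

Lemma ler_NRe_normc x : - Re x <= normc x.
Proof. by rewrite -ReN -[normc x]normcN; exact: ler_Re_normc. Qed.

Lemma ler_Im_normc x : `|Im x| <= normc x.
Proof.
by case: x => a b /=; rewrite -sqrtr_sqr ler_wsqrtr // lerDr sqr_ge0.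
Qed.

Lemma ler_normRe_normc x : `|Re x| <= normc x.
Proof. by rewrite ler_norml ler_Re_normc lerNl ler_NRe_normc. Qed.

Lemma ler_normc_ReIm x : normc x <= `|Re x| + `|Im x|.
Proof.
rewrite -(@ler_pXn2r _ 2) ?nnegrE ?addr_ge0 ?normc_ge0 //.
rewrite sqr_normc -(real_normK (num_real (Re x))) -(real_normK (num_real (Im x))).
have := mulr_ge0 (normr_ge0 (Re x)) (normr_ge0 (Im x)); nra.
Qed.

Lemma normcB_sym x y : normc (x - y) = normc (y - x).
Proof. by rewrite -normcN opprB. Qed.

Lemma ler_normcB x y : normc x - normc y <= normc (x - y).
Proof. by rewrite lerBlDr -{1}(subrK y x) le_normcD. Qed.

Lemma normc_sum (I : Type) (r : seq I) (P : pred I) (F : I -> R[i]) :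
  normc (\sum_(i <- r | P i) F i) <= \sum_(i <- r | P i) normc (F i).
Proof.
elim/big_rec2: _ => [|i a b _ IH]; first by rewrite normc0.
by rewrite (le_trans (le_normcD _ _)) // lerD2l.
Qed.

Lemma normcD2 x y :
  normc (x + y) ^+ 2 = normc x ^+ 2 + normc y ^+ 2 + 2 * Re (x * y^*).
Proof. rewrite !sqr_normc; case: x => a b; case: y => c d /=; ring. Qed.

Lemma normcB2 x y :
  normc (x - y) ^+ 2 = normc x ^+ 2 + normc y ^+ 2 - 2 * Re (x * y^*).
Proof. rewrite !sqr_normc; case: x => a b; case: y => c d /=; ring. Qed.

Lemma normc_eq0 x : (normc x == 0) = (x == 0).
Proof. by apply/eqP/eqP => [/eq0_normc //|->]; rewrite normc0. Qed.

Lemma normc_gt0 x : (0 < normc x) = (x != 0).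
Proof. by rewrite lt_neqAle normc_ge0 andbT eq_sym normc_eq0. Qed.

Lemma Re_sum (I : Type) (r : seq I) (P : pred I) (F : I -> R[i]) :
  Re (\sum_(i <- r | P i) F i) = \sum_(i <- r | P i) Re (F i).
Proof. by elim/big_rec2: _ => [//|i a b _ <-]; rewrite ReD. Qed.

Lemma rc_sum (I : Type) (r : seq I) (P : pred I) (F : I -> R) :
  (\sum_(i <- r | P i) F i)%:C = \sum_(i <- r | P i) (F i)%:C.
Proof. exact: rmorph_sum. Qed.

Lemma cj_sum (I : Type) (r : seq I) (P : pred I) (F : I -> R[i]) :
  (\sum_(i <- r | P i) F i)^* = \sum_(i <- r | P i) (F i)^*.
Proof. exact: rmorph_sum. Qed.

Lemma cjM x y : (x * y)^* = x^* * y^*. Proof. exact: rmorphM. Qed.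
Lemma cjN x : (- x)^* = - x^*. Proof. exact: rmorphN. Qed.
Lemma cjB x y : (x - y)^* = x^* - y^*. Proof. exact: rmorphB. Qed.
Lemma cjK x : x^*^* = x. Proof. exact: conjCK. Qed.
Lemma cj0 : 0^* = 0 :> R[i]. Proof. exact: rmorph0. Qed.
Lemma cj1 : 1^* = 1 :> R[i]. Proof. exact: rmorph1. Qed.

Lemma rcD a b : (a + b)%:C = a%:C + b%:C. Proof. exact: rmorphD. Qed.
Lemma rcM a b : (a * b)%:C = a%:C * b%:C. Proof. exact: rmorphM. Qed.
Lemma rcB a b : (a - b)%:C = a%:C - b%:C. Proof. exact: rmorphB. Qed.
Lemma rcV a : (a^-1)%:C = (a%:C)^-1. Proof. exact: fmorphV. Qed.
Lemma rcX a n : (a ^+ n)%:C = a%:C ^+ n. Proof. exact: rmorphXn. Qed.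
Lemma rc_nat n : (n%:R)%:C = n%:R :> R[i]. Proof. exact: rmorph_nat. Qed.

Lemma rcK a : Re a%:C = a.
Proof. by []. Qed.

Lemma cjR a : (a%:C)^* = a%:C :> R[i].
Proof. by rewrite /real_complex_def; congr (Complex _ _); rewrite oppr0. Qed.

Lemma ler_eps (C a b : R) : (forall e, 0 < e -> a <= b + C * e) -> a <= b.
Proof.
move=> h; have C1 : 0 < `|C| + 1 by rewrite ltr_wpDl.
apply/ler_addgt0Pr => e e0.
have := h (e / (`|C| + 1)) (divr_gt0 e0 C1) => /le_trans; apply.
rewrite lerD2l mulrA ler_pdivrMr // mulrC ler_pM2l //.
by rewrite (le_trans (ler_norm C)) // lerDl.
Qed.

Lemma inv_succ_small e : 0 < e ->
  exists N, forall n, (N <= n)%N -> (n.+1%:R : R)^-1 < e.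
Proof.
move=> e0; exists (Num.truncn (e^-1)) => n hn.
rewrite invf_plt ?posrE ?ltr0Sn //.
by apply: lt_le_trans (truncnS_gt _) _; rewrite ler_nat ltnS.
Qed.

Lemma normc_phase x : exists2 u : R[i], normc u = 1 & u * x = (normc x)%:C.
Proof.
have [->|x0] := eqVneq x 0; first by exists 1; rewrite ?normc1 // mulr0 normc0.
have nx : normc x != 0 by rewrite normc_eq0.
exists (x^* * ((normc x)^-1)%:C).
  by rewrite normcM normc_conj ger0_normcR ?divff // invr_ge0 normc_ge0.
rewrite mulrAC mulJc -rmorphM; congr (_%:C).
by field.
Qed.

End ComplexNumbers.

(** * Hilbert function spaces *)

Section HilbertSpace.
Context {R : realType} {X : Type} (H : rkhs (R := R) X).

Definition hpred : pred (X -> CC R) := fun f => `[< H f >].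

(** The elements of the space as a type of their own, so that linear algebra
    needs no membership side conditions. *)
Record hvec := Hvec { hfun :> X -> CC R ; hvecP : hpred hfun }.

HB.instance Definition _ := [isSub for hfun].
HB.instance Definition _ := [Choice of hvec by <:].

Lemma hpred_zmod : zmod_closed hpred.
Proof.
have A := rkhs_axioms H; split=> [|f g /asboolP hf /asboolP hg]; apply/asboolP.
  exact: (rkhs0 A).
by rewrite addrC -scaleN1r; apply: (rkhsP A).
Qed.

Lemma hpred_submod : subsemimod_closed hpred.
Proof.
have A := rkhs_axioms H; split; first split.
- apply/asboolP; exact: (rkhs0 A).
- move=> f g /asboolP hf /asboolP hg; apply/asboolP.
  by rewrite -[f]scale1r; apply: (rkhsP A).
- move=> a f /asboolP hf; apply/asboolP.
  by rewrite -[_ *: _]addr0; apply: (rkhsP A) => //; exact: (rkhs0 A).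
Qed.

HB.instance Definition _ :=
  GRing.SubChoice_isSubZmodule.Build _ hpred hvec hpred_zmod.
HB.instance Definition _ :=
  GRing.SubZmodule_isSubLmodule.Build _ _ hpred hvec hpred_submod.

Lemma hvecH (f : hvec) : H f.
Proof. by apply/asboolP; exact: hvecP. Qed.

Definition mkh (f : X -> CC R) (hf : H f) : hvec := Hvec (introT (asboolP _) hf).

Definition ev (f : hvec) (x : X) : R[i] := hfun f x.

Definition ip (f g : hvec) : R[i] := inner H f g.

Definition nrm (f : hvec) : R := hnorm H f.

Lemma evD f g x : ev (f + g) x = ev f x + ev g x. Proof. by []. Qed.
Lemma evB f g x : ev (f - g) x = ev f x - ev g x. Proof. by []. Qed.
Lemma evZ a f x : ev (a *: f) x = a * ev f x. Proof. by []. Qed.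
Lemma ev0 x : ev 0 x = 0. Proof. by []. Qed.

Lemma ev_sum (I : Type) (r : seq I) (P : pred I) (F : I -> hvec) x :
  ev (\sum_(i <- r | P i) F i) x = \sum_(i <- r | P i) ev (F i) x.
Proof. by elim/big_rec2: _ => [//|i a b _ <-]; rewrite evD. Qed.

Lemma hvec_ext f g : (forall x, ev f x = ev g x) -> f = g.
Proof. by move=> h; apply: val_inj; apply/funext => x; exact: h. Qed.

Let A := rkhs_axioms H.

Lemma ipPl a f g h : ip (a *: f + g) h = a * ip f h + ip g h.
Proof. by apply: (innerP A); exact: hvecH. Qed.

Lemma ipC f g : ip g f = (ip f g)^*.
Proof. by apply: (innerC A); exact: hvecH. Qed.

Lemma ipDl f g h : ip (f + g) h = ip f h + ip g h.
Proof. by rewrite -[f]scale1r ipPl scale1r mul1r. Qed.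

Lemma ip0l h : ip 0 h = 0.
Proof. by apply: (addrI (ip 0 h)); rewrite -ipDl !addr0. Qed.

Lemma ipZl a f h : ip (a *: f) h = a * ip f h.
Proof. by rewrite -[a *: f]addr0 ipPl ip0l addr0. Qed.

Lemma ipNl f h : ip (- f) h = - ip f h.
Proof. by rewrite -scaleN1r ipZl mulN1r. Qed.

Lemma ipBl f g h : ip (f - g) h = ip f h - ip g h.
Proof. by rewrite ipDl ipNl. Qed.

Lemma ip_suml (I : Type) (r : seq I) (P : pred I) (F : I -> hvec) h :
  ip (\sum_(i <- r | P i) F i) h = \sum_(i <- r | P i) ip (F i) h.
Proof. by elim/big_rec2: _ => [|i a b _ <-]; rewrite ?ip0l // ipDl. Qed.

Lemma ipDr f g h : ip h (f + g) = ip h f + ip h g.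
Proof. by rewrite ipC ipDl rmorphD /= -!ipC. Qed.

Lemma ip0r h : ip h 0 = 0.
Proof. by rewrite ipC ip0l rmorph0. Qed.

Lemma ipZr a f h : ip h (a *: f) = a^* * ip h f.
Proof. by rewrite ipC ipZl rmorphM /= -ipC. Qed.

Lemma ipNr f h : ip h (- f) = - ip h f.
Proof. by rewrite ipC ipNl rmorphN /= -ipC. Qed.

Lemma ipBr f g h : ip h (f - g) = ip h f - ip h g.
Proof. by rewrite ipDr ipNr. Qed.

Lemma ip_sumr (I : Type) (r : seq I) (P : pred I) (F : I -> hvec) h :
  ip h (\sum_(i <- r | P i) F i) = \sum_(i <- r | P i) ip h (F i).
Proof. by elim/big_rec2: _ => [|i a b _ <-]; rewrite ?ip0r // ipDr. Qed.

Lemma ip_ge0 f : 0 <= ip f f.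
Proof.
have [->|f0] := eqVneq f 0; first by rewrite ip0l.
apply: ltW; apply: (inner_gt0 A); first exact: hvecH.
by move=> h; move/eqP: f0; apply; apply: val_inj.
Qed.

Lemma ipxx f : ip f f = (nrm f ^+ 2)%:C.
Proof.
have := ip_ge0 f; rewrite /nrm /hnorm -/(ip f f) => h.
have : 0 <= Re (ip f f) by move: h; rewrite lecE /= => /andP[].
move=> h'; rewrite sqr_sqrtr //; symmetry; apply: RRe_real.
exact: ger0_real.
Qed.

Lemma nrm_ge0 f : 0 <= nrm f. Proof. exact: sqrtr_ge0. Qed.

Lemma nrm_eq0 f : nrm f = 0 -> f = 0.
Proof.
move=> h; apply/eqP; apply/negPn/negP => f0.
have : 0 < ip f f.
  apply: (inner_gt0 A); first exact: hvecH.
  by move=> h'; move/eqP: f0; apply; apply: val_inj.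
by rewrite ipxx h expr0n /= ltxx.
Qed.

Lemma nrm_gt0 f : f <> 0 -> 0 < nrm f.
Proof.
move=> f0; rewrite lt_neqAle nrm_ge0 andbT; apply/eqP => h.
by apply: f0; exact: nrm_eq0.
Qed.

Lemma nrm2 f : nrm f ^+ 2 = Re (ip f f).
Proof. by rewrite ipxx. Qed.

Lemma nrm0 : nrm 0 = 0.
Proof.
by apply/eqP; rewrite -[_ == 0](@expf_eq0 _ _ 2) /= nrm2 ip0l.
Qed.

Lemma nrmZ a f : nrm (a *: f) = normc a * nrm f.
Proof.
apply/eqP; rewrite -(@eqrXn2 _ 2) ?mulr_ge0 ?nrm_ge0 ?normc_ge0 //.
by rewrite nrm2 ipZl ipZr mulrA mulcJ ReZ exprMn nrm2.
Qed.

Lemma nrmN f : nrm (- f) = nrm f.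
Proof. by rewrite -scaleN1r nrmZ normcN normc1 mul1r. Qed.

Lemma nrmB_sym f g : nrm (f - g) = nrm (g - f).
Proof. by rewrite -nrmN opprB. Qed.

Lemma nrmD2 f g :
  nrm (f + g) ^+ 2 = nrm f ^+ 2 + nrm g ^+ 2 + 2 * Re (ip f g).
Proof.
rewrite !nrm2 ipDl !ipDr !ReD (ipC f g) ReJ; ring.
Qed.

Lemma nrmB2 f g :
  nrm (f - g) ^+ 2 = nrm f ^+ 2 + nrm g ^+ 2 - 2 * Re (ip f g).
Proof. by rewrite nrmD2 nrmN ipNr ReN mulrN. Qed.

Lemma cauchy_schwarz f g : normc (ip f g) <= nrm f * nrm g.
Proof.
have [->|g0] := eqVneq g 0; first by rewrite ip0r normc0 nrm0 mulr0.
have ng : 0 < nrm g by apply: nrm_gt0; apply/eqP.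
have h : ip (f - (ip f g / ip g g) *: g) (f - (ip f g / ip g g) *: g)
   = (nrm f ^+ 2 - normc (ip f g) ^+ 2 / nrm g ^+ 2)%:C.
  have gg : ip g g != 0 by rewrite ipxx fmorph_eq0 expf_neq0 // gt_eqF.
  rewrite rmorphB /= [(_ / _)%:C]fmorph_div /= -mulcJ -!ipxx -ipC.
  rewrite ipBl !ipBr !ipZl !ipZr fmorph_div /= -!ipC.
  by field.
have := ip_ge0 (f - (ip f g / ip g g) *: g); rewrite h lecR subr_ge0.
rewrite ler_pdivrMr ?exprn_gt0 // -exprMn => h2.
by rewrite -(@ler_pXn2r _ 2) ?nnegrE ?mulr_ge0 ?normc_ge0 ?nrm_ge0.
Qed.

Lemma Re_ip_le f g : Re (ip f g) <= nrm f * nrm g.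
Proof. exact: le_trans (ler_Re_normc _) (cauchy_schwarz f g). Qed.

Lemma nrmD f g : nrm (f + g) <= nrm f + nrm g.
Proof.
rewrite -(@ler_pXn2r _ 2) ?nnegrE ?addr_ge0 ?nrm_ge0 //.
have := Re_ip_le f g; rewrite nrmD2 => h; nra.
Qed.

Lemma nrmB f g : nrm (f - g) <= nrm f + nrm g.
Proof. by rewrite -[nrm g]nrmN nrmD. Qed.

Lemma ler_nrmB f g : nrm f - nrm g <= nrm (f - g).
Proof. by rewrite lerBlDr -{1}(subrK g f) nrmD. Qed.

Lemma nrm_sum (I : Type) (r : seq I) (P : pred I) (F : I -> hvec) :
  nrm (\sum_(i <- r | P i) F i) <= \sum_(i <- r | P i) nrm (F i).
Proof.
elim/big_rec2: _ => [|i a b _ IH]; first by rewrite nrm0.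
by rewrite (le_trans (nrmD _ _)) // lerD2l.
Qed.

Lemma hvec_complete (u : nat -> hvec) :
  (forall e, 0 < e -> exists N, forall p q, (N <= p)%N -> (N <= q)%N ->
     nrm (u p - u q) < e) ->
  exists f, forall e, 0 < e -> exists N, forall n, (N <= n)%N -> nrm (u n - f) < e.
Proof.
move=> hu; have [f Hf cf] := hcomplete A (fun n => hvecH (u n)) hu.
exists (mkh Hf) => e e0.
have /cvgrPdist_lt /(_ e e0) [N _ hN] := cf.
exists N => n Nn; have := hN n Nn.
by rewrite /= sub0r normrN ger0_norm // sqrtr_ge0.
Qed.

(** The representing vector maximises [2 Re l - |d|^2] on the graph. A
    maximising sequence is Cauchy by the parallelogram law, although the domain
    need not be closed, and it exhibits the vector as a limit of elements of the
    domain. *)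
Lemma riesz_graph (G : hvec -> R[i] -> Prop) (c : R) :
  G 0 0 ->
  (forall a d l d' l', G d l -> G d' l' -> G (a *: d + d') (a * l + l')) ->
  0 <= c -> (forall d l, G d l -> normc l <= c * nrm d) ->
  exists v, [/\ forall d l, G d l -> l = ip d v, nrm v <= c
    & forall e, 0 < e -> exists d l, G d l /\ nrm (v - d) < e].
Proof.
move=> G0 GP c0 Gc.
pose J (p : hvec * R[i]) := 2 * Re p.2 - nrm p.1 ^+ 2.
pose D := [set p : hvec * R[i] | G p.1 p.2].
have Jc p : D p -> J p <= c ^+ 2.
  move=> /Gc; have := ler_Re_normc p.2; rewrite /J.
  have := sqr_ge0 (c - nrm p.1); nra.
have hs : has_sup (J @` D).
  split; first by exists (J (0, 0)); exists (0, 0).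
  by exists (c ^+ 2) => _ [p /Jc + <-].
pose s := sup (J @` D).
have Js p : D p -> J p <= s.
  by move=> Dp; apply: ub_le_sup; [case: hs|exists p].
have /choice[u hu] : forall n : nat, exists p, D p /\ s - n.+1%:R^-1 < J p.
  move=> n; have n0 : 0 < (n.+1%:R : R)^-1 by rewrite invr_gt0 ltr0Sn.
  have [_ [p Dp <-] hp] := sup_adherent n0 hs.
  by exists p.
have [v hv] : exists f, forall e, 0 < e -> exists N, forall n, (N <= n)%N ->
    nrm ((u n).1 - f) < e.
  apply: hvec_complete => e e0.
  have e4 : 0 < e ^+ 2 / 4 by apply: divr_gt0; rewrite ?exprn_gt0.
  have [N hN] := inv_succ_small e4; exists N => p q Np Nq.
  have [Dp jp] := hu p; have [Dq jq] := hu q.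
  have := Js (2^-1 *: ((u p).1 + (u q).1), 2^-1 * ((u p).2 + (u q).2)).
  have /[swap]/[apply] : D (2^-1 *: ((u p).1 + (u q).1), 2^-1 * ((u p).2 + (u q).2)).
    have h1 : G ((u p).1 + (u q).1) ((u p).2 + (u q).2).
      by have := GP 1 _ _ _ _ Dp Dq; rewrite scale1r mul1r.
    by have := GP 2^-1 _ _ _ _ h1 G0; rewrite !addr0.
  have h2 : (2^-1 : R[i]) = (2^-1 : R)%:C by rewrite fmorphV rmorph_nat.
  rewrite /J /= nrmZ h2 ReZ ger0_normcR ?invr_ge0 // exprMn ReD nrmD2 => hpq.
  have np := hN _ Np; have nq := hN _ Nq.
  rewrite -(@ltr_pXn2r _ 2) ?nnegrE ?nrm_ge0 ?(ltW e0) // nrmB2.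
  move: hpq jp jq np nq; rewrite /J.
  set a := nrm _ ^+ 2; set b := nrm _ ^+ 2.
  set i1 := p.+1%:R^-1; set i2 := q.+1%:R^-1.
  set ee := e ^+ 2.
  lra.
have hvd e : 0 < e -> exists n, nrm (v - (u n).1) < e /\ (n.+1%:R : R)^-1 < e.
  move=> e0; have [N hN] := hv e e0; have [M hM] := inv_succ_small e0.
  exists (maxn N M); rewrite nrmB_sym; split; [apply: hN|apply: hM].
    exact: leq_maxl.
  exact: leq_maxr.
exists v.
have rep d l : G d l -> l = ip d v.
  move=> Gd; apply/eqP; rewrite -subr_eq0; set dl := _ - _.
  have key t : 2 * Re (t * dl) <= normc t ^+ 2 * nrm d ^+ 2.
    apply: (@ler_eps _ (1 + 2 * (normc t * nrm d))) => e e0.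
    have [n [h1 h2]] := hvd e e0; have [Dn jn] := hu n.
    have := Js (t *: d + (u n).1, t * l + (u n).2).
    have /[swap]/[apply] : D (t *: d + (u n).1, t * l + (u n).2) by exact: GP.
    rewrite /J /= nrmD2 nrmZ exprMn ipZl ReD => hJ.
    have -> : dl = l - ip d (u n).1 - ip d (v - (u n).1).
      by rewrite /dl ipBr; ring.
    rewrite (mulrBr t) ReB (mulrBr t) ReB.
    have h3 : - Re (t * ip d (v - (u n).1)) <= normc t * nrm d * e.
      apply: le_trans (ler_NRe_normc _) _; rewrite normcM -mulrA.
      apply: ler_wpM2l; first exact: normc_ge0.
      apply: le_trans (cauchy_schwarz _ _) _.
      by apply: ler_wpM2l; [exact: nrm_ge0|exact: ltW].
    move: jn hJ h2; rewrite /J; set i1 := n.+1%:R^-1; lra.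
  rewrite -normc_eq0 -[_ == 0](@expf_eq0 _ _ 2) /=.
  rewrite eq_le sqr_ge0 andbT.
  apply: (@ler_eps _ (2^-1 * (normc dl ^+ 2 * nrm d ^+ 2))) => e e0; rewrite add0r.
  have := key (e%:C * dl^*); rewrite -mulrA mulJc ReZ rcK normcM normc_conj.
  rewrite ger0_normcR ?(ltW e0) // exprMn => h.
  have : e * (2 * normc dl ^+ 2) <= e * (e * (normc dl ^+ 2 * nrm d ^+ 2)) by lra.
  rewrite ler_pM2l // => h'; lra.
split=> //.
  have h : nrm v ^+ 2 <= c * nrm v.
    apply: (@ler_eps _ (c + nrm v)) => e e0.
    have [n [h1 _]] := hvd e e0; have [Dn _] := hu n.
    have h2 := Gc _ _ Dn; rewrite (rep _ _ Dn) in h2.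
    have -> : nrm v ^+ 2 = Re (ip (u n).1 v) + Re (ip (v - (u n).1) v).
      by rewrite -ReD -ipDl addrC subrK nrm2.
    have := ler_Re_normc (ip (u n).1 v); have := Re_ip_le (v - (u n).1) v.
    have h3 := ler_nrmB (u n).1 v; rewrite nrmB_sym in h3.
    have h4 : nrm (v - (u n).1) * nrm v <= e * nrm v.
      by apply: ler_wpM2r; [exact: nrm_ge0|exact: ltW].
    have h5 : c * nrm (u n).1 <= c * (nrm v + e).
      by apply: ler_wpM2l => //; lra.
    lra.
  have := nrm_ge0 v; rewrite le_eqVlt => /orP[/eqP <- //|v0].
  by move: h; rewrite expr2 ler_pM2r.
move=> e e0; have [n [h1 _]] := hvd e e0; have [Dn _] := hu n.
by exists (u n).1, (u n).2.
Qed.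

End HilbertSpace.

(** * Reproducing kernels *)

Section Kernel.
Context {R : realType} {X : Type} (H : rkhs (R := R) X) (k : X -> X -> R[i]).
Hypothesis hk : is_kernel H k.
Implicit Types (f g h : hvec H) (x y : X) (s : seq (R[i] * X)) (S : seq X).

Definition kv y : hvec H := mkh (hk.1 y).

Lemma ev_kv x y : ev (kv y) x = k x y. Proof. by []. Qed.

Lemma ip_kv f y : ip f (kv y) = ev f y.
Proof. by rewrite /ev (hk.2 f y (hvecH f)). Qed.

Lemma ip_kvl f y : ip (kv y) f = (ev f y)^*.
Proof. by rewrite ipC ip_kv. Qed.

Lemma kernelC x y : k y x = (k x y)^*.
Proof. by rewrite -ev_kv -ip_kv ipC ip_kv. Qed.

Lemma nrm2_kv x : (nrm (kv x) ^+ 2)%:C = k x x.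
Proof. by rewrite -ipxx ip_kv. Qed.

Definition lcomb s : hvec H := \sum_(p <- s) p.1 *: kv p.2.

Definition scale_pts (u : X -> R[i]) s := [seq (p.1 * u p.2, p.2) | p <- s].

Lemma lcomb_cat s t : lcomb (s ++ t) = lcomb s + lcomb t.
Proof. exact: big_cat. Qed.

Lemma lcomb_scale u s :
  lcomb (scale_pts u s) = \sum_(p <- s) (p.1 * u p.2) *: kv p.2.
Proof. by rewrite /lcomb big_map. Qed.

Lemma lcomb_cst (a : R[i]) s : lcomb (scale_pts (fun=> a) s) = a *: lcomb s.
Proof.
rewrite lcomb_scale scaler_sumr; apply: eq_bigr => p _.
by rewrite scalerA mulrC.
Qed.

Lemma ip_lcomb f s : ip f (lcomb s) = \sum_(p <- s) p.1^* * ev f p.2.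
Proof.
by rewrite /lcomb ip_sumr; apply: eq_bigr => p _; rewrite ipZr ip_kv.
Qed.

Lemma nrm_lcomb2 s :
  (nrm (lcomb s) ^+ 2)%:C =
  \sum_(p <- s) \sum_(q <- s) p.1^* * q.1 * k p.2 q.2.
Proof.
rewrite -ipxx ip_lcomb; apply: eq_bigr => p _.
rewrite {1}/lcomb ev_sum mulr_sumr; apply: eq_bigr => q _.
by rewrite evZ ev_kv mulrA.
Qed.

(** Riesz representation of [k_x |-> (g x)^*] on the span of the kernel
    functions: by the reproducing property the representing vector is [g]. All
    functions that are shown below to lie in the space come from here. *)
Lemma rkhs_membership (g : X -> R[i]) (c : R) :
  0 <= c ->
  (forall s, normc (\sum_(p <- s) p.1^* * g p.2) <= c * nrm (lcomb s)) ->
  exists f, [/\ forall x, ev f x = g x, nrm f <= c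
    & forall e, 0 < e -> exists s, nrm (f - lcomb s) < e].
Proof.
move=> c0 hg.
pose G d l := exists s, d = lcomb s /\ l = \sum_(p <- s) p.1 * (g p.2)^*.
have bd s : normc (\sum_(p <- s) p.1 * (g p.2)^*) <= c * nrm (lcomb s).
  rewrite -normc_conj cj_sum; apply: le_trans (hg s).
  by under eq_bigr do rewrite cjM cjK.
have [||d l [s [-> ->]]//|v [hv nv dv]] := @riesz_graph _ _ _ G c _ _ c0.
- by exists [::]; rewrite /lcomb !big_nil.
- move=> a _ _ _ _ [s [-> ->]] [t [-> ->]].
  exists (scale_pts (fun=> a) s ++ t); rewrite lcomb_cat lcomb_cst; split=> //.
  rewrite big_cat big_map mulr_sumr /=; congr (_ + _).
  by apply: eq_bigr => p _; rewrite mulrA [a * _]mulrC.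
exists v; split=> //.
  move=> x; have := hv (kv x) (g x)^*; rewrite ip_kvl => h.
  apply: (can_inj (@conjCK _)); rewrite -h //.
  by exists [:: (1, x)]; rewrite /lcomb !big_seq1 scale1r mul1r.
by move=> e /dv[d [l [[s [-> _]] h]]]; exists s.
Qed.

Lemma kernel_dense f e : 0 < e -> exists s, nrm (f - lcomb s) < e.
Proof.
move=> e0; have [s|g [hg _]] := @rkhs_membership (ev f) (nrm f) (nrm_ge0 f).
  by rewrite -ip_lcomb cauchy_schwarz.
by move=> /(_ e e0); rewrite (hvec_ext hg).
Qed.

Lemma ip_lcomb_bound f (c : R) : 0 <= c ->
  (forall s, normc (ip f (lcomb s)) <= c * nrm (lcomb s)) -> nrm f <= c.
Proof.
move=> c0 h; have [s|g [hg ng _]] := @rkhs_membership (ev f) c c0.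
  by rewrite -ip_lcomb.
by rewrite -(hvec_ext hg).
Qed.

(** ** Multipliers *)

Definition mv (phi : mult H) x : R[i] := mult_fun phi x.

Definition mact (phi : mult H) f : hvec H :=
  mkh (asboolW (multP phi) f (hvecH f)).

Lemma ev_mact phi f x : ev (mact phi f) x = mv phi x * ev f x.
Proof. by []. Qed.

Lemma mvD phi psi x : mv (phi + psi) x = mv phi x + mv psi x. Proof. by []. Qed.
Lemma mvB phi psi x : mv (phi - psi) x = mv phi x - mv psi x. Proof. by []. Qed.
Lemma mvM phi psi x : mv (phi * psi) x = mv phi x * mv psi x. Proof. by []. Qed.
Lemma mvZ a phi x : mv (a *: phi) x = a * mv phi x. Proof. by []. Qed.
Lemma mv1 x : mv 1 x = 1. Proof. by []. Qed.

Lemma mvX phi n x : mv (phi ^+ n) x = mv phi x ^+ n.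
Proof. by elim: n => [|n IH]; rewrite ?expr0 // !exprS mvM IH. Qed.

Lemma mv_sum (I : Type) (r : seq I) (P : pred I) (F : I -> mult H) x :
  mv (\sum_(i <- r | P i) F i) x = \sum_(i <- r | P i) mv (F i) x.
Proof. by elim/big_rec2: _ => [//|i a b _ <-]; rewrite mvD. Qed.

Lemma mult_ext (phi psi : mult H) : (forall x, mv phi x = mv psi x) -> phi = psi.
Proof. by move=> h; apply: val_inj; apply/funext => x; exact: h. Qed.

Definition contr (phi : mult H) := forall f, nrm (mact phi f) <= nrm f.

(** The adjoint of multiplication by [e] would map [k_x] to [(e x)^* k_x]. A
    bound for it on the span of the kernel functions bounds evaluation of [e f]
    there, so that [rkhs_membership] applies. *)
Lemma contr_multiplier (e : X -> R[i]) :
  (forall s, nrm (lcomb (scale_pts (fun x => (e x)^*) s)) <= nrm (lcomb s)) ->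
  exists phi : mult H, (forall x, mv phi x = e x) /\ contr phi.
Proof.
move=> he.
have key f : exists g, (forall x, ev g x = e x * ev f x) /\ nrm g <= nrm f.
  have [s|g [hg ng _]] :=
      @rkhs_membership (fun x => e x * ev f x) (nrm f) (nrm_ge0 f).
    have -> : \sum_(p <- s) p.1^* * (e p.2 * ev f p.2) =
        ip f (lcomb (scale_pts (fun x => (e x)^*) s)).
      rewrite ip_lcomb big_map; apply: eq_bigr => p _ /=.
      by rewrite cjM cjK mulrA.
    apply: le_trans (cauchy_schwarz _ _) _.
    by apply: ler_wpM2l; [exact: nrm_ge0|exact: he].
  by exists g.
have me : multiplier_pred H (e : X -> CC R).
  apply/asboolP => f Hf; have [g [hg _]] := key (mkh Hf).
  have -> : (e : X -> CC R) * f = g by apply/funext => x; rewrite -[g x]/(ev g x) hg.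
  exact: hvecH.
exists (Mult me); split=> // f; have [g [hg ng]] := key f.
by rewrite (_ : mact _ f = g) //; apply: hvec_ext => x; rewrite hg ev_mact.
Qed.

Lemma ip_mact_lcomb phi f s :
  ip (mact phi f) (lcomb s) = ip f (lcomb (scale_pts (fun x => (mv phi x)^*) s)).
Proof.
rewrite !ip_lcomb big_map; apply: eq_bigr => p _.
by rewrite ev_mact /= cjM cjK mulrA.
Qed.

(** ** Finite sets of points *)

Definition pts_in S s := forall p, List.In p s -> List.In p.2 S.

Definition span S f := exists2 s, pts_in S s & f = lcomb s.

Lemma pts_in_cat S s t : pts_in S s -> pts_in S t -> pts_in S (s ++ t).
Proof. by move=> hs ht p /(@List.in_app_or _ s t p)[/hs|/ht]. Qed.

Lemma pts_in_scale S u s : pts_in S s -> pts_in S (scale_pts u s).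
Proof. by move=> hs p /List.in_map_iff[q [<- /hs]]. Qed.

Lemma span0 S : span S 0.
Proof. by exists [::] => //; rewrite /lcomb big_nil. Qed.

Lemma spanD S f g : span S f -> span S g -> span S (f + g).
Proof.
move=> [s hs ->] [t ht ->]; exists (s ++ t); first exact: pts_in_cat.
by rewrite lcomb_cat.
Qed.

Lemma spanZ S a f : span S f -> span S (a *: f).
Proof.
move=> [s hs ->]; exists (scale_pts (fun=> a) s); first exact: pts_in_scale.
by rewrite lcomb_cst.
Qed.

Lemma spanB S f g : span S f -> span S g -> span S (f - g).
Proof. by move=> hf hg; rewrite -scaleN1r; apply/spanD/spanZ. Qed.

Lemma span_sum S (I : eqType) (r : seq I) (F : I -> hvec H) :
  (forall i, i \in r -> span S (F i)) -> span S (\sum_(i <- r) F i).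
Proof.
elim: r => [|i r IH] h; first by rewrite big_nil; exact: span0.
rewrite big_cons; apply: spanD; first by apply: h; rewrite mem_head.
by apply: IH => j jr; apply: h; rewrite inE jr orbT.
Qed.

Lemma span_kv S x : List.In x S -> span S (kv x).
Proof.
move=> xS; exists [:: (1, x)]; first by move=> p [<-|].
by rewrite /lcomb big_seq1 scale1r.
Qed.

Lemma span_sub S S' f :
  (forall x, List.In x S -> List.In x S') -> span S f -> span S' f.
Proof. by move=> h [s hs ->]; exists s => // p /hs /h. Qed.

Lemma big_In (T : Type) (V : nmodType) (r : seq T) (F G : T -> V) :
  (forall i, List.In i r -> F i = G i) ->
  \sum_(i <- r) F i = \sum_(i <- r) G i.
Proof.
elim: r => [|i r IH] h; first by rewrite !big_nil.
rewrite !big_cons h; last by left.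
by rewrite IH // => j jr; apply: h; right.
Qed.

Lemma span_ip0 S f g :
  span S g -> (forall x, List.In x S -> ev f x = 0) -> ip f g = 0.
Proof.
move=> [s hs ->] hf; rewrite ip_lcomb.
by rewrite (@big_In _ _ s _ (fun=> 0)) ?big1 // => p /hs /hf ->; rewrite mulr0.
Qed.

Lemma span_eq S f g : span S f -> span S g ->
  (forall x, List.In x S -> ev f x = ev g x) -> f = g.
Proof.
move=> hf hg h; apply/eqP; rewrite -subr_eq0; apply/eqP/nrm_eq0/eqP.
rewrite -[_ == 0](@expf_eq0 _ _ 2) /= nrm2 (@span_ip0 S) //; first exact: spanB.
by move=> x /h; rewrite evB => ->; rewrite subrr.
Qed.

(** Gram--Schmidt, in the form of a Parseval frame of the span. *)
Lemma span_frame S : exists2 es : seq (hvec H),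
  forall e, e \in es -> span S e
  & forall x, List.In x S -> kv x = \sum_(e <- es) ip (kv x) e *: e.
Proof.
elim: S => [|x S [es hes hx]]; first by exists [::].
have sub y : List.In y S -> List.In y (x :: S) by right.
pose p f := \sum_(e <- es) ip f e *: e.
have evp f y : List.In y S -> ev (p f) y = ev f y.
  move=> yS; rewrite -!ip_kv {2}(hx y yS) ip_suml ip_sumr; apply: eq_bigr => e _.
  by rewrite ipZl ipZr -ipC mulrC.
have sp f : span S (p f) by apply: span_sum => e /hes; exact: spanZ.
pose w := kv x - p (kv x).
have w0 y : List.In y S -> ev w y = 0 by move=> yS; rewrite evB evp // subrr.
have [w00|wn0] := eqVneq w 0.
  exists es; first by move=> e /hes; exact: span_sub.
  by move=> y [<-|/hx //]; apply/eqP; rewrite -subr_eq0; apply/eqP.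
have nw : 0 < nrm w by apply: nrm_gt0; apply/eqP.
pose e := ((nrm w)^-1)%:C *: w.
have sw : span (x :: S) w.
  apply: spanB; first by apply: span_kv; left.
  exact: span_sub (sp _).
exists (e :: es).
  by move=> e'; rewrite inE => /orP[/eqP ->|/hes]; [exact: spanZ|exact: span_sub].
have ee f : ip f e *: e = ((nrm w ^+ 2)^-1%:C * ip f w) *: w.
  rewrite /e ipZr scalerA cjR; congr (_ *: _).
  rewrite -exprVn rmorphXn /=; ring.
move=> y [<-|yS]; rewrite big_cons ee; last first.
  by rewrite (ipC w) ip_kv w0 // rmorph0 mulr0 scale0r add0r; exact: hx.
have -> : ip (kv x) w = (nrm w ^+ 2)%:C.
  rewrite -{1}(subrK (p (kv x)) (kv x)) ipDl -/w ipxx (ipC w).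
  by rewrite (@span_ip0 S) // rmorph0 addr0.
rewrite -rmorphM mulVf ?scale1r /=; last by rewrite expf_neq0 // gt_eqF.
by rewrite /w subrK.
Qed.

(** The orthogonal projection onto the span of the kernel functions of [S],
    which is interpolation on [S] by the element of least norm. *)
Lemma span_proj S : exists2 P : hvec H -> hvec H,
  forall f, span S (P f)
  & forall f x, List.In x S -> ev (P f) x = ev f x.
Proof.
have [es hes hx] := span_frame S.
exists (fun f => \sum_(e <- es) ip f e *: e).
  by move=> f; apply: span_sum => e /hes; exact: spanZ.
move=> f y yS; rewrite -!ip_kv {2}(hx y yS) ip_suml ip_sumr; apply: eq_bigr => e _.
by rewrite ipZl ipZr -ipC mulrC.
Qed.

Definition psdk S (Q : X -> X -> R[i]) := forall s, pts_in S s ->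
  0 <= \sum_(p <- s) \sum_(q <- s) p.1^* * q.1 * Q p.2 q.2.

(** The Schur product theorem, for a factor that is the kernel of the space:
    a frame splits that factor into rank one pieces. *)
Lemma psdk_schur S Q : psdk S Q -> psdk S (fun x y => k x y * Q x y).
Proof.
move=> hQ s hs; have [es _ hx] := span_frame S.
have kE x y : List.In x S -> List.In y S ->
    k x y = \sum_(e <- es) ev e x * (ev e y)^*.
  move=> xS yS; rewrite -ev_kv -ip_kv {1}(hx y yS) ip_suml.
  by apply: eq_bigr => e _; rewrite ipZl ip_kv ip_kvl mulrC.
have -> : \sum_(p <- s) \sum_(q <- s) p.1^* * q.1 * (k p.2 q.2 * Q p.2 q.2) =
    \sum_(e <- es) \sum_(p <- scale_pts (fun x => (ev e x)^*) s)
      \sum_(q <- scale_pts (fun x => (ev e x)^*) s) p.1^* * q.1 * Q p.2 q.2.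
  under [RHS]eq_bigr do rewrite big_map.
  rewrite [RHS]exchange_big /=; apply: big_In => p ps.
  under [RHS]eq_bigr do rewrite big_map.
  rewrite [RHS]exchange_big /=.
  apply: big_In => q qs; rewrite kE; try exact: hs.
  rewrite mulr_suml mulr_sumr; apply: eq_bigr => e _.
  by rewrite cjM cjK; ring.
by apply: sumr_ge0 => e _; apply: hQ; exact: pts_in_scale.
Qed.

Section Projection.
Variables (S : seq X) (P : hvec H -> hvec H).
Hypotheses (Pspan : forall f, span S (P f))
  (Pev : forall f x, List.In x S -> ev (P f) x = ev f x).

Lemma proj_eq f g : (forall x, List.In x S -> ev f x = ev g x) -> P f = P g.
Proof. by move=> h; apply: (@span_eq S) => // x xS; rewrite !Pev // h. Qed.

Lemma projPl a f g : P (a *: f + g) = a *: P f + P g.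
Proof.
apply: (@span_eq S) => [//||x xS]; first by apply: spanD => //; exact: spanZ.
by rewrite Pev // !evD !evZ !Pev.
Qed.

Lemma projD f g : P (f + g) = P f + P g.
Proof. by have := projPl 1 f g; rewrite !scale1r. Qed.

Lemma proj0 : P 0 = 0.
Proof. by apply: (addrI (P 0)); rewrite -projD !addr0. Qed.

Lemma projZ a f : P (a *: f) = a *: P f.
Proof. by have := projPl a f 0; rewrite proj0 !addr0. Qed.

Lemma projB f g : P (f - g) = P f - P g.
Proof. by rewrite -scaleN1r projD projZ scaleN1r. Qed.

Lemma proj_sum (I : Type) (r : seq I) (F : I -> hvec H) :
  P (\sum_(i <- r) F i) = \sum_(i <- r) P (F i).
Proof.
by elim: r => [|i r IH]; rewrite ?big_nil ?proj0 // !big_cons projD IH.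
Qed.

Lemma proj_ip f g : span S g -> ip (P f) g = ip f g.
Proof.
move=> hg; apply/eqP; rewrite -subr_eq0 -ipBl (@span_ip0 S) // => x xS.
by rewrite evB Pev // subrr.
Qed.

Lemma proj_best f g : span S g -> nrm (f - P f) <= nrm (f - g).
Proof.
move=> hg; rewrite -(@ler_pXn2r _ 2) ?nnegrE ?nrm_ge0 //.
have -> : f - g = (f - P f) + (P f - g) by rewrite addrA subrK.
rewrite [leRHS]nrmD2 (@span_ip0 S _ (P f - g)); first by have := sqr_ge0 (nrm (P f - g)); rewrite mulr0 addr0; lra.
  exact: spanB.
by move=> x xS; rewrite evB Pev // subrr.
Qed.

Lemma proj_contr f : nrm (P f) <= nrm f.
Proof.
rewrite -(@ler_pXn2r _ 2) ?nnegrE ?nrm_ge0 //.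
rewrite -{2}(subrK (P f) f) nrmD2.
rewrite (@span_ip0 S (f - P f) (P f)) //; first by have := sqr_ge0 (nrm (f - P f)); rewrite mulr0 addr0; lra.
by move=> x xS; rewrite evB Pev // subrr.
Qed.

Lemma proj_mact phi f : P (mact phi (P f)) = P (mact phi f).
Proof. by apply: proj_eq => x xS; rewrite !ev_mact Pev. Qed.

End Projection.

End Kernel.

(** * Norms of multipliers *)

Section MultiplierNorms.
Context {R : realType} {X : Type} (H : rkhs (R := R) X).

Lemma mactDl (phi psi : mult H) f : mact (phi + psi) f = mact phi f + mact psi f.
Proof. by apply: hvec_ext => x; rewrite evD !ev_mact mvD mulrDl. Qed.

Lemma mactZl a (phi : mult H) f : mact (a *: phi) f = a *: mact phi f.
Proof. by apply: hvec_ext => x; rewrite evZ !ev_mact mvZ mulrA. Qed.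

Lemma mactDr (phi : mult H) f g : mact phi (f + g) = mact phi f + mact phi g.
Proof. by apply: hvec_ext => x; rewrite evD !ev_mact evD mulrDr. Qed.

Lemma mactZr a (phi : mult H) f : mact phi (a *: f) = a *: mact phi f.
Proof. by apply: hvec_ext => x; rewrite evZ !ev_mact evZ mulrCA. Qed.

Lemma mact0r (phi : mult H) : mact phi 0 = 0.
Proof. by apply: hvec_ext => x; rewrite ev_mact !ev0 mulr0. Qed.

Lemma mactBr (phi : mult H) f g : mact phi (f - g) = mact phi f - mact phi g.
Proof. by rewrite mactDr -scaleN1r mactZr scaleN1r. Qed.

Lemma mact_sumr (phi : mult H) (I : Type) (r : seq I) (F : I -> hvec H) :
  mact phi (\sum_(i <- r) F i) = \sum_(i <- r) mact phi (F i).
Proof.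
elim: r => [|i r IH]; first by rewrite !big_nil mact0r.
by rewrite !big_cons mactDr IH.
Qed.

Lemma mactM (phi psi : mult H) f : mact (phi * psi) f = mact phi (mact psi f).
Proof. by apply: hvec_ext => x; rewrite !ev_mact mvM mulrA. Qed.

Lemma mact1 f : mact (1 : mult H) f = f.
Proof. by apply: hvec_ext => x; rewrite ev_mact mv1 mul1r. Qed.

Lemma mult_norm_leP (phi : mult H) (C : R) : 0 <= C ->
  (mult_norm phi <= C%:E)%E <-> forall f, nrm (mact phi f) <= C * nrm f.
Proof.
move=> C0; split=> [h f|h]; last first.
  apply: ge_ereal_sup => _ [f [Hf f1] <-]; rewrite lee_fin.
  have := h (mkh Hf); move=> /le_trans; apply.
  by rewrite -[leRHS]mulr1; apply: ler_wpM2l.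
have [->|f0] := eqVneq f 0; first by rewrite mact0r !nrm0 mulr0.
have nf : 0 < nrm f by apply: nrm_gt0; apply/eqP.
pose g := ((nrm f)^-1)%:C *: f.
have ng : nrm g = 1.
  by rewrite nrmZ ger0_normcR ?mulVf ?gt_eqF // invr_ge0 ltW.
have : ((nrm (mact phi g))%:E <= C%:E)%E.
  apply: le_trans h; apply: ereal_sup_ubound; exists g => //.
  by split; [exact: hvecH|rewrite -/(nrm g) ng].
rewrite lee_fin mactZr nrmZ ger0_normcR ?invr_ge0 ?(ltW nf) //.
by rewrite mulrC ler_pdivrMr.
Qed.

(** Tuples of vectors stand for the columns of functions in the tensor product,
    which carry no proof of membership. *)
Definition mapp m (Phi : 'M[mult H]_m) (h : 'I_m -> hvec H) (i : 'I_m) : hvec H :=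
  \sum_l mact (Phi i l) (h l).

Definition tnrm2 m (h : 'I_m -> hvec H) : R := \sum_i nrm (h i) ^+ 2.

Lemma tnrm2_ge0 m (h : 'I_m -> hvec H) : 0 <= tnrm2 h.
Proof. by apply: sumr_ge0 => i _; exact: sqr_ge0. Qed.

Lemma mappZ m (Phi : 'M[mult H]_m) a (h : 'I_m -> hvec H) i :
  mapp Phi (fun l => a *: h l) i = a *: mapp Phi h i.
Proof.
by rewrite /mapp scaler_sumr; apply: eq_bigr => l _; rewrite mactZr.
Qed.

Lemma tnrm2Z m a (h : 'I_m -> hvec H) :
  tnrm2 (fun l => a *: h l) = normc a ^+ 2 * tnrm2 h.
Proof.
by rewrite /tnrm2 mulr_sumr; apply: eq_bigr => l _; rewrite nrmZ exprMn.
Qed.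

Lemma tensor_normE m (h : 'I_m -> hvec H) :
  tensor_norm H (\col_i (hfun (h i))) = Num.sqrt (tnrm2 h).
Proof. by congr Num.sqrt; apply: eq_bigr => i _; rewrite mxE. Qed.

Lemma mul_mappE m (Phi : 'M[mult H]_m) (h : 'I_m -> hvec H) :
  map_mx (@mult_fun R X H) Phi *m \col_i (hfun (h i)) = \col_i hfun (mapp Phi h i).
Proof.
apply/matrixP => i j; rewrite !mxE; apply/funext => x.
rewrite -[RHS]/(ev (mapp Phi h i) x) ev_sum fct_sumE.
by apply: eq_bigr => l _; rewrite !mxE.
Qed.

Lemma mult_mxnorm_leP m (Phi : 'M[mult H]_m) (C : R) : 0 <= C ->
  (mult_mxnorm Phi <= C%:E)%E <->
  forall h, tnrm2 (mapp Phi h) <= C ^+ 2 * tnrm2 h.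
Proof.
move=> C0; split=> [hC h|hC]; last first.
  apply: ge_ereal_sup => _ [F [tF F1] <-]; rewrite lee_fin.
  pose h i := mkh (tF i).
  have EF : F = \col_i hfun (h i).
    by apply/matrixP => i j; rewrite mxE (ord1 j).
  rewrite EF mul_mappE tensor_normE; move: F1; rewrite EF tensor_normE => F1.
  rewrite -(@ler_pXn2r _ 2) ?nnegrE ?sqrtr_ge0 // sqr_sqrtr ?tnrm2_ge0 //.
  apply: le_trans (hC h) _; rewrite -[leRHS]mulr1.
  apply: ler_wpM2l; first exact: sqr_ge0.
  by rewrite -[tnrm2 h]sqr_sqrtr ?tnrm2_ge0 // expr_le1 ?sqrtr_ge0.
have := tnrm2_ge0 h; rewrite le_eqVlt => /orP[/eqP h0|hp].
  have hz l : h l = 0.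
    apply: nrm_eq0; apply/eqP; rewrite -[_ == 0](@expf_eq0 _ _ 2) /=.
    have := h0; rewrite /tnrm2 => /esym/eqP; rewrite psumr_eq0 //.
    by move=> /allP /(_ l (mem_index_enum _)) /implyP /(_ isT).
    by move=> *; exact: sqr_ge0.
  rewrite -h0 mulr0 /tnrm2 big1 // => i _.
  by rewrite /mapp big1 ?nrm0 ?expr0n // => l _; rewrite hz mact0r.
pose c := Num.sqrt (tnrm2 h); have cp : 0 < c by rewrite sqrtr_gt0.
pose g l := (c^-1)%:C *: h l.
have nc : normc (c^-1)%:C = c^-1 by rewrite ger0_normcR // invr_ge0 ltW.
have cc : c ^+ 2 = tnrm2 h by rewrite sqr_sqrtr // tnrm2_ge0.
have ng : tnrm2 g = 1 by rewrite tnrm2Z nc exprVn cc mulVf ?gt_eqF.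
have : ((Num.sqrt (tnrm2 (mapp Phi g)))%:E <= C%:E)%E.
  apply: le_trans hC; apply: ereal_sup_ubound; exists (\col_i hfun (g i)).
    split; first by move=> i; rewrite mxE; exact: hvecH.
    by rewrite tensor_normE ng sqrtr1.
  by rewrite mul_mappE tensor_normE.
rewrite lee_fin -(@ler_pXn2r _ 2) ?nnegrE ?sqrtr_ge0 // sqr_sqrtr ?tnrm2_ge0 //.
have -> : tnrm2 (mapp Phi g) = (c^-1) ^+ 2 * tnrm2 (mapp Phi h).
  by rewrite -nc -tnrm2Z; apply: eq_bigr => i _; rewrite mappZ.
by rewrite exprVn cc mulrC ler_pdivrMr.
Qed.

End MultiplierNorms.

(** * The complete Pick property *)

Section CompletePick.
Context {R : realType} {X : Type} (H : rkhs (R := R) X) (k : X -> X -> R[i]).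
Hypothesis hk : is_kernel H k.
Notation kv := (kv hk).
Notation lcomb := (lcomb hk).

Definition row_contr d (phi : 'I_d -> mult H) := forall h : 'I_d -> hvec H,
  nrm (\sum_l mact (phi l) (h l)) ^+ 2 <= \sum_l nrm (h l) ^+ 2.

Lemma psd_kernel n (x : 'I_n -> X) (c : 'I_n -> R[i]) :
  0 <= \sum_i \sum_j (c i)^* * c j * k (x i) (x j).
Proof.
have -> : \sum_i \sum_j (c i)^* * c j * k (x i) (x j) =
    ip (\sum_j c j *: kv (x j)) (\sum_j c j *: kv (x j)).
  rewrite ip_sumr; apply: eq_bigr => i _; rewrite ipZr ip_kv ev_sum mulr_sumr.
  by apply: eq_bigr => j _; rewrite evZ ev_kv mulrA.
exact: ip_ge0.
Qed.

Lemma block_form n m (B : 'I_n -> 'I_n -> 'M[R[i]]_m)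
    (v : 'cV[R[i]]_(\sum_(i < n) m)) :
  (v ^t* *m (\mxblock_(i < n, j < n) B i j) *m v) 0 0 =
  \sum_i \sum_j \sum_a \sum_b
     (submxcol v i a 0)^* * B i j a b * submxcol v j b 0.
Proof.
have cE (A : 'rV[R[i]]_(\sum_(i < n) m)) (C : 'I_n -> 'cV[R[i]]_m) :
    A *m \mxcol_i C i = \sum_i submxrow A i *m C i.
  by rewrite -{1}[A]submxrowK mul_mxrow_mxcol.
rewrite -mulmxA -{2}[v]submxcolK mul_mxblock_mxrow cE summxE.
apply: eq_bigr => i _; rewrite mulmx_sumr summxE; apply: eq_bigr => j _.
rewrite !mxE; apply: eq_bigr => a _; rewrite !mxE mulr_sumr; apply: eq_bigr => b _.
by rewrite !mxE mulrA.
Qed.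

Section Pick.
Hypothesis hNP : complete_NP H k.

(** The complete Pick property for rows, obtained from square matrices that
    have a single nonzero row. *)
Lemma pick_row n d (x : 'I_n -> X) (w : 'I_n -> 'I_d.+1 -> R[i]) :
  (forall c : 'I_n -> R[i], 0 <= \sum_i \sum_j (c i)^* * c j *
     (k (x i) (x j) * (1 - \sum_l w i l * (w j l)^*))) ->
  exists phi : 'I_d.+1 -> mult H,
    (forall i l, mv (phi l) (x i) = w i l) /\ row_contr phi.
Proof.
move=> hw.
pose W i : 'M[R[i]]_d.+1 := \matrix_(a, b) (if a == ord0 then w i b else 0).
have WW i j a b : (W i *m (W j) ^t*) a b =
    if (a == ord0) && (b == ord0) then \sum_l w i l * (w j l)^* else 0.
  rewrite !mxE; case: eqP => [->|/eqP a0] /=; last first.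
    by rewrite big1 // => l _; rewrite !mxE (negbTE a0) mul0r.
  case: eqP => [->|/eqP b0] /=; last first.
    by rewrite big1 // => l _; rewrite !mxE (negbTE b0) conjC0 mulr0.
  by apply: eq_bigr => l _; rewrite !mxE eqxx.
have BE i j a b : (k (x i) (x j) *: (1%:M - W i *m (W j) ^t*)) a b =
    k (x i) (x j) * ((a == b)%:R -
      if (a == ord0) && (b == ord0) then \sum_l w i l * (w j l)^* else 0).
  by rewrite -WW !mxE.
have [] := @hNP d.+1 n x W.
  move=> v; rewrite block_form.
  have -> : \sum_i \sum_j \sum_a \sum_b (submxcol v i a 0)^* *
      (k (x i) (x j) *: (1%:M - W i *m (W j) ^t*)) a b * submxcol v j b 0 =
    \sum_a \sum_i \sum_j (submxcol v i a 0)^* * submxcol v j a 0 *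
      (k (x i) (x j) * (1 - (if a == ord0 then \sum_l w i l * (w j l)^* else 0))).
    rewrite [RHS]exchange_big; apply: eq_bigr => i _; rewrite [RHS]exchange_big.
    apply: eq_bigr => j _; apply: eq_bigr => a _.
    rewrite (bigD1 a) //= big1 ?addr0; last first.
      move=> b ba; rewrite BE eq_sym (negbTE ba).
      have -> : (a == ord0) && (b == ord0) = false.
        by apply/negP => /andP[/eqP a0 /eqP b0]; rewrite a0 b0 eqxx in ba.
      by rewrite subrr !mulr0 mul0r.
    rewrite BE eqxx andbb.
    by rewrite mulrAC.
  apply: sumr_ge0 => a _; case: eqP => _; first exact: hw.
  under eq_bigr do under eq_bigr do rewrite subr0 mulr1.
  exact: psd_kernel.
move=> Phi [hPhi nPhi]; exists (fun l => Phi ord0 l); split.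
  by move=> i l; have /matrixP/(_ ord0 l) := hPhi i; rewrite !mxE eqxx.
move=> h; have /mult_mxnorm_leP /(_ h) := nPhi; rewrite expr1n mul1r => /(_ ler01).
move=> le1; apply: le_trans le1; rewrite /tnrm2 [leRHS](bigD1 ord0) //= lerDl.
by apply: sumr_ge0 => *; exact: sqr_ge0.
Qed.

End Pick.

(** The adjoint of a row contraction multiplies kernel functions by scalars. Its
    contractivity on combinations of them is the positivity of [row_defect]. *)
Lemma row_contr_adj d (phi : 'I_d -> mult H) s : row_contr phi ->
  \sum_l nrm (lcomb (scale_pts (fun x => (mv (phi l) x)^*) s)) ^+ 2
    <= nrm (lcomb s) ^+ 2.
Proof.
move=> hphi; set h := fun l => lcomb (scale_pts (fun x => (mv (phi l) x)^*) s).
have E : (\sum_l nrm (h l) ^+ 2)%:C = ip (\sum_l mact (phi l) (h l)) (lcomb s).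
  rewrite rc_sum ip_suml; apply: eq_bigr => l _.
  by rewrite ip_mact_lcomb ipxx.
have h1 := cauchy_schwarz (\sum_l mact (phi l) (h l)) (lcomb s).
rewrite -E ger0_normcR in h1; last by apply: sumr_ge0 => *; exact: sqr_ge0.
have h2 := hphi h.
set T := \sum_l _ in h1 h2 *; set p := nrm (lcomb s) in h1 *.
set q := nrm _ in h1 h2.
have T0 : 0 <= T by apply: sumr_ge0 => *; exact: sqr_ge0.
have p0 : 0 <= p := nrm_ge0 _; have q0 : 0 <= q := nrm_ge0 _.
have : T * T <= T * p ^+ 2.
  have : T ^+ 2 <= (q * p) ^+ 2 by rewrite ler_pXn2r ?nnegrE ?mulr_ge0.
  by rewrite exprMn; have := sqr_ge0 p => *; nra.
have [->|Tn0] := eqVneq T 0; first by rewrite sqr_ge0.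
by rewrite ler_pM2l // lt_neqAle eq_sym Tn0.
Qed.

Definition row_defect d (phi : 'I_d -> mult H) x y : R[i] :=
  k x y * (1 - \sum_l mv (phi l) x * (mv (phi l) y)^*).

Lemma row_defect_psd d (phi : 'I_d -> mult H) s : row_contr phi ->
  0 <= \sum_(p <- s) \sum_(q <- s) p.1^* * q.1 * row_defect phi p.2 q.2.
Proof.
move=> /(@row_contr_adj _ phi s); rewrite -subr_ge0 -ler0c rmorphB /= rc_sum.
rewrite nrm_lcomb2; under [X in _ - X]eq_bigr do rewrite nrm_lcomb2.
congr (0 <= _); rewrite /scale_pts.
under [X in _ - X]eq_bigr do rewrite big_map.
rewrite [X in _ - X]exchange_big -sumrB; apply: eq_bigr => p _.
under [X in _ - X]eq_bigr do rewrite big_map.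
rewrite [X in _ - X]exchange_big -sumrB; apply: eq_bigr => q _.
rewrite /row_defect mulrBr mulr1 mulrBr; congr (_ - _).
rewrite !mulr_sumr; apply: eq_bigr => l _ /=; rewrite cjM cjK; ring.
Qed.

(** In a positive semidefinite form a null vector is orthogonal to every vector:
    take [a] to be a small negative multiple of [d]. *)
Lemma psd_form2_eq (q : R) (d : R[i]) :
  (forall a : R[i], 0 <= normc a ^+ 2 * q + 2 * Re (a^* * d)) -> d = 0.
Proof.
move=> h.
have q1 : 0 < `|q| + 1 by rewrite ltr_wpDl.
pose t := (`|q| + 1)^-1.
have t0 : 0 < t by rewrite invr_gt0.
have := h ((- t)%:C * d); rewrite cjM cjR -mulrA mulJc ReZ rcK.
rewrite normcM normcR normrN ger0_norm ?(ltW t0) // exprMn => h1.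
have tq : t * q < 1.
  rewrite /t mulrC ltr_pdivrMr // mul1r; have := ler_norm q; lra.
have n0 := sqr_ge0 (normc d).
apply/eqP; rewrite -normc_eq0 -[_ == 0](@expf_eq0 _ _ 2) /= eq_le n0 andbT.
have : 0 <= t * (normc d ^+ 2 * (t * q - 2)) by lra.
rewrite pmulr_rge0 // => h2; nra.
Qed.

Section Normalized.
Hypothesis hNP : complete_NP H k.
Variable x0 : X.
Hypothesis hnorm1 : normalized k x0.
Hypothesis hk0 : forall x y, k x y <> 0.

Lemma k_neq0 x y : k x y != 0. Proof. exact/eqP/hk0. Qed.

Lemma kx0 x : k x0 x = 1. Proof. by rewrite (kernelC hk) hnorm1 conjC1. Qed.

(** The kernel of the ball into which a normalized complete Pick space embeds:
    [k = 1 / (1 - pickF)]. *)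
Definition pickF x y : R[i] := 1 - (k x y)^-1.

Lemma pickFC x y : pickF y x = (pickF x y)^*.
Proof. by rewrite /pickF cjB cj1 (kernelC hk) fmorphV. Qed.

Lemma pickFx0 x : pickF x x0 = 0.
Proof. by rewrite /pickF hnorm1 invr1 subrr. Qed.

Lemma k_pickF x y : k x y * (1 - pickF x y) = 1.
Proof. by rewrite /pickF subKr divff // k_neq0. Qed.

(** One of the two points ranges over [S], the other one over the whole set. In
    this form the interpolating multipliers act as coordinates of an embedding
    into a ball. *)
Definition pick_coords S d (phi : 'I_d -> mult H) := row_contr phi /\
  forall y, List.In y S -> forall x,
    \sum_l mv (phi l) x * (mv (phi l) y)^* = pickF x y.

(** The defect kernel is 1 on [S], so that differences of point masses in [S]
    are null vectors of it. By [psd_form2_eq] it is then 1 as soon as one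
    argument is in [S]. *)
Lemma pick_coords_extend d (phi : 'I_d -> mult H) S :
  row_contr phi -> List.In x0 S ->
  (forall x y, List.In x S -> List.In y S ->
     \sum_l mv (phi l) x * (mv (phi l) y)^* = pickF x y) ->
  pick_coords S phi.
Proof.
move=> hphi x0S hS; split=> // y yS x.
have phi0 l : mv (phi l) x0 = 0.
  have := hS x0 x0 x0S x0S; rewrite pickFx0 => /eqP.
  rewrite psumr_eq0 => [|i _]; last by rewrite mulcJ ler0c sqr_ge0.
  move=> /allP/(_ l (mem_index_enum _))/implyP/(_ isT).
  by rewrite mulf_eq0 conjC_eq0 orbb => /eqP.
have Q0 z : row_defect phi z x0 = 1.
  rewrite /row_defect hnorm1 mul1r big1 ?subr0 // => l _.
  by rewrite phi0 conjC0 mulr0.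
have QS z z' : List.In z S -> List.In z' S -> row_defect phi z z' = 1.
  by move=> zS z'S; rewrite /row_defect hS // k_pickF.
have QC z z' : row_defect phi z z' = (row_defect phi z' z)^*.
  rewrite /row_defect cjM -(kernelC hk) cjB cj1 cj_sum; congr (_ * (_ - _)).
  by apply: eq_bigr => l _; rewrite cjM cjK mulrC.
have Qxx : row_defect phi x x = (Re (row_defect phi x x))%:C.
  have := row_defect_psd [:: (1, x)] hphi; rewrite !big_seq1 /= conjC1 !mul1r.
  by move=> /ger0_real/RRe_real.
have E : row_defect phi x x0 - row_defect phi x y = 0.
  apply: (@psd_form2_eq (Re (row_defect phi x x))) => a.
  have := row_defect_psd [:: (a, x); (1, x0); (-1, y)] hphi.
  rewrite !big_cons !big_nil /= !addr0 cj1 cjN cj1 (QS x0 y) // (QS y x0) //.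
  rewrite (QS y y) // (QS x0 x0) // (QC x0 x) (QC y x) Qxx.
  set q := Re _; set u := row_defect phi x x0; set v := row_defect phi x y.
  rewrite -ler0c => h; apply: le_trans h _.
  rewrite rcK rcD rcM -mulJc [(2 * _)%:C]rcM.
  have -> : (2 : R)%:C * (Re (a^* * (u - v)))%:C = a^* * (u - v) + (a^* * (u - v))^*.
    by rewrite [RHS]addcJ rc_nat.
  rewrite (cjM a^*) cjK cjB le_eqVlt; apply/orP; left; apply/eqP; ring.
have := Q0 x; move/eqP: E; rewrite subr_eq0 => /eqP ->.
rewrite /row_defect => /(canRL (mulKf (k_neq0 x y))).
rewrite mulr1 /pickF => <-; ring.
Qed.

(** A point at a time, the coordinates already found fall short of the
    diagonal value [pickF x x] by a nonnegative amount, which a new coordinate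
    makes up for (the proof of the McCullough--Quiggin theorem by Knese). *)
Lemma pick_coords_exist S :
  exists d (phi : 'I_d -> mult H), pick_coords (rcons S x0) phi.
Proof.
elim: S => [|x S [d [phi [hphi hS]]]].
  exists 0%N, (fun=> 0); apply: pick_coords_extend => /=; last 2 first.
  - by left.
  - by move=> x y _ [<-|//]; rewrite big_ord0 pickFx0.
  by move=> h; rewrite !big_ord0 nrm0 expr0n.
have x0S : List.In x0 (rcons S x0) by elim: S {hS} => [|a S IH]; [left|right].
pose rho : R := Re (pickF x x) - \sum_l normc (mv (phi l) x) ^+ 2.
have kxx : k x x = (nrm (kv x) ^+ 2)%:C by rewrite nrm2_kv.
have kp : 0 < nrm (kv x) ^+ 2.
  rewrite lt_neqAle sqr_ge0 andbT eq_sym; apply/eqP => h.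
  by have := @hk0 x x; rewrite kxx h.
have rho_ge0 : 0 <= rho.
  have := row_defect_psd [:: (1, x); (-1, x0)] hphi.
  rewrite !big_cons !big_nil /= !addr0 cjN cj1 /row_defect.
  have -> : \sum_l mv (phi l) x0 * (mv (phi l) x)^* =
      (\sum_l mv (phi l) x * (mv (phi l) x0)^*)^*.
    by rewrite cj_sum; apply: eq_bigr => l _; rewrite cjM cjK mulrC.
  rewrite !(hS x0 x0S) !pickFx0 cj0 hnorm1 kx0 hnorm1 kxx.
  under eq_bigr do rewrite mulcJ.
  rewrite -rc_sum /rho /pickF kxx -fmorphV ReB !rcK.
  set T := \sum_l _; set K := _ ^+ 2 in kp *.
  rewrite (_ : _ + _ = (K * (1 - T) - 1)%:C); last first.
    rewrite rcB rcM rcB; ring.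
  rewrite ler0c => h.
  rewrite (_ : 1 - K^-1 - T = K^-1 * (K * (1 - T) - 1)); last by field; rewrite gt_eqF.
  apply: mulr_ge0; first by rewrite invr_ge0 ltW.
  lra.
pose r := (Num.sqrt rho)%:C : R[i].
have rr : r * r^* = rho%:C by rewrite cjR -rmorphM -expr2 sqr_sqrtr.
pose T := x :: rcons S x0.
pose pt (i : 'I_(size T)) := nth x0 T i.
pose w (i : 'I_(size T)) (l : 'I_d.+1) : R[i] :=
  oapp (fun l' => mv (phi l') (pt i)) (if val i == 0%N then r else 0) (unlift ord0 l).
have ptS (i : 'I_(size T)) : val i != 0%N -> List.In (pt i) (rcons S x0).
  case: i => [[|i]] //= hi _; rewrite /pt /=.
  have : (i < size (rcons S x0))%N by [].
  elim: (rcons S x0) i {hi} => [//|a L IH] [|i] hi /=; first by left.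
  by right; apply: IH.
have wE i j : \sum_l w i l * (w j l)^* = pickF (pt i) (pt j).
  rewrite big_ord_recl /w unlift_none /=.
  under eq_bigr do rewrite liftK /=.
  have [i0|i0] := eqVneq (val i) 0%N; have [j0|j0] := eqVneq (val j) 0%N.
  - have -> : pt i = x by rewrite /pt i0.
    have -> : pt j = x by rewrite /pt j0.
    under eq_bigr do rewrite mulcJ.
    rewrite rr -rc_sum -rmorphD /= /rho subrK.
    rewrite /pickF kxx -fmorphV ReB !rcK.
    by rewrite rmorphB.
  - by rewrite conjC0 mulr0 add0r hS //; exact: ptS.
  - rewrite mul0r add0r -[LHS]conjCK cj_sum.
    under eq_bigr do rewrite cjM cjK mulrC.
    by rewrite hS; [rewrite -pickFC|exact: ptS].
  - by rewrite mul0r add0r hS //; exact: ptS.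
have [] := @pick_row hNP _ _ pt w.
  move=> c.
  have -> : \sum_i \sum_j (c i)^* * c j *
      (k (pt i) (pt j) * (1 - \sum_l w i l * (w j l)^*)) =
      (normc (\sum_i c i) ^+ 2)%:C.
    rewrite -mulJc cj_sum mulr_suml; apply: eq_bigr => i _.
    rewrite mulr_sumr; apply: eq_bigr => j _.
    by rewrite wE k_pickF mulr1.
  by rewrite ler0c sqr_ge0.
move=> psi [hpsi cpsi]; exists d.+1, psi; apply: pick_coords_extend => //.
  by right.
have InT z : List.In z T -> exists i, z = pt i.
  suff h : forall L : seq X, List.In z L -> exists2 i, (i < size L)%N & z = nth x0 L i.
    by move=> /h[i hi zi]; exists (Ordinal hi).
  elim=> [//|a L IH] /= [->|/IH[i hi ->]]; first by exists 0%N.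
  by exists i.+1.
move=> _ _ /InT[i ->] /InT[j ->]; rewrite -wE; apply: eq_bigr => l _.
by rewrite !hpsi.
Qed.

End Normalized.

End CompletePick.

(** * Column contractions *)

Section CauchySchwarz2.
Context {R : realType}.

(** A linear combination of the two entries of the column [(tau f, N - tau^2) /
    N]. *)
Definition col_entry (al be : R[i]) (tau : R) (fx Nx : R[i]) : R[i] :=
  (al * tau%:C * fx + be * (Nx - (tau ^+ 2)%:C)) / Nx.

Lemma cauchy2 (a b u v : R) : 0 <= a -> 0 <= b ->
  a ^+ 2 + b ^+ 2 <= 1 -> (a * u + b * v) ^+ 2 <= u ^+ 2 + v ^+ 2.
Proof.
move=> a0 b0 h; have := sqr_ge0 (a * v - b * u).
have := sqr_ge0 u; have := sqr_ge0 v; nra.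
Qed.

End CauchySchwarz2.

Section ColumnContraction.
Context {R : realType} {X : Type} (H : rkhs (R := R) X) (k : X -> X -> R[i]).
Hypothesis hk : is_kernel H k.
Notation kv := (kv hk).
Notation lcomb := (lcomb hk).
Notation span := (span hk).
Hypothesis hNP : complete_NP H k.
Hypothesis hirr : irreducible_kernel k.
Variable x0 : X.
Hypothesis hnorm1 : normalized k x0.

Let hk0 : forall x y, k x y <> 0. Proof. by case: hirr. Qed.

Notation one := (kv x0).

Lemma ev_one x : ev one x = 1. Proof. exact: hnorm1. Qed.

Lemma nrm_one : nrm one = 1.
Proof.
have : (nrm one ^+ 2)%:C = 1%:C by rewrite nrm2_kv hnorm1.
by move=> /complexI/eqP; rewrite sqrf_eq1 => /orP[/eqP //|/eqP h];
  have := nrm_ge0 one; rewrite h ler0N1.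
Qed.

Lemma ip_one f : ip f one = ev f x0. Proof. exact: ip_kv. Qed.

Lemma ev_mact_one phi x : ev (mact phi one) x = mv phi x.
Proof. by rewrite ev_mact ev_one mulr1. Qed.

(** Equal coordinates at [x] and [y] would make [pickF] and hence [k] agree on
    the two points, against irreducibility. *)
Lemma multiplier_separates x y : x <> y ->
  exists2 m : mult H, mv m y = 0 & mv m x <> 0.
Proof.
move=> xy.
have [d [phi [_ hphi]]] := pick_coords_exist hk hNP hnorm1 hk0 [:: x; y].
have [[l hl]|hall] := pselect (exists l, mv (phi l) x <> mv (phi l) y).
  exists (phi l - mv (phi l) y *: (1 : mult H)); first by rewrite mvB mvZ mv1 mulr1 subrr.
  by rewrite mvB mvZ mv1 mulr1 => /eqP; rewrite subr_eq0 => /eqP.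
have e l : mv (phi l) x = mv (phi l) y.
  by apply: contrapT => h; apply: hall; exists l.
have kxy z : k z x = k z y.
  have : pickF k z x = pickF k z y.
    rewrite -!hphi /=; [|by right; left|by left].
    by apply: eq_bigr => l _; rewrite e.
  by move/(congr1 (fun t => (1 - t)^-1)); rewrite /pickF !subKr !invrK.
have [h1 _] : (1 : R[i]) = 0 /\ (-1 : R[i]) = 0.
  apply: (hirr.2 x y xy); apply/funext => z.
  by rewrite -[LHS]/(1 * k z x + -1 * k z y) kxy mul1r mulN1r subrr.
by move/eqP: h1; rewrite oner_eq0.
Qed.

Lemma multiplier_bump x S : ~ List.In x S ->
  exists2 m : mult H, forall y, List.In y S -> mv m y = 0 & mv m x <> 0.
Proof.
elim: S => [|y S IH] xS.
  by exists 1 => //; rewrite mv1; apply/eqP; exact: oner_neq0.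
have [|m hm mx] := IH; first by move=> h; apply: xS; right.
have [|m' hm' m'x] := @multiplier_separates x y.
  by move=> e; apply: xS; left.
exists (m * m').
  by move=> z [<-|/hm e]; rewrite mvM ?hm' ?mulr0 // e mul0r.
by rewrite mvM; apply/eqP; rewrite mulf_neq0 //; apply/eqP.
Qed.

Lemma interpolation S (u : X -> R[i]) :
  exists v : hvec H, forall x, List.In x S -> ev v x = u x.
Proof.
elim: S => [|x S [v hv]]; first by exists 0.
have [xS|xS] := pselect (List.In x S).
  by exists v => y [<-|/hv //]; exact: hv.
have [m hm /eqP mx] := multiplier_bump xS.
exists (v + ((u x - ev v x) / mv m x) *: mact m one) => y yS.
rewrite evD evZ ev_mact_one; case: yS => [<-|yS].
  by rewrite divfK // addrC subrK.
by rewrite (hm y yS) mulr0 addr0 hv.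
Qed.

Section FiniteSet.
Variables (f : mult H) (S : seq X) (P : hvec H -> hvec H).
Hypotheses (Pspan : forall f, span S (P f))
  (Pev : forall f x, List.In x S -> ev (P f) x = ev f x).

Let fS := P (mact f one).
Let xi x := P (mact f (kv x)).
Let N x := ip fS (xi x).
Let sigma : R := nrm fS ^+ 2.

Let xi_lcomb s : \sum_(p <- s) p.1 *: xi p.2 = P (mact f (lcomb s)).
Proof.
rewrite /lcomb mact_sumr (proj_sum Pspan Pev); apply: eq_bigr => p _.
by rewrite mactZr (projZ Pspan Pev).
Qed.

(** On the span, [k_x f - f] is the image of the coordinates of [x] times
    [k_x f] under a row contraction, because [k_x - 1 = pickF k_x]. *)
Lemma row_estimate s : pts_in S s ->
  (nrm (\sum_(p <- s) p.1 *: (xi p.2 - fS)) ^+ 2)%:C <=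
  \sum_(p <- s) \sum_(q <- s) p.1^* * q.1 * (pickF k p.2 q.2 * ip (xi q.2) (xi p.2)).
Proof.
move=> hs; have [d [phi [cphi hphi]]] := pick_coords_exist hk hNP hnorm1 hk0 S.
have hphiS y : List.In y S ->
    forall x, \sum_l mv (phi l) x * (mv (phi l) y)^* = pickF k x y.
  move=> yS; apply: hphi; elim: S yS => [//|a L IH] /= [->|/IH h]; first by left.
  by right.
pose h l := \sum_(p <- s) (p.1 * (mv (phi l) p.2)^*) *: mact f (kv p.2).
have hE : \sum_l mact (phi l) (h l) =
    \sum_(p <- s) p.1 *: (mact f (kv p.2) - mact f one).
  apply: hvec_ext => z; rewrite !ev_sum.
  under eq_bigr do rewrite ev_mact ev_sum mulr_sumr.
  rewrite exchange_big; apply: big_In => p ps.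
  rewrite evZ evB !ev_mact ev_one ev_kv.
  under eq_bigr do rewrite evZ ev_mact ev_kv.
  transitivity (pickF k z p.2 * (p.1 * (mv f z * k z p.2))).
    rewrite -hphiS; last exact: hs.
    by rewrite mulr_suml; apply: eq_bigr => l _; ring.
  have kp := @k_neq0 _ _ k hk0 z p.2.
  by rewrite /pickF; field.
have -> : \sum_(p <- s) p.1 *: (xi p.2 - fS) =
    P (\sum_l mact (phi l) (P (h l))).
  rewrite (proj_sum Pspan Pev).
  under [RHS]eq_bigr do rewrite (proj_mact Pspan Pev).
  rewrite -(proj_sum Pspan Pev) hE (proj_sum Pspan Pev); apply: eq_bigr => p _.
  by rewrite (projZ Pspan Pev) (projB Pspan Pev).
have le1 : nrm (P (\sum_l mact (phi l) (P (h l)))) ^+ 2 <=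
    \sum_l nrm (P (h l)) ^+ 2.
  apply: le_trans (cphi _); rewrite ler_pXn2r ?nnegrE ?nrm_ge0 //.
  exact: proj_contr Pspan Pev _.
apply: (@le_trans _ _ (\sum_l nrm (P (h l)) ^+ 2)%:C); first by rewrite lecR.
rewrite le_eqVlt rc_sum; apply/orP; left; apply/eqP.
transitivity (\sum_l \sum_(p <- s) \sum_(q <- s)
    p.1^* * q.1 * (mv (phi l) p.2 * (mv (phi l) q.2)^* * ip (xi q.2) (xi p.2))).
  apply: eq_bigr => l _.
  have -> : P (h l) = \sum_(p <- s) (p.1 * (mv (phi l) p.2)^*) *: xi p.2.
    rewrite /h (proj_sum Pspan Pev); apply: eq_bigr => p _.
    by rewrite (projZ Pspan Pev).
  rewrite -ipxx ip_sumr; apply: eq_bigr => p _.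
  rewrite ipZr ip_suml mulr_sumr; apply: eq_bigr => q _.
  by rewrite ipZl cjM cjK; ring.
rewrite exchange_big; apply: eq_bigr => p _.
rewrite exchange_big; apply: big_In => q qs.
rewrite -hphiS; last exact: hs.
by rewrite mulr_suml mulr_sumr.
Qed.

(** [row_estimate] says that [G] is a positive kernel on [S]. By the Schur
    product theorem so is [k G], and its value on the coefficients of [g] is the
    difference of the two sides. *)
Lemma column_estimate g q : span S g -> span S q ->
  (forall x, List.In x S -> ev q x = N x * ev g x) ->
  nrm (P (mact f g)) ^+ 2 <= 2 * Re (ip q g) - sigma * nrm g ^+ 2.
Proof.
move=> [s hs ->] sq hq.
pose G x y := N x + (N y)^* - sigma%:C - ip (xi y) (xi x) * (1 - pickF k x y).
have psdG : psdk S G.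
  move=> t ht; have := row_estimate ht; rewrite -subr_ge0.
  congr (0 <= _); rewrite -ipxx ip_sumr -sumrB; apply: eq_bigr => p _.
  rewrite ipZr ip_suml mulr_sumr -sumrB; apply: eq_bigr => r _.
  rewrite ipZl ipBl !ipBr ipxx -/sigma /G /N -(ipC fS); ring.
have := psdk_schur hk psdG hs.
have -> : \sum_(p <- s) \sum_(r <- s) p.1^* * r.1 * (k p.2 r.2 * G p.2 r.2) =
    ip q (lcomb s) + (ip q (lcomb s))^* - sigma%:C * (nrm (lcomb s) ^+ 2)%:C
    - (nrm (P (mact f (lcomb s))) ^+ 2)%:C.
  have E1 : ip q (lcomb s) =
      \sum_(p <- s) \sum_(r <- s) p.1^* * r.1 * (k p.2 r.2 * N p.2).
    rewrite ip_lcomb; apply: big_In => p ps; rewrite hq; last exact: hs.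
    rewrite /lcomb ev_sum !mulr_sumr; apply: eq_bigr => r _.
    by rewrite evZ ev_kv; ring.
  have E2 : (ip q (lcomb s))^* =
      \sum_(p <- s) \sum_(r <- s) p.1^* * r.1 * (k p.2 r.2 * (N r.2)^*).
    rewrite E1 cj_sum; under eq_bigr do rewrite cj_sum.
    rewrite exchange_big; apply: eq_bigr => p _; apply: eq_bigr => r _.
    by rewrite !cjM cjK -(kernelC hk); ring.
  rewrite E2 E1 nrm_lcomb2 -xi_lcomb -ipxx ip_sumr mulr_sumr -!(big_split, sumrB) /=.
  apply: eq_bigr => p _.
  rewrite ipZr ip_suml !mulr_sumr -!(big_split, sumrB) /=.
  apply: eq_bigr => r _; rewrite ipZl /G.
  have kp := @k_neq0 _ _ k hk0 p.2 r.2.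
  by rewrite /pickF; field.
rewrite addcJ -rcM -rc_nat -rcM -!rcB ler0c => h.
by move: h; rewrite subr_ge0.
Qed.

Hypothesis sigma_gt0 : 0 < nrm fS.

Lemma column_Re x : List.In x S -> sigma <= 2 * Re (N x).
Proof.
move=> xS; have [v hv] := interpolation S (fun z => N z * k z x).
have := @column_estimate (kv x) (P v) (span_kv hk xS) (Pspan v).
move=> /(_ (fun z zS => etrans (Pev v zS) (hv z zS))).
rewrite ip_kv Pev // hv // -(nrm2_kv hk) (mulrC (N x)) ReZ.
have kp : 0 < nrm (kv x) ^+ 2.
  rewrite exprn_gt0 // nrm_gt0 // => h; apply: (@hk0 x x).
  by rewrite -[LHS]/(ev (kv x) x) h.
have := sqr_ge0 (nrm (P (mact f (kv x)))) => h0 h1.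
have : 0 <= nrm (kv x) ^+ 2 * (2 * Re (N x) - sigma) by lra.
by rewrite pmulr_rge0 // subr_ge0.
Qed.

Lemma column_neq0 x : List.In x S -> N x != 0.
Proof.
move=> /column_Re h; apply/eqP => N0; move: h; rewrite N0 mulr0.
by rewrite leNgt exprn_gt0.
Qed.

(** For [g = q / N] the adjoint of the multiplier maps [lcomb s] to [q], while
    [E] is the multiplier applied to [q]; [column_estimate] gives [|E| <= |q|]. *)
Lemma column_contr_fin (al be : R[i]) s : pts_in S s ->
  normc al ^+ 2 + normc be ^+ 2 <= 1 ->
  nrm (lcomb (scale_pts (fun x => (col_entry al be (nrm fS) (mv f x) (N x))^*) s))
    <= nrm (lcomb s).
Proof.
move=> hs ab; pose e x := col_entry al be (nrm fS) (mv f x) (N x).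
set q := lcomb (scale_pts _ s).
have sq : span S q by exists (scale_pts (fun x => (e x)^*) s) => //; exact: pts_in_scale.
have [v hv] := interpolation S (fun x => ev q x / N x).
pose g := P v.
have gE x : List.In x S -> ev q x = N x * ev g x.
  by move=> xS; rewrite Pev // hv // mulrC divfK // column_neq0.
pose E := (al * (nrm fS)%:C) *: P (mact f g) + be *: (q - sigma%:C *: g).
have EE x : List.In x S -> ev E x = e x * ev q x.
  move=> xS; rewrite evD !evZ Pev // ev_mact evB evZ gE // /e /col_entry -/sigma.
  have n0 := column_neq0 xS; field; exact: n0.
have qq : nrm q ^+ 2 <= nrm E * nrm (lcomb s).
  apply: le_trans (Re_ip_le _ _); rewrite nrm2 le_eqVlt; apply/orP; left.
  apply/eqP; congr Re; rewrite /q ip_lcomb big_map ip_lcomb.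
  apply: big_In => p ps; rewrite EE; last exact: hs.
  by rewrite -/q [fst _]/= [snd _]/= cjM cjK -mulrA.
have Eq : nrm E <= nrm q.
  have h1 := column_estimate (Pspan v) sq gE; rewrite -/g in h1.
  rewrite -(@ler_pXn2r _ 2) ?nnegrE ?nrm_ge0 //.
  set a := nrm (P (mact f g)) in h1; set b := nrm (q - sigma%:C *: g).
  have h2 : nrm E <= normc al * (nrm fS * a) + normc be * b.
    apply: le_trans (nrmD _ _) _; rewrite !nrmZ normcM ger0_normcR ?nrm_ge0 //.
    by rewrite mulrA.
  have h3 := cauchy2 (nrm fS * a) b (normc_ge0 al) (normc_ge0 be) ab.
  have h4 : nrm E ^+ 2 <= (normc al * (nrm fS * a) + normc be * b) ^+ 2.
    by rewrite ler_pXn2r ?nnegrE ?nrm_ge0 // (le_trans (nrm_ge0 E)).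
  have h5 : b ^+ 2 = nrm q ^+ 2 + sigma ^+ 2 * nrm g ^+ 2 - 2 * sigma * Re (ip q g).
    rewrite /b nrmB2 nrmZ normcR exprMn real_normK ?num_real // ipZr cjR ReZ.
    by rewrite mulrA.
  move: h3 h4; rewrite exprMn -/sigma h5 => h3 h4.
  have : sigma * a ^+ 2 <= sigma * (2 * Re (ip q g) - sigma * nrm g ^+ 2).
    by apply: ler_wpM2l => //; exact: sqr_ge0.
  lra.
have := nrm_ge0 q; rewrite le_eqVlt => /orP[/eqP <-|q0]; first exact: nrm_ge0.
have : nrm q * nrm q <= nrm q * nrm (lcomb s).
  rewrite -expr2; apply: le_trans qq _; apply: ler_wpM2r => //; exact: nrm_ge0.
by rewrite ler_pM2l.
Qed.

End FiniteSet.

(** ** Passage to the limit along finite sets *)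

Lemma cvg_col_entry (K : numFieldType) (al be f tau N : K) (t n : nat -> K) :
  t @ \oo --> tau -> n @ \oo --> N -> N != 0 ->
  (fun i => (al * t i * f + be * (n i - t i ^+ 2)) / n i) @ \oo -->
  ((al * tau * f + be * (N - tau ^+ 2)) / N : K).
Proof.
move=> ct cn N0; apply: cvgM; last exact: cvgV.
apply: cvgD.
  by apply: cvgM; [apply: cvgM => //; exact: cvg_cst|exact: cvg_cst].
apply: cvgM; first exact: cvg_cst.
apply: cvgB => //.
under eq_fun do rewrite expr2.
by rewrite expr2; exact: cvgM.
Qed.

Lemma cvg_of_bound (u : nat -> R[i]) (l : R[i]) (C : R) :
  (forall n, normc (u n - l) <= C * n.+1%:R^-1) ->
  (u : nat -> CC R) @ \oo --> (l : CC R).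
Proof.
move=> h; apply/cvgrPdist_lt => e e0.
have ep : 0 < Re e by move: e0; rewrite ltcE => /andP[].
have C1 : 0 < `|C| + 1 by rewrite ltr_wpDl.
have [M hM] := inv_succ_small (divr_gt0 ep C1).
exists M => // n /= Mn; have := hM n Mn; rewrite ltr_pdivlMr // => h1.
have -> : e = (Re e)%:C by rewrite RRe_real // gtr0_real.
rewrite -[`|_|]/((normc (l - u n))%:C) ltcR normcB_sym.
apply: le_lt_trans (h n) (le_lt_trans _ h1).
rewrite mulrC; apply: ler_wpM2l; first by rewrite invr_ge0 ler0n.
by rewrite (le_trans (ler_norm C)) // lerDl.
Qed.

Lemma cvg_normc (u : nat -> R[i]) (l : R[i]) :
  (u : nat -> CC R) @ \oo --> (l : CC R) ->
  forall e : R, 0 < e -> \forall n \near \oo, normc (u n - l) < e.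
Proof.
move=> /cvgrPdist_lt h e e0; have := h e%:C; rewrite ltcR => /(_ e0).
apply: filterS => n; rewrite -[`|_|]/((normc (l - u n))%:C) ltcR.
by rewrite normcB_sym.
Qed.

(** On finite sets this is [column_contr_fin]; in general the projections onto
    larger and larger spans of kernel functions are passed to the limit. The two
    entries are tied to [f]: the first one times [tau] is [f] times 1 minus the
    second one. *)
Lemma column_contraction (f : mult H) : mact f one <> 0 ->
  let N x := ip (mact f one) (mact f (kv x)) in
  let tau := nrm (mact f one) in
  (forall x, N x != 0) /\
  forall al be : R[i], normc al ^+ 2 + normc be ^+ 2 <= 1 ->
  exists phi : mult H,
    (forall x, mv phi x = col_entry al be tau (mv f x) (N x)) /\ contr phi.
Proof.
move=> f0 N tau; have tau0 : 0 < tau by exact: nrm_gt0.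
have seqP (s : seq (R[i] * X)) : exists (u : nat -> (hvec H -> hvec H)) (T : nat -> seq X),
    forall n, [/\ forall g, span (T n) (u n g),
      forall g x, List.In x (T n) -> ev (u n g) x = ev g x,
      pts_in (T n) s & nrm (u n (mact f one) - mact f one) <= n.+1%:R^-1].
  have /choice[uT huT] : forall n : nat, exists uT : (hvec H -> hvec H) * seq X,
    [/\ forall g, span uT.2 (uT.1 g),
      forall g x, List.In x uT.2 -> ev (uT.1 g) x = ev g x,
      pts_in uT.2 s & nrm (uT.1 (mact f one) - mact f one) <= n.+1%:R^-1].
    move=> n; have n0 : 0 < (n.+1%:R : R)^-1 by rewrite invr_gt0 ltr0Sn.
    have [t ht] := kernel_dense hk (mact f one) n0.
    pose T := map snd (s ++ t).
    have inT (r : seq (R[i] * X)) p :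
        (forall p', List.In p' r -> List.In p' (s ++ t)) -> List.In p r -> List.In p.2 T.
      by move=> hr /hr pr; apply: List.in_map.
    have [P Pspan Pev] := span_proj hk T.
    exists (P, T); split=> //=.
      move=> p; apply: inT => p' h; apply/List.in_or_app; by left.
    rewrite nrmB_sym; apply: le_trans (ltW ht).
    apply: (proj_best Pspan Pev); exists t => // p.
    by apply: inT => p' h; apply/List.in_or_app; right.
  by exists (fun n => (uT n).1), (fun n => (uT n).2).
have NE P T : (forall g, span T (P g)) ->
    (forall g x, List.In x T -> ev (P g) x = ev g x) -> forall x,
    ip (P (mact f one)) (P (mact f (kv x))) = ip (P (mact f one)) (mact f (kv x)).
  by move=> Ps Pe x; rewrite ipC (@proj_ip _ _ _ _ hk T P Pe) // -ipC.
have N0 x : N x != 0.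
  have [u [T hu]] := seqP [:: (0, x)].
  suff h : tau ^+ 2 <= 2 * Re (N x).
    apply/eqP => N0; move: h; rewrite N0 mulr0.
    by rewrite leNgt exprn_gt0.
  apply: (@ler_eps _ (2 * nrm (mact f (kv x)) + 2 * tau)) => e e0.
  have [M /(_ M (leqnn M)) hM] := inv_succ_small e0.
  have [Ps Pe Pin hP] := hu M; have hPe := ltW (le_lt_trans hP hM).
  have xT : List.In x (T M) by apply: (Pin (0, x)); left.
  have h1 := ler_nrmB (mact f one) (u M (mact f one)).
  rewrite -/tau nrmB_sym in h1.
  have h2 : nrm (u M (mact f one)) ^+ 2 <= 2 * Re (ip (u M (mact f one)) (mact f (kv x))).
    by have := @column_Re f (T M) (u M) Ps Pe x xT; rewrite (NE _ _ Ps Pe).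
  have h3 := Re_ip_le (u M (mact f one) - mact f one) (mact f (kv x)).
  rewrite ipBl ReB -/(N x) in h3.
  have h4 : nrm (u M (mact f one) - mact f one) * nrm (mact f (kv x)) <=
      e * nrm (mact f (kv x)).
    by apply: ler_wpM2r; [exact: nrm_ge0|].
  have := sqr_ge0 (nrm (u M (mact f one)) - tau).
  have h5 : nrm (u M (mact f one)) * tau >= (tau - e) * tau.
    by apply: ler_wpM2r; [exact: ltW|lra].
  lra.
split=> // al be ab; apply: (contr_multiplier (hk := hk)) => s.
pose e x := col_entry al be tau (mv f x) (N x).
rewrite (_ : (fun x => _) = (fun x => (e x)^*)) //.
have [u [T hu]] := seqP s.
pose fn n := u n (mact f one).
pose Nn n x := ip (fn n) (mact f (kv x)).
pose en n x := col_entry al be (nrm (fn n)) (mv f x) (Nn n x).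
have cN x : (Nn^~ x : nat -> CC R) @ \oo --> (N x : CC R).
  apply: (@cvg_of_bound _ _ (nrm (mact f (kv x)))) => n.
  rewrite -ipBl; apply: le_trans (cauchy_schwarz _ _) _; rewrite mulrC.
  by apply: ler_wpM2l; [exact: nrm_ge0|case: (hu n)].
have ct : ((fun n => (nrm (fn n))%:C) : nat -> CC R) @ \oo --> (tau%:C : CC R).
  apply: (@cvg_of_bound _ _ 1) => n; rewrite -rcB normcR mul1r.
  case: (hu n) => _ _ _; apply: le_trans.
  rewrite ler_norml lerNl opprB; apply/andP; split; last exact: ler_nrmB.
  by rewrite nrmB_sym; exact: ler_nrmB.
have ce x : (en^~ x : nat -> CC R) @ \oo --> (e x : CC R).
  have -> : (en^~ x : nat -> CC R) = (fun n => (al * (nrm (fn n))%:C * mv f x +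
      be * (Nn n x - (nrm (fn n))%:C ^+ 2)) / Nn n x).
    by apply/funext => n; rewrite -rcX.
  rewrite /e /col_entry rcX.
  exact (@cvg_col_entry (R[i] : numFieldType) al be (mv f x) tau%:C (N x)
    (fun n => (nrm (fn n))%:C) (Nn^~ x) ct (cN x) (N0 x)).
have near_s : forall d : R, 0 < d ->
    \forall n \near \oo, forall p, List.In p s -> normc (en n p.2 - e p.2) < d.
  move=> d d0; elim: s {hu} => [|p t IH]; first by apply: nearW.
  have [N1 _ h1] := cvg_normc (ce p.2) d0; have [N2 _ h2] := IH.
  exists (maxn N1 N2) => // n /=; rewrite geq_max => /andP[n1 n2] q [<-|qt].
    exact: h1.
  exact: h2 n2 q qt.
have en_contr n : nrm (lcomb (scale_pts (fun x => (en n x)^*) s)) <= nrm (lcomb s)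
    \/ nrm (fn n) <= 0.
  have [Ps Pe Pin _] := hu n.
  case: (ltP 0 (nrm (fn n))) => h; last by right.
  left; have := column_contr_fin Ps Pe h Pin ab.
  rewrite (_ : (fun x => _) = (fun x => (en n x)^*)) //.
  apply/funext => x; congr (_^*); rewrite /en /Nn -(NE _ _ Ps Pe) //.
pose C := \sum_(p <- s) normc p.1 * nrm (kv p.2).
apply: (@ler_eps _ C) => d d0.
have near_t : \forall n \near \oo, 0 < nrm (fn n).
  have := cvg_normc ct tau0; apply: filterS => n; rewrite -rcB normcR => h.
  have := ler_norm (tau - nrm (fn n)); rewrite distrC; lra.
have [n [hn1 hn2]] : exists n, 0 < nrm (fn n) /\
    forall p, List.In p s -> normc (en n p.2 - e p.2) < d.
  have [N1 _ h1] := near_t; have [N2 _ h2] := near_s d d0.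
  by exists (maxn N1 N2); split; [apply: h1|apply: h2];
    rewrite /= ?leq_maxl ?leq_maxr.
have [hc|] := en_contr n; last by rewrite leNgt hn1.
have : lcomb (scale_pts (fun x => (e x)^*) s) =
    lcomb (scale_pts (fun x => (en n x)^*) s) -
    \sum_(p <- s) (p.1 * (en n p.2 - e p.2)^*) *: kv p.2.
  rewrite !lcomb_scale -sumrB; apply: eq_bigr => p _.
  by rewrite -scalerBl cjB; congr (_ *: _); ring.
move=> ->; apply: le_trans (nrmB _ _) _; apply: lerD => //.
apply: le_trans (nrm_sum _ _ _) _; rewrite mulr_suml.
elim: s hn2 {hu near_s en_contr hc C seqP} => [|p t IH] h.
  by rewrite !big_nil.
rewrite !big_cons; apply: lerD; last by apply: IH => q qt; apply: h; right.
rewrite nrmZ normcM normc_conj -!mulrA; apply: ler_wpM2l; first exact: normc_ge0.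
rewrite mulrC; apply: ler_wpM2l; first exact: nrm_ge0.
by apply: ltW; apply: h; left.
Qed.

End ColumnContraction.

(** * Characters and the isometric Gelfand transform *)

Section Characters.
Context {R : realType} {X : Type} (H : rkhs (R := R) X).
Implicit Types (phi psi : mult H) (chi : Delta H).

Definition chv chi phi : R[i] := char_eval phi chi.

Lemma chvP chi : is_character (set_val chi : mult H -> CC R).
Proof. exact: set_valP. Qed.

Lemma chvPl chi a phi psi : chv chi (a *: phi + psi) = a * chv chi phi + chv chi psi.
Proof. exact: (char_linear (chvP chi)). Qed.

Lemma chvM chi phi psi : chv chi (phi * psi) = chv chi phi * chv chi psi.
Proof. exact: (char_mul (chvP chi)). Qed.

Lemma chvD chi phi psi : chv chi (phi + psi) = chv chi phi + chv chi psi.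
Proof. by rewrite -[phi in LHS]scale1r chvPl mul1r. Qed.

Lemma chv0 chi : chv chi 0 = 0.
Proof. by apply: (addrI (chv chi 0)); rewrite -chvD !addr0. Qed.

Lemma chvZ chi a phi : chv chi (a *: phi) = a * chv chi phi.
Proof. by rewrite -[a *: phi]addr0 chvPl chv0 addr0. Qed.

Lemma chvN chi phi : chv chi (- phi) = - chv chi phi.
Proof. by rewrite -scaleN1r chvZ mulN1r. Qed.

Lemma chvB chi phi psi : chv chi (phi - psi) = chv chi phi - chv chi psi.
Proof. by rewrite chvD chvN. Qed.

Lemma chv1 chi : chv chi 1 = 1.
Proof.
have [a /eqP a0] := char_neq0 (chvP chi).
by apply: (mulIf a0); rewrite mul1r -[set_val chi a]/(chv chi a) -chvM mul1r.
Qed.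

Lemma chvX chi phi n : chv chi (phi ^+ n) = chv chi phi ^+ n.
Proof. by elim: n => [|n IH]; rewrite ?chv1 // !exprS chvM IH. Qed.

Lemma chv_sum chi (I : Type) (r : seq I) (P : pred I) (F : I -> mult H) :
  chv chi (\sum_(i <- r | P i) F i) = \sum_(i <- r | P i) chv chi (F i).
Proof. by elim/big_rec2: _ => [|i a b _ <-]; rewrite ?chv0 // chvD. Qed.

Hypothesis gel : gelfand_isometric H.

Lemma gelfand_le phi (C : R) : 0 <= C ->
  (forall chi, normc (chv chi phi) <= C) ->
  forall f, nrm (mact phi f) <= C * nrm f.
Proof.
move=> C0 h; apply/mult_norm_leP => //; rewrite -gel.
by apply: ge_ereal_sup => _ [chi _ <-]; rewrite lee_fin; exact: h.
Qed.

Lemma gelfand_contr phi chi : contr phi -> normc (chv chi phi) <= 1.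
Proof.
move=> h; rewrite -lee_fin.
have : (mult_norm phi <= 1%:E)%E.
  by apply/mult_norm_leP => // f; rewrite mul1r; exact: h.
rewrite -gel; apply: le_trans; apply: ereal_sup_ubound.
by exists chi.
Qed.

End Characters.

Section SquareSum.
Context {R : realType}.

Lemma normc2_le1 (A B : R[i]) :
  (forall al be : R[i], normc al ^+ 2 + normc be ^+ 2 <= 1 ->
     normc (al * A + be * B) <= 1) ->
  normc A ^+ 2 + normc B ^+ 2 <= 1.
Proof.
move=> h; set rho2 := _ + _.
have rho20 : 0 <= rho2 by rewrite addr_ge0 ?sqr_ge0.
have [->|r0] := eqVneq rho2 0; first exact: ler01.
pose rho := Num.sqrt rho2.
have rp : 0 < rho by rewrite sqrtr_gt0 lt_neqAle eq_sym r0.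
have rr : rho ^+ 2 = rho2 by rewrite sqr_sqrtr.
have := h (A^* * rho^-1%:C) (B^* * rho^-1%:C).
rewrite !normcM !normc_conj ger0_normcR ?invr_ge0 ?(ltW rp) // !exprMn -mulrDl.
rewrite -/rho2 exprVn rr divff // lexx => /(_ isT).
have -> : A^* * rho^-1%:C * A + B^* * rho^-1%:C * B = rho%:C.
  rewrite mulrAC mulJc mulrAC mulJc -!rcM -rcD -mulrDl -/rho2 -rr expr2 mulfK //.
  by rewrite gt_eqF.
rewrite ger0_normcR ?(ltW rp) // => r1.
by rewrite -rr expr_le1 // ltW.
Qed.

(** The weak inequality [t |1 - B|^2 <= s (1 - |B|^2)] places [B] near the disc
    with centre [1 / (1 + s)] and radius [s / (1 + s)] when [t] is near 1. *)
Lemma disc_estimate (s t : R) (B : R[i]) : 0 <= s -> s <= 1 -> t <= 1 ->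
  normc B <= 1 -> t * normc (1 - B) ^+ 2 <= s * (1 - normc B ^+ 2) ->
  normc (1 - (1 + s)%:C * B) ^+ 2 <= s ^+ 2 + 8 * (1 - t).
Proof.
move=> s0 s1 t1 B1; rewrite !normcB2 normc1 !mul1r normcM ger0_normcR ?addr_ge0 //.
rewrite cjM cjR ReZ !ReJ expr1n.
have := ler_NRe_normc B; set b := normc B in B1 *; set x := Re B => xb h.
have : (1 - t) * (1 + b ^+ 2 - 2 * x) <= (1 - t) * 4.
  by apply: ler_wpM2l; [lra|have := normc_ge0 B; rewrite -/b; nra].
have b0 : 0 <= (1 - t) * (1 + b ^+ 2 - 2 * x).
  apply: mulr_ge0; first lra.
  have := sqr_ge0 (1 - b); have := ler_Re_normc B; rewrite -/b -/x; nra.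
move: h; set D := (1 + b ^+ 2 - 2 * x) in b0 *; move=> h h2.
have -> : 1 + ((1 + s) * b) ^+ 2 - 2 * ((1 + s) * x) =
    s ^+ 2 + (1 + s) * (D - s * (1 - b ^+ 2)) by rewrite /D; ring.
rewrite lerD2l.
have h3 : D - s * (1 - b ^+ 2) <= (1 - t) * D by lra.
have h4 : (1 + s) * (D - s * (1 - b ^+ 2)) <= (1 + s) * ((1 - t) * D).
  by apply: ler_wpM2l => //; lra.
nra.
Qed.

(** The identity [|1 - w^* z|^2 - |w - z|^2 = (1 - |w|^2) (1 - |z|^2)] keeps the
    Moebius transform [(w - z) / (1 - w^* z)] away from the unit circle in
    proportion to [1 - |z|^2]. *)
Lemma moebius_bound (w z : R[i]) : normc w < 1 -> normc z <= 1 ->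
  normc (w - z) <= normc (1 - w^* * z) *
    (1 - (1 - normc w ^+ 2) / 4 * (1 - normc z ^+ 2) / 2).
Proof.
have := normc_ge0 w; have := normc_ge0 z.
have e1 : normc (w - z) ^+ 2 = normc (1 - w^* * z) ^+ 2 -
    (1 - normc w ^+ 2) * (1 - normc z ^+ 2).
  by rewrite !normcB2 normc1 mul1r cjM cjK normcM normc_conj; ring.
have e2 : normc (1 - w^* * z) <= 1 + normc w * normc z.
  by apply: le_trans (le_normcD _ _) _; rewrite normcN normc1 normcM normc_conj.
have n0 := normc_ge0 (1 - w^* * z).
move: e1 e2 n0 (normc_ge0 (w - z)).
move: (normc (w - z)) (normc (1 - w^* * z)) (normc z) (normc w).
move=> p q s r e1 e2 q0 p0 s0 r0 r1 s1.
set d := (1 - r ^+ 2) / 4; set v := 1 - s ^+ 2.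
have d0 : 0 <= d by rewrite /d; nra.
have d1 : d <= 4^-1 by rewrite /d; nra.
have v0 : 0 <= v by rewrite /v; nra.
have v1 : v <= 1 by rewrite /v; nra.
have dv0 : 0 <= d * v by exact: mulr_ge0.
have dv1 : d * v <= 4^-1 * 1 by exact: ler_pM.
rewrite -(@ler_pXn2r _ 2) ?nnegrE ?mulr_ge0 //; last lra.
have q2 : q <= 2 by nra.
have e3 : q ^+ 2 * (d * v) <= 4 * (d * v) by apply: ler_wpM2r => //; nra.
have e4 : 4 * (d * v) = (1 - r ^+ 2) * v by rewrite /d; field.
rewrite e1 exprMn -/v -e4.
have := mulr_ge0 (sqr_ge0 q) (sqr_ge0 (d * v / 2)).
set T := q ^+ 2 in e3 *; lra.
Qed.

(** [1 + a] is the larger eigenvalue of the sum of the projections onto two unit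
    vectors of the plane at an angle with cosine [a]. *)
Lemma quadratic_bound (a b x y : R) : 0 <= a -> a <= 1 -> a ^+ 2 + b ^+ 2 = 1 ->
  x ^+ 2 + y ^+ 2 <= 1 -> x ^+ 2 + (a * x + b * y) ^+ 2 <= 1 + a.
Proof.
move=> a0 a1 ab xy.
have bb : b ^+ 2 = 1 - a ^+ 2 by lra.
suff : 0 <= a * ((1 - a) * x ^+ 2 - 2 * b * x * y + (1 + a) * y ^+ 2).
  have -> : (a * x + b * y) ^+ 2 =
      a ^+ 2 * x ^+ 2 + 2 * a * b * x * y + (1 - a ^+ 2) * y ^+ 2.
    by rewrite -bb; ring.
  have : (1 + a) * (x ^+ 2 + y ^+ 2) <= (1 + a) * 1 by apply: ler_wpM2l => //; lra.
  lra.
apply: mulr_ge0 => //.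
have [a11|an1] := eqVneq a 1.
  have -> : b = 0 by apply/eqP; rewrite -sqrf_eq0 bb a11 expr1n subrr.
  by rewrite a11; have := sqr_ge0 y; lra.
have h7 : 0 < 1 - a by rewrite subr_gt0 lt_neqAle an1.
have := sqr_ge0 ((1 - a) * x - b * y).
rewrite (_ : _ ^+ 2 = (1 - a) ^+ 2 * x ^+ 2 - 2 * (1 - a) * b * x * y +
  b ^+ 2 * y ^+ 2); last by ring.
rewrite bb -(pmulr_rge0 _ h7) => h; apply: le_trans h _.
by rewrite le_eqVlt; apply/orP; left; apply/eqP; ring.
Qed.

(** The loss in the Moebius factor makes up for the growth of the other factor. *)
Lemma damping_bound (d v b e : R) : 0 <= d -> 0 <= v -> 0 <= e -> e <= d / 4 ->
  2^-1 <= b -> (1 - d * v / 2) * (b + e * v) <= b.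
Proof.
move=> d0 v0 e0 ed b1.
have h1 : e * v <= d / 4 * v by apply: ler_wpM2r.
have h2 : d * v / 2 * 2^-1 <= d * v / 2 * b by apply: ler_wpM2l => //; nra.
have h3 : 0 <= d * v * (e * v) by apply: mulr_ge0; apply: mulr_ge0.
lra.
Qed.

Lemma one_minus_expr (t : R) n : 0 <= t -> t <= 1 -> 1 - t ^+ n <= n%:R * (1 - t).
Proof.
move=> t0 t1; elim: n => [|n IH]; first by rewrite expr0 subrr mul0r.
rewrite exprS -natr1 mulrDl mul1r.
have h : t * (1 - t ^+ n) <= 1 - t ^+ n.
  by rewrite -[leRHS]mul1r; apply: ler_wpM2r => //; rewrite subr_ge0 exprn_ile1.
lra.
Qed.

Lemma expr_small (r e : R) : 0 <= r -> r < 1 -> 0 < e ->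
  exists M, r ^+ M.+1 < e.
Proof.
move=> r0 r1 e0; have : `|r| < 1 by rewrite ger0_norm.
move=> /cvg_expr/cvgrPdist_lt/(_ e e0)[M _ /(_ M.+1 (leqnSn M))] /=.
by rewrite sub0r normrN ger0_norm ?exprn_ge0 // => h; exists M.
Qed.

End SquareSum.

Section GelfandIsometric.
Context {R : realType} {X : Type} (H : rkhs (R := R) X) (k : X -> X -> R[i]).
Hypothesis hk : is_kernel H k.
Notation kv := (kv hk).
Hypothesis hNP : complete_NP H k.
Hypothesis hirr : irreducible_kernel k.
Variable x0 : X.
Hypothesis hnorm1 : normalized k x0.
Hypothesis gel : gelfand_isometric H.

Notation one := (kv x0).
Notation F := (pickF k).

Let hk0 : forall x y, k x y <> 0. Proof. by case: hirr. Qed.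

Let K y := nrm (kv y) ^+ 2.

Lemma kernel_gt1 y : y <> x0 -> 1 < K y.
Proof.
move=> yx0; have h : nrm (kv y - one) ^+ 2 = K y - 1.
  by rewrite nrmB2 (nrm_one hk hnorm1) expr1n (ip_one hk) ev_kv (kx0 hk) // [Re 1]/=; rewrite /K; lra.
rewrite -subr_gt0 -h exprn_gt0 // nrm_gt0 // => e.
have [h1 _] : (1 : R[i]) = 0 /\ (-1 : R[i]) = 0.
  apply: (hirr.2 y x0 yx0); apply/funext => z.
  have := congr1 (fun f => ev f z) e; rewrite evB !ev_kv ev0 => e'.
  by rewrite -[LHS]/(1 * k z y + -1 * k z x0) mul1r mulN1r.
by move/eqP: h1; rewrite oner_eq0.
Qed.

Lemma pickF_diag y : F y y = (1 - (K y)^-1)%:C.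
Proof. by rewrite /pickF -(nrm2_kv hk) -/(K y) rcB rcV. Qed.

Lemma geometric_mult (w z : R[i]) M :
  (\sum_(i < M) (w^* * z) ^+ i) * (1 - w^* * z) = 1 - (w^* * z) ^+ M.
Proof.
by rewrite -opprB mulrN mulrC -subrX1 opprB.
Qed.

(** A multiplier [u] with [u y = 0] and [|u x0| = |phi y|] has norm at least 1,
    as testing against [1 - k_y / k(y, y)] shows, and the Moebius transform of
    [phi] that vanishes at [y] is such a multiplier. If [phi^n] had norm less
    than 1 in the space, then its column contraction would provide a factor [g]
    with [g x0 = 1] that is less than 1 on the characters on which [|phi|] is
    close to 1. The product with the Moebius transform would be less than 1 on
    all characters, against the isometry. *)
Lemma extremal_pow_norm phi y n : contr phi -> mv phi x0 = 0 ->
  mv phi y != 0 -> normc (mv phi y) ^+ 2 = 1 - (K y)^-1 ->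
  1 <= nrm (mact (phi ^+ n) one).
Proof.
move=> cphi phi0 phiy hr.
set w := mv phi y in phiy hr; set r := normc w in hr.
have r0 : 0 < r by rewrite normc_gt0.
have Ky : 0 < K y.
  rewrite lt_neqAle sqr_ge0 andbT eq_sym; apply/eqP => h.
  by have := @hk0 y y; rewrite -(nrm2_kv hk) -/(K y) h.
have r1 : r < 1.
  have iK : 0 < (K y)^-1 by rewrite invr_gt0.
  by rewrite -(@ltr_pXn2r _ 2) ?nnegrE ?(ltW r0) // expr1n hr; lra.
set f := phi ^+ n; set tau := nrm (mact f one).
have fv0 : mact f one <> 0.
  move=> h; have := congr1 (fun g => ev g y) h.
  rewrite (ev_mact_one hk hnorm1) mvX ev0 => /eqP; rewrite expf_eq0 => /andP[_].
  by rewrite (negbTE phiy).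
have tau0 : 0 < tau by exact: nrm_gt0.
rewrite leNgt; apply/negP => tau1.
pose N x := ip (mact f one) (mact f (kv x)).
have [N0 hcol] : (forall x, N x != 0) /\ forall al be : R[i],
    normc al ^+ 2 + normc be ^+ 2 <= 1 -> exists psi : mult H,
    (forall x, mv psi x = col_entry al be tau (mv f x) (N x)) /\ contr psi.
  exact (column_contraction hNP hirr hnorm1 fv0).
pose s := tau ^+ 2.
have s0 : 0 < s by rewrite exprn_gt0.
have s1 : s < 1 by rewrite expr_lt1 // ltW.
have [|a [ha _]] := hcol 1 0; first by rewrite normc1 normc0 expr1n expr0n addr0.
have [|b [hb cb]] := hcol 0 1; first by rewrite normc1 normc0 expr1n expr0n add0r.
have comb al be : normc al ^+ 2 + normc be ^+ 2 <= 1 -> contr (al *: a + be *: b).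
  move=> /hcol[c [hc cc]]; rewrite (_ : _ + _ = c) //; apply: mult_ext => x.
  by rewrite mvD !mvZ ha hb hc /col_entry; field; exact: N0.
have fab : f * (1 - b) = tau%:C *: a.
  apply: mult_ext => x; rewrite mvM mvB mv1 mvZ ha hb /col_entry rcX.
  by field; exact: N0.
have bx0 : mv b x0 = 0.
  have Nx0 : N x0 = (tau ^+ 2)%:C by rewrite /N ipxx.
  by rewrite hb /col_entry Nx0 subrr mulr0 mul0r addr0 !mul0r.
(* The constant [d] is the one of [moebius_bound]; [ep] is so small that
   [damping_bound] applies, and [M] is so large that the truncated geometric
   series of [Gam] costs less than the margin [1 - B0]. *)
pose d := (1 - r ^+ 2) / 4.
have d0 : 0 < d by rewrite divr_gt0 // subr_gt0 expr_lt1 // ltW.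
have d1 : d <= 4^-1 by rewrite /d; have := sqr_ge0 r; lra.
pose C := 4 * n%:R / s.
have C0 : 0 <= C by rewrite divr_ge0 ?mulr_ge0 // ltW.
pose ep := d / (4 * (C + 1)).
have C1 : 0 < C + 1 by rewrite ltr_wpDl.
have ep0 : 0 < ep by rewrite divr_gt0 // mulr_gt0.
have epC : ep * (C + 1) = d / 4 by rewrite /ep; field; rewrite gt_eqF.
have ep1 : ep <= 16^-1.
  have : ep * 1 <= ep * (C + 1) by apply: ler_wpM2l; lra.
  lra.
pose B0 := 1 - ep * (1 - s).
have B01 : B0 < 1 by rewrite /B0 ltrBlDr ltrDl mulr_gt0 // subr_gt0.
have B0h : 2^-1 <= B0.
  have : ep * (1 - s) <= 16^-1 * 1 by apply: ler_pM; lra.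
  rewrite /B0; lra.
have B0' : 0 < 1 - B0 by rewrite subr_gt0.
have [M hM] := expr_small (ltW r0) r1 B0'.
pose Gam : mult H := \sum_(i < M.+1) (w^* *: phi) ^+ i.
pose g : mult H := 1 - (ep * (1 + s))%:C *: b.
(* An approximation to [(w - phi) / (1 - w^* phi) * g], with [g x0 = 1]. *)
pose u : mult H := (w *: (1 : mult H) - phi) * Gam * g.
(* On a character with [|z|] close to 1 the relation [fab] forces [g] to be at
   most about [B0] in modulus; elsewhere the Moebius factor is small. *)
have chu chi : normc (chv chi u) <= (1 + r ^+ M.+1) * B0.
  set z := chv chi phi; set B := chv chi b; set Ac := chv chi a.
  have z1 : normc z <= 1 by exact: gelfand_contr.
  have B1 : normc B <= 1 by exact: gelfand_contr.
  have AB : normc Ac ^+ 2 + normc B ^+ 2 <= 1.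
    apply: normc2_le1 => al be /comb h.
    by have := gelfand_contr gel chi h; rewrite chvD !chvZ.
  pose t := (normc z ^+ 2) ^+ n.
  have z2 : normc z ^+ 2 <= 1 by rewrite expr_le1 ?normc_ge0.
  have t0 : 0 <= t by rewrite exprn_ge0 ?sqr_ge0.
  have t1 : t <= 1 by rewrite exprn_ile1 ?sqr_ge0.
  have tB : t * normc (1 - B) ^+ 2 <= s * (1 - normc B ^+ 2).
    have := congr1 (chv chi) fab; rewrite chvM chvB chv1 chvX chvZ -/z -/B -/Ac.
    move=> /(congr1 (fun v => normc v ^+ 2)); rewrite !normcM !exprMn normcX.
    rewrite -exprM mulnC exprM -/t ger0_normcR ?(ltW tau0) // -/s => ->.
    by apply: ler_wpM2l; [exact: ltW|lra].
  pose v := 1 - normc z ^+ 2.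
  have v0 : 0 <= v by rewrite subr_ge0.
  have hg : normc (chv chi g) <= B0 + ep * C * v.
    rewrite chvB chv1 chvZ -/B.
    pose q := normc (1 - (1 + s)%:C * B).
    have hq : q <= s + C * v.
      have h1 := disc_estimate (ltW s0) (ltW s1) t1 B1 tB; rewrite -/q in h1.
      have h2 : 1 - t <= n%:R * v by exact: one_minus_expr (sqr_ge0 _) z2.
      have Cv : 0 <= C * v by exact: mulr_ge0.
      rewrite -(@ler_pXn2r _ 2) ?nnegrE ?normc_ge0 //; last by rewrite addr_ge0 ?(ltW s0).
      have h3 : 2 * s * (C * v) = 8 * (n%:R * v) by rewrite /C; field; rewrite gt_eqF.
      have := sqr_ge0 (C * v); lra.
    have -> : 1 - (ep * (1 + s))%:C * B =
        (1 - ep)%:C + ep%:C * (1 - (1 + s)%:C * B).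
      rewrite !(rcB, rcM, rcD); ring.
    apply: le_trans (le_normcD _ _) _; rewrite normcM !ger0_normcR ?(ltW ep0) //; last lra.
    have : ep * q <= ep * (s + C * v) by apply: ler_wpM2l => //; exact: ltW.
    rewrite -/q /B0; lra.
  have hwz : 0 < normc (1 - w^* * z).
    rewrite normc_gt0 subr_eq0; apply/eqP => /(congr1 (@normc _)).
    rewrite normc1 normcM normc_conj -/r => h.
    have : r * normc z <= r * 1 by apply: ler_wpM2l => //; exact: ltW.
    lra.
  have hmob : normc (w - z) <= normc (1 - w^* * z) * (1 - d * v / 2).
    exact: moebius_bound r1 z1.
  have hGam : normc (chv chi Gam) * normc (1 - w^* * z) <= 1 + r ^+ M.+1.
    rewrite -normcM /Gam chv_sum.
    under eq_bigr do rewrite chvX chvZ -/z.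
    rewrite geometric_mult; apply: le_trans (le_normcD _ _) _.
    rewrite normcN normc1 lerD2l normcX normcM normc_conj -/r.
    rewrite ler_pXn2r ?nnegrE ?mulr_ge0 ?normc_ge0 ?(ltW r0) //.
    by rewrite -[leRHS]mulr1; apply: ler_wpM2l => //; exact: ltW.
  rewrite /u !chvM chvB chvZ chv1 mulr1 -/z !normcM.
  have dv0 : 0 <= d * v by rewrite mulr_ge0 // ltW.
  have dv1 : d * v <= 1.
    have : d * v <= 4^-1 * 1.
      apply: ler_pM => //; first exact: ltW.
      by rewrite /v; have := sqr_ge0 (normc z); lra.
    lra.
  have f1 : normc (w - z) * normc (chv chi Gam) <= (1 + r ^+ M.+1) * (1 - d * v / 2).
    apply: le_trans (_ : normc (1 - w^* * z) * (1 - d * v / 2) * normc (chv chi Gam) <= _).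
      by apply: ler_wpM2r => //; exact: normc_ge0.
    by rewrite mulrAC (mulrC (normc (1 - _))); apply: ler_wpM2r => //; lra.
  have f2 : (1 - d * v / 2) * (B0 + ep * C * v) <= B0.
    by apply: damping_bound => //; [exact: ltW|exact: mulr_ge0 (ltW ep0) C0|lra].
  apply: le_trans (_ : (1 + r ^+ M.+1) * (1 - d * v / 2) * (B0 + ep * C * v) <= _).
    by apply: ler_pM => //; rewrite ?mulr_ge0 ?normc_ge0.
  rewrite -mulrA; apply: ler_wpM2l => //.
  by rewrite addr_ge0 // exprn_ge0 // ltW.
have rM0 : 0 <= 1 + r ^+ M.+1 by rewrite addr_ge0 // exprn_ge0 // ltW.
have B00 : 0 <= B0 by lra.
have hu := gelfand_le gel (mulr_ge0 rM0 B00) chu one.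
rewrite (nrm_one hk hnorm1) mulr1 in hu.
(* Since [u] vanishes at [y], pairing with [h] evaluates it at [x0]. *)
pose h := one - (K y)^-1%:C *: kv y.
have nh : nrm h ^+ 2 = r ^+ 2.
  rewrite hr nrmB2 (nrm_one hk hnorm1) expr1n nrmZ normcR exprMn real_normK ?num_real //.
  rewrite -/(K y) ipZr cjR ReZ (ip_kv hk) (ev_one hk hnorm1) [Re 1]/=.
  by field; rewrite gt_eqF.
have nhr : nrm h = r.
  by apply/eqP; rewrite -(@eqrXn2 _ 2) ?nrm_ge0 ?(ltW r0) // nh.
have iu : ip (mact u one) h = w.
  rewrite ipBr ipZr !(ip_kv hk) !(ev_mact_one hk hnorm1) /u !mvM !mvB !mvZ mv1 mulr1.
  rewrite -/w subrr !mul0r mulr0 phi0 !subr0 bx0 mulr0 subr0 mulr1.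
  rewrite /Gam mv_sum big_ord_recl expr0 mv1 big1 ?addr0 ?mulr1 //.
  by move=> i _; rewrite mvX mvZ phi0 mulr0 expr0n.
have := cauchy_schwarz (mact u one) h; rewrite iu nhr -/r => h1.
have h2 : r <= (1 + r ^+ M.+1) * B0 * r.
  by apply: le_trans h1 _; apply: ler_wpM2r => //; exact: ltW.
have h3 : (1 + r ^+ M.+1) * B0 <= (2 - B0) * B0.
  by apply: ler_wpM2r => //; lra.
have h4 : 1 <= (1 + r ^+ M.+1) * B0 by rewrite -(ler_pM2r r0) mul1r.
have h5 : (1 - B0) ^+ 2 <= 0 by have := le_trans h4 h3; lra.
by move: h5; rewrite leNgt exprn_gt0.
Qed.

(** Two extremal multipliers [z1] and [psi = a z1 + b z2] of a row contraction
    [(z1, z2)] have powers of norm at least 1 by [extremal_pow_norm]. The norm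
    of [z1^2 + psi^2] is then at least [sqrt (2 + 2 a^2)] in the space, but it
    is at most [1 + a] on the characters; hence [a = 1]. *)
Lemma pickF_rank_one y z : y <> x0 -> z <> x0 ->
  normc (F z y) ^+ 2 = Re (F z z) * Re (F y y).
Proof.
move=> yx0 zx0.
have Ky := kernel_gt1 yx0; have Kz := kernel_gt1 zx0.
have Fpos t : 1 < K t -> 0 < 1 - (K t)^-1.
  by move=> K1; rewrite subr_gt0 invf_lt1 // (lt_trans ltr01).
have Fy := Fpos _ Ky; have Fz := Fpos _ Kz.
rewrite !pickF_diag !rcK.
pose r := Num.sqrt (1 - (K y)^-1); pose rz := Num.sqrt (1 - (K z)^-1).
have r0 : 0 < r by rewrite sqrtr_gt0.
have rz0 : 0 < rz by rewrite sqrtr_gt0.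
have rr : r ^+ 2 = 1 - (K y)^-1 by rewrite sqr_sqrtr // ltW.
have rrz : rz ^+ 2 = 1 - (K z)^-1 by rewrite sqr_sqrtr // ltW.
rewrite -rr -rrz.
have CS : normc (F z y) <= rz * r.
  have [d [phi [_ hphi]]] := pick_coords_exist hk hNP hnorm1 hk0 [:: y; z].
  pose t := F z y / (r ^+ 2)%:C.
  have hy : \sum_l normc (mv (phi l) y) ^+ 2 = r ^+ 2.
    apply: complexI; rewrite rc_sum rr -pickF_diag -hphi; last by left.
    by apply: eq_bigr => l _; rewrite mulcJ.
  have hz : \sum_l normc (mv (phi l) z) ^+ 2 = rz ^+ 2.
    apply: complexI; rewrite rc_sum rrz -pickF_diag -hphi; last by right; left.
    by apply: eq_bigr => l _; rewrite mulcJ.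
  have : 0 <= \sum_l normc (mv (phi l) z - t * mv (phi l) y) ^+ 2.
    by apply: sumr_ge0 => *; exact: sqr_ge0.
  under eq_bigr do rewrite normcB2 normcM exprMn cjM [X in 2 * Re X]mulrCA.
  rewrite sumrB big_split /= hz -mulr_sumr hy -mulr_sumr -Re_sum -mulr_sumr.
  rewrite hphi; last by left.
  have -> : t^* * F z y = (normc (F z y) ^+ 2 / r ^+ 2)%:C.
    by rewrite /t -rcV cjM cjR rcM -mulJc; ring.
  rewrite rcK /t -rcV normcM.
  rewrite ger0_normcR ?invr_ge0 ?sqr_ge0 //.
  set q := normc _ => h.
  rewrite -(@ler_pXn2r _ 2) ?nnegrE ?mulr_ge0 ?normc_ge0 ?(ltW r0) ?(ltW rz0) //.
  have h' : 0 <= rz ^+ 2 - q ^+ 2 / r ^+ 2.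
    apply: le_trans h _; rewrite le_eqVlt; apply/orP; left; apply/eqP.
    by field; rewrite gt_eqF.
  by move: h'; rewrite subr_ge0 ler_pdivrMr ?exprn_gt0 // exprMn.
pose a := normc (F z y) / (rz * r).
have a0 : 0 <= a by rewrite divr_ge0 ?normc_ge0 // mulr_ge0 // ltW.
have a1 : a <= 1 by rewrite ler_pdivrMr ?mulr_gt0 // mul1r.
pose b := Num.sqrt (1 - a ^+ 2).
have b0 : 0 <= b by exact: sqrtr_ge0.
have bb : b ^+ 2 = 1 - a ^+ 2 by rewrite sqr_sqrtr // subr_ge0 expr_le1.
have nFa : normc (F z y) = rz * r * a by rewrite /a mulrC divfK // mulf_neq0 ?gt_eqF.
have ab1 : a ^+ 2 + b ^+ 2 = 1 by rewrite bb addrC subrK.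
clearbody a; clearbody b.
have [om om1 Fom] : exists2 om : R[i], normc om = 1 & F z y = om * (rz * r * a)%:C.
  have [u u1 hu] := normc_phase (F z y); exists u^*; first by rewrite normc_conj.
  by rewrite -nFa -hu mulrA mulJc u1 expr1n mul1r.
suff a1' : a = 1 by rewrite nFa a1' mulr1 exprMn.
(* The points [x0], [y], [z] sit in the plane with the Gram matrix [F], the
   second one on the first axis. *)
pose pt (i : 'I_3) := nth x0 [:: x0; y; z] i.
pose w (i : 'I_3) (l : 'I_2) : R[i] :=
  nth 0 (nth [::] [:: [:: 0; 0]; [:: r%:C; 0]; [:: om * (rz * a)%:C; om * (rz * b)%:C]] i) l.
have wF i j : \sum_l w i l * (w j l)^* = F (pt i) (pt j).
  rewrite !big_ord_recl big_ord0 addr0.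
  have Fx0l t : F x0 t = 0 by rewrite (pickFC hk) (pickFx0 hnorm1) conjC0.
  have oo : om * om^* = 1 by rewrite mulcJ om1 expr1n.
  case: i => [[|[|[|i]]] // hi]; case: j => [[|[|[|j]]] // hj]; rewrite /w /pt /=;
    rewrite ?Fx0l ?(pickFx0 hnorm1) ?mul0r ?conjC0 ?mulr0 ?addr0 ?mul0r //.
  - by rewrite cjR -rcM -expr2 rr pickF_diag.
  - by rewrite cjM cjR (pickFC hk) Fom cjM cjR !rcM; ring.
  - by rewrite cjR Fom !rcM; ring.
  rewrite pickF_diag -rrz !cjM !cjR.
  rewrite (_ : _ + _ = (om * om^*) * (rz ^+ 2 * (a ^+ 2 + b ^+ 2))%:C); last first.
    rewrite !(rcM, rcD, rcX); ring.
  by rewrite oo mul1r ab1 mulr1.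
have [] := @pick_row _ _ H k hk hNP _ _ pt w.
  move=> c.
  have -> : \sum_i \sum_j (c i)^* * c j *
      (k (pt i) (pt j) * (1 - \sum_l w i l * (w j l)^*)) =
      (normc (\sum_i c i) ^+ 2)%:C.
    rewrite -mulJc cj_sum mulr_suml; apply: eq_bigr => i _.
    rewrite mulr_sumr; apply: eq_bigr => j _.
    by rewrite wF (k_pickF hk0) mulr1.
  by rewrite ler0c sqr_ge0.
move=> phi [hphi cphi].
pose z1 := phi ord0; pose z2 := phi (lift ord0 ord0).
have row g h : nrm (mact z1 g + mact z2 h) ^+ 2 <= nrm g ^+ 2 + nrm h ^+ 2.
  have := cphi (fun l => if l == ord0 then g else h).
  by rewrite !big_ord_recl !big_ord0 /= !addr0.
pose psi := a%:C *: z1 + b%:C *: z2.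
have c1 : contr z1.
  move=> g; rewrite -(@ler_pXn2r _ 2) ?nnegrE ?nrm_ge0 //.
  by have := row g 0; rewrite mact0r addr0 nrm0 expr0n addr0.
have cpsi : contr psi.
  move=> g; rewrite -(@ler_pXn2r _ 2) ?nnegrE ?nrm_ge0 //.
  have := row (a%:C *: g) (b%:C *: g); rewrite !nrmZ !ger0_normcR // !exprMn -mulrDl.
  by rewrite ab1 mul1r !mactZr mactDl !mactZl.
have z10 : mv z1 x0 = 0 by rewrite (hphi ord0).
have z20 : mv z2 x0 = 0 by rewrite (hphi ord0).
have z1y : mv z1 y = r%:C by rewrite (hphi (lift ord0 ord0)).
have psiz : mv psi z = om * rz%:C.
  rewrite mvD !mvZ /z1 /z2.
  rewrite (hphi (lift ord0 (lift ord0 ord0)) ord0).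
  rewrite (hphi (lift ord0 (lift ord0 ord0)) (lift ord0 ord0)) /w /=.
  rewrite (_ : _ + _ = om * (rz * (a ^+ 2 + b ^+ 2))%:C); last first.
    rewrite !(rcM, rcD, rcX); ring.
  by rewrite ab1 mulr1.
have Z n : 1 <= nrm (mact (z1 ^+ n) one).
  apply: (@extremal_pow_norm _ y) => //; rewrite z1y.
    by rewrite -normc_gt0 ger0_normcR // ltW.
  by rewrite ger0_normcR ?ltW.
have Psi n : 1 <= nrm (mact (psi ^+ n) one).
  apply: (@extremal_pow_norm _ z) => //.
  - by rewrite mvD !mvZ z10 z20 !mulr0 addr0.
  - by rewrite psiz -normc_gt0 normcM om1 mul1r ger0_normcR // ltW.
  by rewrite psiz normcM om1 mul1r ger0_normcR ?ltW.
pose e1 := mact z1 one; pose v := mact z1 e1.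
have ne1 : nrm e1 <= 1 by have := c1 one; rewrite (nrm_one hk hnorm1).
have nv : 1 <= nrm v by have := Z 2%N; rewrite expr2 mactM.
(* Since [z1^2] has norm at least 1, the row contraction leaves no room for a
   component of [z2 g] along it. *)
have orth g : ip v (mact z2 g) = 0.
  apply: (@psd_form2_eq _ (nrm g ^+ 2)) => c.
  have := row e1 (- c *: g); rewrite mactZr -/v nrmD2 ipZr !nrmZ normcN !exprMn.
  rewrite cjN mulNr ReN => h1.
  have h2 : nrm e1 ^+ 2 <= 1 by rewrite expr_le1 ?nrm_ge0.
  have h3 : 1 <= nrm v ^+ 2 by rewrite expr_ge1 ?nrm_ge0.
  have h4 : 0 <= normc c ^+ 2 * nrm (mact z2 g) ^+ 2 by rewrite mulr_ge0 ?sqr_ge0.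
  lra.
pose p := mact psi (mact psi one).
have np : 1 <= nrm p by have := Psi 2%N; rewrite expr2 mactM.
have pE : p = (a ^+ 2)%:C *: v +
    mact z2 ((2 * a * b)%:C *: e1 + (b ^+ 2)%:C *: mact z2 one).
  apply: hvec_ext => t; rewrite evD evZ !ev_mact evD !evZ !ev_mact (ev_one hk hnorm1).
  rewrite mvD !mvZ !(rcM, rcX) rc_nat; ring.
have vp : Re (ip v p) = a ^+ 2 * nrm v ^+ 2.
  by rewrite pE ipDr ipZr orth addr0 cjR ipxx -rcM rcK.
have lower : 2 + 2 * a ^+ 2 <= nrm (v + p) ^+ 2.
  rewrite nrmD2 vp.
  have h3 : 1 <= nrm v ^+ 2 by rewrite expr_ge1 ?nrm_ge0.
  have h4 : 1 <= nrm p ^+ 2 by rewrite expr_ge1 ?nrm_ge0.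
  have h5 : a ^+ 2 * 1 <= a ^+ 2 * nrm v ^+ 2.
    by apply: ler_wpM2l => //; exact: sqr_ge0.
  lra.
have upper : nrm (v + p) <= 1 + a.
  have -> : v + p = mact (z1 ^+ 2 + psi ^+ 2) one by rewrite mactDl !expr2 !mactM.
  have a10 : 0 <= 1 + a by lra.
  have := @gelfand_le _ _ H gel (z1 ^+ 2 + psi ^+ 2) (1 + a) a10.
  move=> /(_ _ one); rewrite (nrm_one hk hnorm1) mulr1; apply.
  move=> chi; rewrite chvD !chvX; set c1' := chv chi z1; set et := chv chi psi.
  set c2' := chv chi z2.
  have etE : et = a%:C * c1' + b%:C * c2' by rewrite /et chvD !chvZ.
  have le1 : normc c1' ^+ 2 + normc c2' ^+ 2 <= 1.
    apply: normc2_le1 => al be ab.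
    have /(gelfand_contr gel chi) : contr (al *: z1 + be *: z2).
      move=> g; rewrite -(@ler_pXn2r _ 2) ?nnegrE ?nrm_ge0 //.
      have := row (al *: g) (be *: g); rewrite !nrmZ !exprMn -mulrDl.
      rewrite !mactZr mactDl !mactZl => /le_trans; apply.
      by rewrite -[leRHS]mul1r; apply: ler_wpM2r => //; exact: sqr_ge0.
    by rewrite chvD !chvZ.
  have h1 : normc (c1' ^+ 2 + et ^+ 2) <= normc c1' ^+ 2 + normc et ^+ 2.
    by apply: le_trans (le_normcD _ _) _; rewrite !normcX.
  apply: le_trans h1 _.
  have h2 : normc et <= a * normc c1' + b * normc c2'.
    by rewrite etE; apply: le_trans (le_normcD _ _) _; rewrite !normcM !ger0_normcR.
  have h3 : normc et ^+ 2 <= (a * normc c1' + b * normc c2') ^+ 2.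
    by rewrite ler_pXn2r ?nnegrE ?normc_ge0 // addr_ge0 // mulr_ge0 ?normc_ge0.
  set x := normc c1' in le1 h3 *; set yy := normc c2' in le1 h3.
  have h4 := quadratic_bound a0 a1 ab1 le1.
  by apply: le_trans h4; rewrite lerD2l.
have : nrm (v + p) ^+ 2 <= (1 + a) ^+ 2.
  by rewrite ler_pXn2r ?nnegrE ?nrm_ge0 // addr_ge0.
move=> up; have h : (1 - a) ^+ 2 <= 0 by lra.
have : (1 - a) ^+ 2 == 0 by rewrite eq_le h sqr_ge0.
by rewrite sqrf_eq0 subr_eq0 => /eqP.
Qed.

End GelfandIsometric.

(** * Power series and square summable sequences *)

Section PowerSeries.
Context {R : realType}.
Implicit Types (a b : nat -> R[i]) (z w : R[i]).

Definition ctends (s : nat -> R[i]) (l : R[i]) :=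
  forall e : R, 0 < e -> exists N, forall n, (N <= n)%N -> normc (s n - l) < e.

Definition pspart a z (n : nat) : R[i] := \sum_(i < n) a i * z ^+ i.

Definition psval a z w := ctends (pspart a z) w.

Definition l2bd a (B : R) := forall M, \sum_(i < M) normc (a i) ^+ 2 <= B.

Lemma ctends_unique s l l' : ctends s l -> ctends s l' -> l = l'.
Proof.
move=> h h'; apply/eqP; rewrite -subr_eq0 -normc_eq0 eq_le normc_ge0 andbT.
apply: (@ler_eps _ 2) => e e0; have [N hN] := h e e0; have [N' hN'] := h' e e0.
have := hN _ (leq_maxl N N'); have := hN' _ (leq_maxr N N').
set t := s _ => h1 h2.
have -> : l - l' = (t - l') - (t - l) by ring.
apply: le_trans (le_normcD _ _) _; rewrite normcN; lra.
Qed.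

Lemma ctends_cst l : ctends (fun=> l) l.
Proof. by move=> e e0; exists 0%N => n _; rewrite subrr normc0. Qed.

Lemma ctendsD s t l m : ctends s l -> ctends t m -> ctends (fun n => s n + t n) (l + m).
Proof.
move=> hs ht e e0; have e2 : 0 < e / 2 by rewrite divr_gt0.
have [N hN] := hs _ e2; have [M hM] := ht _ e2.
exists (maxn N M) => n; rewrite geq_max => /andP[/hN h1 /hM h2].
rewrite (_ : _ - _ = (s n - l) + (t n - m)); last by ring.
by apply: le_lt_trans (le_normcD _ _) _; rewrite (splitr e) ltrD.
Qed.

Lemma ctendsM c s l : ctends s l -> ctends (fun n => c * s n) (c * l).
Proof.
move=> hs e e0; have c1 : 0 < normc c + 1 by rewrite ltr_wpDl ?normc_ge0.
have [N hN] := hs _ (divr_gt0 e0 c1); exists N => n /hN h.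
rewrite -mulrBr normcM; rewrite ltr_pdivlMr // in h.
apply: le_lt_trans h; rewrite mulrC; apply: ler_wpM2l; first exact: normc_ge0.
by rewrite lerDl.
Qed.

Lemma ctends_shift s l : ctends s l -> ctends (fun n => s n.+1) l.
Proof. by move=> h e /h[N hN]; exists N => n Nn; apply: hN; exact: leqW. Qed.

Lemma ctends_bound s l (B : R) : ctends s l -> (forall n, normc (s n) <= B) ->
  normc l <= B.
Proof.
move=> h hB; apply: (@ler_eps _ 1) => e e0; have [N /(_ N (leqnn N)) hN] := h e e0.
have := hB N; have := ler_normcB l (s N); rewrite (normcB_sym l); lra.
Qed.

Lemma psval_unique a z w w' : psval a z w -> psval a z w' -> w = w'.
Proof. exact: ctends_unique. Qed.

Lemma psvalPl c a b z w w' : psval a z w -> psval b z w' ->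
  psval (fun n => c * a n + b n) z (c * w + w').
Proof.
move=> ha hb; rewrite /psval.
have -> : pspart (fun n => c * a n + b n) z =
    (fun n => c * pspart a z n + pspart b z n).
  apply/funext => n; rewrite /pspart mulr_sumr -big_split; apply: eq_bigr => i _ /=.
  by rewrite mulrDl mulrA.
by apply: ctendsD => //; exact: ctendsM.
Qed.

Lemma psvalB a b z w w' : psval a z w -> psval b z w' ->
  psval (fun n => a n - b n) z (w - w').
Proof.
move=> ha hb; have := psvalPl (-1) hb ha.
rewrite mulN1r addrC (_ : (fun n => _) = (fun n => a n - b n)) //.
by apply/funext => n; rewrite mulN1r addrC.
Qed.

Lemma l2bd_ge0 a B : l2bd a B -> 0 <= B.
Proof. by move=> /(_ 0%N); rewrite big_ord0. Qed.

Lemma l2_partial_le a M N : (M <= N)%N ->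
  \sum_(i < M) normc (a i) ^+ 2 <= \sum_(i < N) normc (a i) ^+ 2.
Proof.
move=> MN; rewrite -(subnKC MN) big_split_ord /= lerDl.
by apply: sumr_ge0 => i _; exact: sqr_ge0.
Qed.

Lemma l2bd_tail a B : l2bd a B -> forall e : R, 0 < e -> exists N, forall q,
  (N <= q)%N -> l2bd (fun i => a (q + i)%N) e.
Proof.
move=> ha e e0.
pose S n := \sum_(i < n) normc (a i) ^+ 2.
have hs : has_sup (range S).
  by split; [exists (S 0%N); exists 0%N|exists B => _ [n _ <-]; exact: ha].
have [_ [N _ <-] hN] := sup_adherent e0 hs.
exists N => q Nq M.
have h1 : S (q + M)%N <= sup (range S) by apply: ub_le_sup; [case: hs|exists (q + M)%N].
have h2 : S N <= S q by exact: l2_partial_le.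
have : S (q + M)%N = S q + \sum_(i < M) normc (a (q + i)%N) ^+ 2.
  by rewrite /S big_split_ord.
move=> h3; move: hN h1; rewrite h3; lra.
Qed.

Lemma normc_sqrD_le z w : normc (z + w) ^+ 2 <= 2 * (normc z ^+ 2 + normc w ^+ 2).
Proof.
have h1 : normc (z + w) ^+ 2 <= (normc z + normc w) ^+ 2.
  by rewrite ler_pXn2r ?nnegrE ?addr_ge0 ?normc_ge0 // le_normcD.
have := sqr_ge0 (normc z - normc w); lra.
Qed.

Lemma l2bdPl c a b A B : l2bd a A -> l2bd b B ->
  l2bd (fun n => c * a n + b n) (2 * (normc c ^+ 2 * A + B)).
Proof.
move=> ha hb M.
apply: (@le_trans _ _ (\sum_(i < M) 2 * (normc c ^+ 2 * normc (a i) ^+ 2 + normc (b i) ^+ 2))).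
  apply: ler_sum => i _; apply: le_trans (normc_sqrD_le _ _) _.
  by rewrite normcM exprMn.
rewrite -mulr_sumr big_split /= -mulr_sumr; apply: ler_wpM2l => //.
by apply: lerD (hb M); apply: ler_wpM2l (ha M); exact: sqr_ge0.
Qed.

Lemma l2bdB a b A B : l2bd a A -> l2bd b B ->
  l2bd (fun n => a n - b n) (2 * (A + B)).
Proof.
move=> ha hb M; have := l2bdPl (-1) hb ha M.
rewrite normcN normc1 expr1n mul1r addrC.
by congr (_ <= _); apply: eq_bigr => i _; rewrite mulN1r addrC.
Qed.

End PowerSeries.

(** * Pullbacks of the Szego kernel *)

Section SzegoKernel.
Context {R : realType} {X : Type} (H : rkhs (R := R) X) (k : X -> X -> R[i]).
Hypothesis hk : is_kernel H k.
Notation kv := (kv hk).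
Variables (u : X -> R[i]) (x0 : X).
Hypotheses (hu1 : forall x, normc (u x) < 1) (hu0 : u x0 = 0)
  (hku : forall x y, k x y = 1 / (1 - u x * (u y)^*)).
Notation one := (kv x0).

Lemma szego_denom x y : 1 - u x * (u y)^* != 0.
Proof.
rewrite subr_eq0; apply/eqP => /(congr1 (@normc _)); rewrite normc1 normcM normc_conj.
move=> h; have := normc_ge0 (u x); have := normc_ge0 (u y).
have := hu1 x; have := hu1 y; nra.
Qed.

Lemma szego_normalized : normalized k x0.
Proof. by move=> x; rewrite hku hu0 conjC0 mulr0 subr0 divr1. Qed.

Lemma szego_contr_multiplier :
  exists phi : mult H, (forall x, mv phi x = u x) /\ contr phi.
Proof.
apply: (contr_multiplier (hk := hk)) => s.
rewrite -(@ler_pXn2r _ 2) ?nnegrE ?nrm_ge0 // -lecR !nrm_lcomb2.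
rewrite [leLHS]big_map -subr_ge0 -sumrB.
under eq_bigr do rewrite [X in _ - X]big_map -sumrB.
have -> : \sum_(p <- s) \sum_(q <- s) (p.1^* * q.1 * k p.2 q.2 -
    (p.1 * (u p.2)^*, p.2).1^* * (q.1 * (u q.2)^*, q.2).1 *
    k (p.1 * (u p.2)^*, p.2).2 (q.1 * (u q.2)^*, q.2).2) =
    (normc (\sum_(q <- s) q.1) ^+ 2)%:C.
  rewrite -mulJc cj_sum mulr_suml; apply: eq_bigr => p _.
  rewrite mulr_sumr; apply: eq_bigr => q _ /=.
  by rewrite cjM cjK hku; field; exact: szego_denom.
by rewrite ler0c sqr_ge0.
Qed.

Variable phi : mult H.
Hypotheses (hphi : forall x, mv phi x = u x) (cphi : contr phi).

Let evone := ev_one hk szego_normalized.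

Lemma ev_pow n x : ev (mact (phi ^+ n) one) x = u x ^+ n.
Proof. by rewrite ev_mact evone mulr1 mvX hphi. Qed.

Definition hpart (a : nat -> R[i]) M : hvec H :=
  \sum_(n < M) a n *: mact (phi ^+ n) one.

Lemma ev_hpart a M x : ev (hpart a M) x = pspart a (u x) M.
Proof.
by rewrite ev_sum; apply: eq_bigr => n _; rewrite evZ ev_pow.
Qed.

Lemma hpart_cons a M :
  hpart a M.+1 = a 0%N *: one + mact phi (hpart (fun n => a n.+1) M).
Proof.
rewrite /hpart big_ord_recl expr0 mact1 mact_sumr; congr (_ + _).
by apply: eq_bigr => n _; rewrite exprS mactM mactZr.
Qed.

(** The multiplier is contractive and its range is orthogonal to the constants,
    so that its powers behave like the powers of a coordinate in [H^2]. *)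
Lemma nrm_hpart a M : nrm (hpart a M) ^+ 2 <= \sum_(n < M) normc (a n) ^+ 2.
Proof.
elim: M a => [|M IH] a; first by rewrite /hpart !big_ord0 nrm0 expr0n.
rewrite hpart_cons big_ord_recl nrmD2 nrmZ (nrm_one hk szego_normalized) mulr1.
rewrite ipZl ip_kvl ev_mact hphi hu0 mul0r conjC0 !mulr0 addr0 lerD2l.
apply: le_trans (IH (fun n => a n.+1)).
by rewrite ler_pXn2r ?nnegrE ?nrm_ge0 //; exact: cphi.
Qed.

Lemma hpart_split a M N : hpart a (M + N)%N =
  hpart a M + mact (phi ^+ M) (hpart (fun n => a (M + n)%N) N).
Proof.
rewrite /hpart big_split_ord /=; congr (_ + _).
rewrite mact_sumr; apply: eq_bigr => n _.
by rewrite exprD mactM mactZr.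
Qed.

Lemma contr_pow M f : nrm (mact (phi ^+ M) f) <= nrm f.
Proof.
elim: M f => [|M IH] f; first by rewrite expr0 mact1.
by rewrite exprSr mactM (le_trans (IH _)) // cphi.
Qed.

Lemma hpart_tail a B M N : l2bd (fun n => a (M + n)%N) (B ^+ 2) -> 0 <= B ->
  nrm (hpart a (M + N)%N - hpart a M) <= B.
Proof.
move=> ha B0; rewrite hpart_split addrC addKr.
apply: le_trans (contr_pow _ _) _.
rewrite -(@ler_pXn2r _ 2) ?nnegrE ?nrm_ge0 //.
by apply: le_trans (nrm_hpart _ _) _; exact: ha.
Qed.

Lemma normc_ev (f : hvec H) x : normc (ev f x) <= nrm f * nrm (kv x).
Proof. by rewrite -(ip_kv hk); exact: cauchy_schwarz. Qed.

(** The partial sums are Cauchy, by [nrm_hpart] for the tails. *)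
Lemma l2_composition a B : l2bd a B -> exists g : hvec H,
  [/\ forall x, psval a (u x) (ev g x), nrm g ^+ 2 <= B
    & forall e, 0 < e -> exists N, forall n, (N <= n)%N -> nrm (hpart a n - g) < e].
Proof.
move=> ha.
have [g hg] : exists g, forall e, 0 < e -> exists N, forall n, (N <= n)%N ->
    nrm (hpart a n - g) < e.
  apply: hvec_complete => e e0.
  have e4 : 0 < e / 4 by rewrite divr_gt0.
  have [N hN] := l2bd_tail ha (exprn_gt0 2 e4).
  have key p : (N <= p)%N -> nrm (hpart a p - hpart a N) <= e / 4.
    by move=> Np; rewrite -(subnKC Np); apply: hpart_tail; [exact: hN|exact: ltW].
  exists N => p q /key hp /key hq.
  rewrite (_ : _ - _ = (hpart a p - hpart a N) - (hpart a q - hpart a N)).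
    by apply: le_lt_trans (nrmB _ _) _; lra.
  by rewrite opprB addrA subrK.
exists g; split=> //.
  move=> x e e0; have kx0 : 0 < nrm (kv x) + 1 by rewrite ltr_wpDl ?nrm_ge0.
  have [N hN] := hg _ (divr_gt0 e0 kx0); exists N => n /hN h.
  rewrite -ev_hpart -evB; apply: le_lt_trans (normc_ev _ _) _.
  rewrite ltr_pdivlMr // in h; apply: le_lt_trans h.
  by apply: ler_wpM2l; [exact: nrm_ge0|rewrite lerDl].
have B0 := l2bd_ge0 ha.
have : nrm g <= Num.sqrt B.
  apply: (@ler_eps _ 1) => e e0; have [N /(_ N (leqnn N)) hN] := hg e e0.
  have h1 : nrm (hpart a N) <= Num.sqrt B.
    rewrite -(@ler_pXn2r _ 2) ?nnegrE ?nrm_ge0 ?sqrtr_ge0 // [leRHS]sqr_sqrtr //.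
    by apply: le_trans (nrm_hpart _ _) _; exact: ha.
  have := ler_nrmB g (hpart a N); rewrite (nrmB_sym g); lra.
rewrite -(@ler_pXn2r _ 2) ?nnegrE ?nrm_ge0 ?sqrtr_ge0 // [leRHS]sqr_sqrtr //.
Qed.

(** The adjoint of the composition of power series with [u]. *)
Definition hcoef (g : hvec H) (n : nat) : R[i] := ip g (mact (phi ^+ n) one).

Lemma geometric_psval x y : psval (fun n => (u x)^* ^+ n) (u y) (k y x).
Proof.
set q := u y * (u x)^*.
have q1 : normc q < 1.
  rewrite normcM normc_conj; have := hu1 x; have := hu1 y.
  by have := normc_ge0 (u x); have := normc_ge0 (u y); nra.
have d0 : 0 < normc (1 - q) by rewrite normc_gt0 szego_denom.
move=> e e0; have [M hM] := expr_small (normc_ge0 q) q1 (mulr_gt0 e0 d0).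
exists M.+1 => n Mn.
have -> : pspart (fun n => (u x)^* ^+ n) (u y) n - k y x = - (q ^+ n / (1 - q)).
  rewrite hku /pspart -/q.
  have -> : \sum_(i < n) (u x)^* ^+ i * u y ^+ i = \sum_(i < n) q ^+ i.
    by apply: eq_bigr => i _; rewrite -exprMn mulrC.
  have h0 : 1 - q != 0 by exact: szego_denom.
  have : (\sum_(i < n) q ^+ i) * (1 - q) = 1 - q ^+ n.
    by rewrite -opprB mulrN mulrC -subrX1 opprB.
  move=> h; apply: (mulIf h0); rewrite mulrBl h; field; exact: h0.
rewrite normcN normcM normcV ltr_pdivrMr // normcX.
by apply: le_lt_trans hM; apply: ler_wiXn2l; rewrite ?normc_ge0 // ltW.
Qed.

Lemma geometric_l2bd x : l2bd (fun n => (u x)^* ^+ n) (1 - normc (u x) ^+ 2)^-1.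
Proof.
have h1 : 0 < 1 - normc (u x) ^+ 2.
  by rewrite subr_gt0 expr_lt1 ?normc_ge0.
move=> M; rewrite -(ler_pM2r h1) mulVf ?gt_eqF //.
under eq_bigr do rewrite normcX normc_conj -exprM mulnC exprM.
have -> : (\sum_(i < M) (normc (u x) ^+ 2) ^+ i) * (1 - normc (u x) ^+ 2) =
    1 - (normc (u x) ^+ 2) ^+ M.
  by rewrite -opprB mulrN mulrC -subrX1 opprB.
by rewrite lerBlDr lerDl exprn_ge0 // sqr_ge0.
Qed.

(** The kernel function [k_x] is the composition of [sum (u x)^*^n z^n] with
    [u], so that pairing with it sums the series of the inner products. *)
Lemma hcoef_spec g :
  l2bd (hcoef g) (nrm g ^+ 2) /\ forall x, psval (hcoef g) (u x) (ev g x).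
Proof.
split=> [M|x].
  have E : (\sum_(n < M) normc (hcoef g n) ^+ 2)%:C = ip g (hpart (hcoef g) M).
    rewrite rc_sum ip_sumr; apply: eq_bigr => n _.
    by rewrite ipZr -mulJc.
  have h1 := cauchy_schwarz g (hpart (hcoef g) M); rewrite -E in h1.
  have := nrm_hpart (hcoef g) M.
  move: h1; set T := \sum_(n < M) _.
  have T0 : 0 <= T by apply: sumr_ge0 => *; exact: sqr_ge0.
  rewrite ger0_normcR //; set p := nrm g; set q := nrm _ => h1 h2.
  have p0 : 0 <= p := nrm_ge0 _; have q0 : 0 <= q := nrm_ge0 _.
  have : T * T <= T * p ^+ 2.
    have : T ^+ 2 <= (p * q) ^+ 2 by rewrite ler_pXn2r ?nnegrE ?mulr_ge0.
    by rewrite exprMn; have := sqr_ge0 p => *; nra.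
  have [->|Tn0] := eqVneq T 0; first by rewrite sqr_ge0.
  by rewrite ler_pM2l // lt_neqAle eq_sym Tn0.
have [h [hh _ ch]] := l2_composition (geometric_l2bd x).
have -> : ev g x = ip g h.
  rewrite -(ip_kv hk); congr ip; apply: hvec_ext => y.
  by rewrite ev_kv; apply: psval_unique (geometric_psval x y) (hh y).
move=> e e0; have g1 : 0 < nrm g + 1 by rewrite ltr_wpDl ?nrm_ge0.
have [N hN] := ch _ (divr_gt0 e0 g1); exists N => n /hN h1.
have -> : pspart (hcoef g) (u x) n = ip g (hpart (fun n => (u x)^* ^+ n) n).
  rewrite ip_sumr; apply: eq_bigr => i _; rewrite ipZr rmorphXn /= cjK mulrC.
  by [].
rewrite -ipBr; apply: le_lt_trans (cauchy_schwarz _ _) _.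
rewrite ltr_pdivlMr // in h1; apply: le_lt_trans h1.
by rewrite mulrC; apply: ler_wpM2l; [exact: nrm_ge0|rewrite lerDl].
Qed.

(** If no power of [u] has norm less than 1 then no nonzero element of [H^2]
    vanishes on the range of [u]: a multiple of it could be subtracted from a
    power of the coordinate to reduce the norm. *)
Lemma l2_vanishing a B : (forall n, 1 <= nrm (mact (phi ^+ n) one)) ->
  l2bd a B -> (forall x, psval a (u x) 0) -> forall n, a n = 0.
Proof.
move=> hn ha a0 n.
apply: (@psd_form2_eq _ B) => c.
pose d m : R[i] := (m == n)%:R.
have dl : l2bd (fun i => d i + c^* * a i)
    (1 + (normc c ^+ 2 * B + 2 * Re (c^* * a n))).
  move=> M.
  apply: (@le_trans _ _ (\sum_(i < maxn M n.+1) normc (d i + c^* * a i) ^+ 2)).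
    by apply: (@l2_partial_le _ (fun i => d i + c^* * a i)); exact: leq_maxl.
  under eq_bigr do rewrite normcD2 normcM normc_conj exprMn.
  rewrite !big_split /= -mulr_sumr -addrA; apply: lerD; last apply: lerD.
  - have nM : (n < maxn M n.+1)%N by rewrite leq_max ltnSn orbT.
    rewrite (bigD1 (Ordinal nM)) //= big1 ?addr0 /d ?eqxx ?normc1 ?expr1n //.
    move=> i /negbTE h; rewrite -val_eqE /= in h.
    by rewrite h normc0 expr0n.
  - by apply: ler_wpM2l; [exact: sqr_ge0|exact: ha].
  have nM : (n < maxn M n.+1)%N by rewrite leq_max ltnSn orbT.
  rewrite (bigD1 (Ordinal nM)) //= big1 ?addr0 /d ?eqxx; last first.
    move=> i /negbTE h; rewrite -val_eqE /= in h.
    by rewrite h mul0r mulr0.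
  by rewrite mul1r ReJ.
have [g [hg ng _]] := l2_composition dl.
have : g = mact (phi ^+ n) one.
  apply: hvec_ext => x; apply: psval_unique (hg x) _.
  rewrite ev_pow; have := psvalPl c^* (a0 x) (_ : psval d (u x) (u x ^+ n)).
  rewrite mulr0 add0r (_ : (fun m => c^* * a m + d m) = (fun m => d m + c^* * a m)).
    apply; move=> e e0; exists n.+1 => M nM.
    rewrite /pspart (bigD1 (Ordinal nM)) //= big1 ?addr0 /d ?eqxx ?mul1r ?subrr ?normc0 //.
    move=> i /negbTE h; rewrite -val_eqE /= in h.
    by rewrite h mul0r.
  by apply/funext => m; rewrite addrC.
move=> gE; have := hn n; rewrite -gE => h.
have : 1 <= nrm g ^+ 2 by rewrite expr_ge1 ?nrm_ge0.
lra.
Qed.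

End SzegoKernel.

(** * Complex derivatives and power series *)

Section ComplexDerivative.
Context {R : realType}.
Implicit Types (f g : R[i] -> R[i]) (z w h l : R[i]).

Lemma real_cauchy (s : nat -> R) :
  (forall e : R, 0 < e -> exists N, forall p q, (N <= p)%N -> (N <= q)%N ->
     `|s p - s q| < e) ->
  exists l : R, forall e : R, 0 < e -> exists N, forall n, (N <= n)%N -> `|s n - l| < e.
Proof.
move=> hs; pose A := [set x | exists N, forall n, (N <= n)%N -> x <= s n].
have key e : 0 < e -> exists N, (forall n, (N <= n)%N -> `|s n - s N| < e) /\
    A (s N - e) /\ forall x, A x -> x <= s N + e.
  move=> e0; have [N hN] := hs e e0; exists N; split=> [n Nn|]; first exact: hN.
  split.
    by exists N => n Nn; have := hN n N Nn (leqnn N); rewrite ltr_norml => /andP[]; lra.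
  move=> x [M hM]; have := hM _ (leq_maxr N M).
  by have := hN _ N (leq_maxl N M) (leqnn N); rewrite ltr_norml => /andP[]; lra.
have [N1 [_ [AN1 ub]]] := key 1 ltr01.
have sA : has_sup A by split; [exists (s N1 - 1)|exists (s N1 + 1)].
exists (sup A) => e e0; have e2 : 0 < e / 2 by rewrite divr_gt0.
have [N [hN [AN ubN]]] := key _ e2.
exists N => n /hN; have h1 : s N - e / 2 <= sup A by apply: ub_le_sup; [case: sA|].
have h2 : sup A <= s N + e / 2 by apply: ge_sup => //; exists (s N - e / 2).
rewrite !ltr_norml => /andP[h3 h4]; apply/andP; split; lra.
Qed.

Lemma complex_cauchy (s : nat -> R[i]) :
  (forall e : R, 0 < e -> exists N, forall p q, (N <= p)%N -> (N <= q)%N ->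
     normc (s p - s q) < e) ->
  exists l, ctends s l.
Proof.
move=> hs.
have [|a ha] := @real_cauchy (fun n => Re (s n)).
  move=> e /hs[N hN]; exists N => p q Np Nq; rewrite -ReB.
  by apply: le_lt_trans (ler_normRe_normc _) _; exact: hN.
have [|b hb] := @real_cauchy (fun n => Im (s n)).
  move=> e /hs[N hN]; exists N => p q Np Nq.
  apply: le_lt_trans (hN p q Np Nq); apply: le_trans (ler_Im_normc _).
  by case: (s p) => ? ?; case: (s q).
exists (Complex a b) => e e0; have e2 : 0 < e / 2 by rewrite divr_gt0.
have [N hN] := ha _ e2; have [M hM] := hb _ e2.
exists (maxn N M) => n; rewrite geq_max => /andP[/hN h1 /hM h2].
apply: le_lt_trans (ler_normc_ReIm _) _; rewrite (splitr e).
by move: h1 h2; case: (s n) => x y /= h1 h2; rewrite ltrD.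
Qed.

Lemma complex_abs_series (b : nat -> R[i]) (B : R) :
  (forall M, \sum_(i < M) normc (b i) <= B) ->
  exists l, ctends (fun n => \sum_(i < n) b i) l.
Proof.
move=> hB; apply: complex_cauchy => e e0.
pose S n := \sum_(i < n) normc (b i).
have hs : has_sup (range S).
  by split; [exists (S 0%N); exists 0%N|exists B => _ [n _ <-]; exact: hB].
have e2 : 0 < e / 2 by rewrite divr_gt0.
have [_ [N _ <-] hN] := sup_adherent e2 hs.
have key p : (N <= p)%N ->
    normc (\sum_(i < p) b i - \sum_(i < N) b i) < e / 2.
  move=> Np; have h1 : S p <= sup (range S) by apply: ub_le_sup; [case: hs|exists p].
  have := h1; rewrite -(subnKC Np) /S !big_split_ord /= addrAC subrr add0r => h2.
  apply: le_lt_trans (normc_sum _ _ _) _; move: hN h2; rewrite /S; lra.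
exists N => p q /key hp /key hq.
rewrite (_ : _ - _ = (\sum_(i < p) b i - \sum_(i < N) b i)
  - (\sum_(i < q) b i - \sum_(i < N) b i)); last by ring.
by apply: le_lt_trans (le_normcD _ _) _; rewrite normcN (splitr e) ltrD.
Qed.

(** The derivative with moduli in [R]; a metric form suits the estimates below. *)
Definition cdiff f z l := forall e : R, 0 < e -> exists2 d : R, 0 < d &
  forall h, normc h < d -> normc (f (z + h) - f z - h * l) <= e * normc h.

Lemma normCE z : `|z| = (normc z)%:C :> R[i]. Proof. by []. Qed.

Lemma derivable_cdiff (f : CC R -> CC R) (z : CC R) :
  derivable f z 1 -> cdiff f z ('D_1 f z).
Proof.
move=> df e e0; have /cvgrPdist_le /(_ e%:C) : h^-1 *: (f (h + z) - f z) @[h --> 0^']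
    --> ('D_1 f z : CC R).
  have := df; rewrite /derivable /derive => /cvg_ex[l hl].
  move: (hl); move/cvg_lim => /(_ (@norm_hausdorff _ _)) ->.
  apply: cvg_trans hl; apply: near_eq_cvg; near=> h.
  by rewrite /= -[h *: 1]/(h * 1) mulr1.
rewrite ltcR => /(_ e0) /nbhs_ballP[d /= d0 hd].
have dr : d = (Re d)%:C by rewrite RRe_real // gtr0_real.
exists (Re d); first by rewrite -ltcR -dr.
move=> h hhd; have [->|h0] := eqVneq h 0.
  by rewrite addr0 subrr mul0r subr0 normc0 mulr0.
have : ball (0 : CC R) d h.
  by rewrite -ball_normE /= sub0r normrN normCE dr ltcR.
move=> /hd /(_ h0); rewrite normCE lecR => hle.
have hn : 0 < normc h by rewrite normc_gt0.
rewrite -(@ler_pM2l _ (normc h)^-1) ?invr_gt0 // mulrCA mulVf ?gt_eqF // mulr1.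
apply: le_trans hle; rewrite -normcV -normcM normcB_sym le_eqVlt; apply/orP; left.
apply/eqP; congr normc; rewrite addrC -[_ *: _]/(h^-1 * (f (h + z) - f z)).
by rewrite (addrC h z); field.
Unshelve. all: by end_near.
Qed.

Lemma cdiff_is_derive (f : CC R -> CC R) (z l : CC R) :
  cdiff f z l -> derivable f z 1 /\ derive1 f z = l.
Proof.
move=> hf.
have H1 : h^-1 *: (f (h + z) - f z) @[h --> (0 : CC R)^'] --> (l : CC R).
  apply/cvgrPdist_le => e e0.
  have er : e = (Re e)%:C by rewrite RRe_real // gtr0_real.
  have er0 : 0 < Re e by rewrite -ltcR -er.
  have [d d0 hd] := hf _ er0.
  apply/nbhs_ballP; exists d%:C; first by rewrite /= ltcR.
  move=> h; rewrite -ball_normE /= sub0r normrN normCE ltcR => hhd h0.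
  have hn : 0 < normc h by rewrite normc_gt0.
  rewrite normCE er lecR normcB_sym.
  rewrite -(@ler_pM2l _ (normc h)) // -normcM (mulrC (normc h)).
  apply: le_trans (hd h hhd); rewrite le_eqVlt; apply/orP; left; apply/eqP.
  congr normc; rewrite -[_ *: _]/(h^-1 * (f (h + z) - f z)) (addrC h z).
  by field.
split; last by apply: cvg_lim => //; exact: norm_hausdorff.
apply/cvg_ex; exists l; apply: cvg_trans H1; apply: near_eq_cvg; near=> h.
by rewrite /= -[h *: 1]/(h * 1) mulr1.
Unshelve. all: by end_near.
Qed.

Lemma cdiff_continuous f z l : cdiff f z l -> forall e : R, 0 < e ->
  exists2 d : R, 0 < d & forall w, normc (w - z) < d -> normc (f w - f z) < e.
Proof.
move=> hf e e0; have [d d0 hd] := hf 1 ltr01.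
have l1 : 0 < 2 + normc l by rewrite ltr_wpDr ?normc_ge0.
exists (Num.min d (e / (2 + normc l))); first by rewrite lt_min d0 divr_gt0.
move=> w; rewrite lt_min ltr_pdivlMr // => /andP[/hd h1 h2].
rewrite (_ : z + (w - z) = w) ?mul1r in h1; last by ring.
have -> : f w - f z = (f w - f z - (w - z) * l) + (w - z) * l by ring.
apply: le_lt_trans (le_normcD _ _) _; rewrite normcM.
have := normc_ge0 (w - z); have := normc_ge0 l.
move: h1 h2; set x := normc (w - z); set y := normc l.
move=> h1 h2 y0; rewrite le_eqVlt => /orP[/eqP x0|x0].
  by move: h1; rewrite -x0 mul0r addr0 => h1; lra.
have : 0 < x by []. nra.
Qed.

(** ** Differentiation of power series *)

Definition dcoef (a : nat -> R[i]) n : R[i] := n.+1%:R * a n.+1.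

Definition taylor_rem1 (K : comNzRingType) (z h : K) n : K :=
  (z + h) ^+ n - z ^+ n - n%:R * z ^+ n.-1 * h.

Lemma taylor_rem1S (K : comNzRingType) (z h : K) n :
  taylor_rem1 z h n.+1 = (z + h) * taylor_rem1 z h n + n%:R * z ^+ n.-1 * h ^+ 2.
Proof.
rewrite /taylor_rem1; case: n => [|n]; first by rewrite !expr0 /=; ring.
by rewrite /= !exprS -[n.+2%:R]natr1; ring.
Qed.

Lemma taylor_rem1_bound z h (d : R) n : 0 < d -> normc h <= d ->
  normc (taylor_rem1 z h n) <= (normc h / d) ^+ 2 * taylor_rem1 (normc z) d n.
Proof.
move=> d0 hd; elim: n => [|n IH].
  by rewrite /taylor_rem1 !expr0 !mul0r !subr0 !subrr normc0 mulr0.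
rewrite !taylor_rem1S [leRHS]mulrDr; apply: le_trans (le_normcD _ _) _; apply: lerD.
  rewrite normcM mulrCA; apply: ler_pM; rewrite ?normc_ge0 //.
  by apply: le_trans (le_normcD _ _) _; rewrite lerD2l.
rewrite !normcM !normcX -[n%:R]rc_nat ger0_normcR ?ler0n //.
rewrite exprMn exprVn le_eqVlt; apply/orP; left; apply/eqP.
by field; rewrite gt_eqF.
Qed.

Lemma taylor_rem1_real_le (z d : R) n : 0 <= z -> 0 < d ->
  taylor_rem1 z d n <= (z + d) ^+ n.
Proof.
move=> z0 d0; rewrite /taylor_rem1 -addrA gerDl -opprD oppr_le0 addr_ge0 //.
  exact: exprn_ge0.
by rewrite !mulr_ge0 ?exprn_ge0 ?ler0n // ltW.
Qed.

Lemma taylor_rem1_real_ge0 (z d : R) n : 0 <= z -> 0 < d -> 0 <= taylor_rem1 z d n.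
Proof.
move=> z0 d0; elim: n => [|n IH].
  by rewrite /taylor_rem1 !expr0 mul0r mul0r !subrr.
rewrite taylor_rem1S addr_ge0 // mulr_ge0 ?sqr_ge0 //.
  by rewrite addr_ge0 // ltW.
by rewrite mulr_ge0 ?ler0n ?exprn_ge0.
Qed.

Lemma geom_sum_le (x : R) n : 0 <= x -> x < 1 -> \sum_(i < n) x ^+ i <= (1 - x)^-1.
Proof.
move=> x0 x1; have h1 : 0 < 1 - x by rewrite subr_gt0.
rewrite -(ler_pM2r h1) mulVf ?gt_eqF //.
have -> : (\sum_(i < n) x ^+ i) * (1 - x) = 1 - x ^+ n.
  by rewrite -opprB mulrN mulrC -subrX1 opprB.
by rewrite lerBlDr lerDl exprn_ge0.
Qed.

Variable rho : R.
Hypothesis rho0 : 0 < rho.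

Definition psum_on a f := forall z, normc z < rho -> psval a z (f z).

Lemma psum_on_bound a f r : psum_on a f -> 0 < r -> r < rho ->
  exists2 M : R, 0 <= M & forall n, normc (a n) * r ^+ n <= M.
Proof.
move=> haf r0 rr; have zr : normc (r%:C : R[i]) < rho by rewrite ger0_normcR ?ltW.
have [N hN] := haf _ zr 1 ltr01.
pose b n := normc (a n) * r ^+ n.
have b0 n : 0 <= b n by rewrite mulr_ge0 ?normc_ge0 ?exprn_ge0 // ltW.
exists (2 + \sum_(i < N) b i); first by rewrite addr_ge0 // sumr_ge0.
move=> n; have [Nn|nN] := leqP N n; last first.
  rewrite -/(b n) (bigD1 (Ordinal nN)) //= addrCA lerDl addr_ge0 //.
  exact: sumr_ge0.
apply: (@le_trans _ _ 2); last by rewrite lerDl sumr_ge0.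
have := hN n Nn; have := hN n.+1 (leqW Nn).
rewrite /pspart big_ord_recr /=; set s := \sum_(i < n) _ => h1 h2.
have -> : normc (a n) * r ^+ n = normc (a n * r%:C ^+ n).
  by rewrite normcM normcX ger0_normcR // ltW.
rewrite (_ : a n * _ = (s + a n * r%:C ^+ n - f r%:C) - (s - f r%:C)); last by ring.
apply: le_trans (le_normcD _ _) _; rewrite normcN; lra.
Qed.

(** With [|z| + 2 d < rho] the second order remainders of the terms are
    dominated by those of the real power series at [|z|] with increment [d],
    which are at most [(|z| + d)^n]. *)
Lemma psum_on_deriv a f : psum_on a f ->
  exists2 f', psum_on (dcoef a) f' & forall z, normc z < rho -> cdiff f z (f' z).
Proof.
move=> haf.
have key z : normc z < rho -> exists l, psval (dcoef a) z l /\ cdiff f z l.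
  move=> zr.
  pose d := (rho - normc z) / 3; have d0 : 0 < d by rewrite divr_gt0 // subr_gt0.
  pose s := normc z + d; pose r := s + d.
  have z0 := normc_ge0 z.
  have s0 : 0 < s by rewrite ltr_wpDl.
  have r0 : 0 < r by rewrite ltr_wpDl // ltW.
  have rr : r < rho by rewrite /r /s /d; lra.
  have [M M0 hM] := psum_on_bound haf r0 rr.
  pose x := s / r.
  have x0 : 0 <= x by rewrite divr_ge0 // ltW.
  have x1 : x < 1 by rewrite ltr_pdivrMr // mul1r /r ltrDl.
  have an n : normc (a n) * s ^+ n <= M * x ^+ n.
    rewrite (_ : _ * s ^+ n = normc (a n) * r ^+ n * x ^+ n); last first.
      by rewrite /x exprMn exprVn; field; rewrite expf_neq0 // gt_eqF.
    by apply: ler_wpM2r (hM n); exact: exprn_ge0.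
  pose T := M * (1 - x)^-1.
  have hT n : \sum_(i < n) normc (a i) * s ^+ i <= T.
    apply: (@le_trans _ _ (\sum_(i < n) M * x ^+ i)); first exact: ler_sum.
    by rewrite -mulr_sumr; apply: ler_wpM2l => //; exact: geom_sum_le.
  have [l hl] : exists l, psval (dcoef a) z l.
    apply: (@complex_abs_series (fun i => dcoef a i * z ^+ i) (T / d)) => n.
    apply: (@le_trans _ _ (\sum_(i < n.+1) normc (a i) * s ^+ i / d)); last first.
      by rewrite -mulr_suml ler_pM2r ?invr_gt0 //; exact: hT.
    rewrite big_ord_recl expr0 mulr1; apply: ler_wpDl.
      by rewrite divr_ge0 ?normc_ge0 // ltW.
    apply: ler_sum => i _; rewrite /dcoef !normcM normcX -[i.+1%:R]rc_nat.
    rewrite ger0_normcR ?ler0n // -!mulrA mulrCA; apply: ler_wpM2l.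
      exact: normc_ge0.
    rewrite ler_pdivlMr //.
    have := taylor_rem1_real_ge0 i.+1 z0 d0; rewrite /taylor_rem1 /=.
    have := exprn_ge0 i.+1 z0; rewrite -/s; lra.
  exists l; split=> // e e0.
  have T0 : 0 <= T by rewrite mulr_ge0 // invr_ge0 subr_ge0 ltW.
  have T1 : 0 < T / d ^+ 2 + 1 by rewrite ltr_wpDl // divr_ge0 ?sqr_ge0.
  exists (Num.min d (e / (T / d ^+ 2 + 1))); first by rewrite lt_min d0 divr_gt0.
  move=> h; rewrite lt_min => /andP[hd]; rewrite ltr_pdivlMr // => he.
  have zh : normc (z + h) < rho.
    by apply: le_lt_trans (le_normcD _ _) _; apply: lt_trans rr; rewrite /r /s; lra.
  have lim : ctends (fun n => \sum_(i < n.+1) a i * taylor_rem1 z h i)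
      (f (z + h) - f z - h * l).
    have h1 := ctends_shift (haf _ zh).
    have h2 := ctendsM (-1) (ctends_shift (haf _ zr)).
    have h3 := ctendsM (- h) hl.
    have := ctendsD (ctendsD h1 h2) h3.
    rewrite mulN1r mulNr; congr (ctends _ _); apply/funext => n.
    have -> : - h * pspart (dcoef a) z n =
        \sum_(i < n.+1) a i * (- (i%:R * z ^+ i.-1 * h)).
      rewrite big_ord_recl /= mul0r mul0r oppr0 mulr0 add0r /pspart mulr_sumr.
      by apply: eq_bigr => i _; rewrite /dcoef /bump leq0n add1n add0n; ring.
    rewrite /pspart mulr_sumr -!big_split /=; apply: eq_bigr => i _.
    by rewrite /taylor_rem1; ring.
  have : normc (f (z + h) - f z - h * l) <= (normc h / d) ^+ 2 * T.
    apply: (ctends_bound lim) => n.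
    apply: le_trans (normc_sum _ _ _) _.
    apply: (@le_trans _ _ (\sum_(i < n.+1) (normc h / d) ^+ 2 * (normc (a i) * s ^+ i))).
      apply: ler_sum => i _; rewrite normcM mulrCA; apply: ler_wpM2l.
        exact: normc_ge0.
      apply: le_trans (taylor_rem1_bound z i d0 (ltW hd)) _.
      by apply: ler_wpM2l; [exact: sqr_ge0|exact: taylor_rem1_real_le].
    by rewrite -mulr_sumr; apply: ler_wpM2l; [exact: sqr_ge0|exact: hT].
  move=> /le_trans; apply.
  have -> : (normc h / d) ^+ 2 * T = (normc h * (T / d ^+ 2)) * normc h.
    by field; rewrite gt_eqF.
  apply: ler_wpM2r; first exact: normc_ge0.
  apply: le_trans (ltW he); apply: ler_wpM2l; first exact: normc_ge0.
  by rewrite lerDl.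
pose f' z := xget 0 [set l | psval (dcoef a) z l /\ cdiff f z l].
have hf' z : normc z < rho -> psval (dcoef a) z (f' z) /\ cdiff f z (f' z).
  by move=> /key[l hl]; rewrite /f'; case: xgetP => [l' _ //|/(_ l)].
by exists f' => z /hf'[].
Qed.

Lemma iter_dcoef a n m :
  iter n dcoef a m * m`!%:R = (m + n)`!%:R * a (m + n)%N.
Proof.
elim: n a m => [|n IH] a m; first by rewrite addn0 mulrC.
rewrite iterSr; have := IH (dcoef a) m; rewrite /= => ->.
by rewrite /dcoef addnS factS natrM; ring.
Qed.

Lemma psum_on_deriven a (f : CC R -> CC R) n : psum_on a f ->
  psum_on (iter n dcoef a) (derive1n n f).
Proof.
move=> haf; elim: n => [//|n IH].
have [f' hf' df] := psum_on_deriv IH.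
by move=> z zr; rewrite derive1nS (cdiff_is_derive (df z zr)).2; exact: hf'.
Qed.

Lemma psval0 (a : nat -> R[i]) : psval a 0 (a 0%N).
Proof.
move=> e e0; exists 1%N => -[//|n] _.
rewrite /pspart big_ord_recl expr0 mulr1 big1 ?addr0 ?subrr ?normc0 //.
by move=> i _; rewrite expr0n mulr0.
Qed.

Lemma psum_on_taylor a (f : CC R -> CC R) n : psum_on a f ->
  (derive1n n f 0 : R[i]) / n`!%:R = a n.
Proof.
move=> haf.
have h0 : normc (0 : R[i]) < rho by rewrite normc0.
have := psum_on_deriven n haf h0 => h.
rewrite (psval_unique h (psval0 _)).
have := iter_dcoef a n 0; rewrite fact0 mulr1 add0n => ->.
by rewrite mulrAC divff ?mul1r // pnatr_eq0 -lt0n fact_gt0.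
Qed.

Lemma psum_on_derivable a (f : CC R -> CC R) (z : CC R) : psum_on a f ->
  normc z < rho -> derivable f z 1.
Proof.
move=> haf zr; have [f' _ df] := psum_on_deriv haf.
exact: (cdiff_is_derive (df z zr)).1.
Qed.

End ComplexDerivative.

(** * Goursat's lemma for trapezoid sums *)

Section Goursat.
Context {R : realType}.
Variable gam : R * R -> R[i].
Implicit Types (g : R[i] -> R[i]) (P Q : R * R) (m : nat).

Definition midp P Q : R * R := ((P.1 + Q.1) / 2, (P.2 + Q.2) / 2).

(** Trapezoid sums over the dyadic subdivisions of a segment, transported by
    [gam]; they stand for path integrals. *)
Fixpoint trap g m P Q : R[i] :=
  if m is m'.+1 then trap g m' P (midp P Q) + trap g m' (midp P Q) Q
  else (g (gam P) + g (gam Q)) / 2 * (gam Q - gam P).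

Definition square (s t h : R) P :=
  [/\ s <= P.1, P.1 <= s + h, t <= P.2 & P.2 <= t + h].

Definition dist1 P Q : R := `|P.1 - Q.1| + `|P.2 - Q.2|.

Lemma midp_level (s t e : R) : midp (s, e) (t, e) = ((s + t) / 2, e).
Proof. by rewrite /midp /=; congr pair; field. Qed.

Lemma midp_level1 (s t e : R) : midp (e, s) (e, t) = (e, (s + t) / 2).
Proof. by rewrite /midp /=; congr pair; field. Qed.

Lemma midpC P Q : midp P Q = midp Q P.
Proof. by rewrite /midp (addrC P.1) (addrC P.2). Qed.

Lemma trapC g m P Q : trap g m Q P = - trap g m P Q.
Proof.
elim: m P Q => [|m IH] P Q /=; first by ring.
by rewrite (midpC Q) (IH P) (IH _ Q) addrC opprD.
Qed.

Lemma dist1_midl P Q : dist1 P (midp P Q) = dist1 P Q / 2.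
Proof.
have half (x y : R) : `|x - (x + y) / 2| = `|x - y| / 2.
  have -> : x - (x + y) / 2 = (x - y) / 2 by field.
  by rewrite normrM normfV (@ger0_norm _ 2).
by rewrite /dist1 /midp /= !half -mulrDl.
Qed.

Lemma dist1C P Q : dist1 P Q = dist1 Q P.
Proof. by rewrite /dist1 distrC (distrC P.2). Qed.

Lemma dist1_midr P Q : dist1 (midp P Q) Q = dist1 P Q / 2.
Proof. by rewrite dist1C midpC dist1_midl dist1C. Qed.

Lemma trap_bound g m P Q (D : R * R -> Prop) (eta L : R) :
  (forall P Q, D P -> D Q -> D (midp P Q)) -> 0 <= eta ->
  (forall P, D P -> normc (g (gam P)) <= eta) ->
  (forall P Q, D P -> D Q -> normc (gam Q - gam P) <= L * dist1 P Q) ->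
  D P -> D Q -> normc (trap g m P Q) <= eta * (L * dist1 P Q).
Proof.
move=> Dm eta0 hg hL; elim: m P Q => [|m IH] P Q DP DQ /=.
  rewrite normcM; apply: ler_pM; rewrite ?normc_ge0 //; last exact: hL.
  rewrite normcM normcV -[2]rc_nat ger0_normcR // ler_pdivrMr //.
  by apply: le_trans (le_normcD _ _) _; have := hg _ DP; have := hg _ DQ; lra.
have DM := Dm _ _ DP DQ.
apply: le_trans (le_normcD _ _) _.
have := IH _ _ DP DM; have := IH _ _ DM DQ; rewrite dist1_midl dist1_midr; lra.
Qed.

Lemma trapB g g' m P Q :
  trap (fun z => g z - g' z) m P Q = trap g m P Q - trap g' m P Q.
Proof.
elim: m P Q => [|m IH] P Q /=; first by ring.
by rewrite !IH; ring.
Qed.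

(** Affine functions have quadratic primitives, for which the trapezoid rule is
    exact. Over a closed path the sums vanish. *)
Lemma trap_affine (a b : R[i]) m P Q : trap (fun z => a + b * z) m P Q =
  a * (gam Q - gam P) + b * (gam Q ^+ 2 - gam P ^+ 2) / 2.
Proof.
elim: m P Q => [|m IH] P Q /=; last by rewrite !IH; ring.
by field.
Qed.

Definition bdry g m s t h :=
  trap g m (s, t) (s + h, t) + trap g m (s + h, t) (s + h, t + h) +
  trap g m (s + h, t + h) (s, t + h) + trap g m (s, t + h) (s, t).

(** The inner edges of the four subsquares are traversed in both directions and
    cancel. *)
Lemma bdryS g m s t h : bdry g m.+1 s t h =
  bdry g m s t (h / 2) + bdry g m (s + h / 2) t (h / 2) +
  bdry g m s (t + h / 2) (h / 2) + bdry g m (s + h / 2) (t + h / 2) (h / 2).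
Proof.
have h2 (x : R) : x + h / 2 + h / 2 = x + h by field.
have m1 (x : R) : (x + (x + h)) / 2 = x + h / 2 by field.
have m2 (x : R) : (x + h + x) / 2 = x + h / 2 by field.
have m3 (x : R) : (x + x) / 2 = x by field.
rewrite /bdry /= /midp /= !h2 !m1 !m2 !m3.
rewrite (trapC g m (s, t + h / 2) (s + h / 2, t + h / 2)).
rewrite (trapC g m (s + h / 2, t) (s + h / 2, t + h / 2)).
rewrite (trapC g m (s + h / 2, t + h / 2) (s + h, t + h / 2)).
rewrite (trapC g m (s + h / 2, t + h / 2) (s + h / 2, t + h)).
ring.
Qed.

Lemma square_midp s t h P Q : square s t h P -> square s t h Q ->
  square s t h (midp P Q).
Proof. by case=> a1 a2 a3 a4 [b1 b2 b3 b4]; split=> /=; lra. Qed.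

Lemma bdry_bound g m s t h (eta L : R) : 0 <= h -> 0 <= eta -> 0 <= L ->
  (forall P, square s t h P -> normc (g (gam P)) <= eta) ->
  (forall P Q, square s t h P -> square s t h Q ->
     normc (gam Q - gam P) <= L * dist1 P Q) ->
  normc (bdry g m s t h) <= 4 * (eta * (L * h)).
Proof.
move=> h0 eta0 L0 hg hL.
have A : square s t h (s, t) by split=> /=; lra.
have B : square s t h (s + h, t) by split=> /=; lra.
have C : square s t h (s + h, t + h) by split=> /=; lra.
have D : square s t h (s, t + h) by split=> /=; lra.
have tb P Q : square s t h P -> square s t h Q -> dist1 P Q = h ->
    normc (trap g m P Q) <= eta * (L * h).
  by move=> hP hQ <-; apply: trap_bound hP hQ => //; exact: square_midp.
have ah : `|h| = h by rewrite ger0_norm.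
have t1 := tb _ _ A B; have t2 := tb _ _ B C.
have t3 := tb _ _ C D; have t4 := tb _ _ D A.
rewrite /dist1 /= in t1 t2 t3 t4.
rewrite subrr normr0 addr0 opprD addNKr normrN ah in t1.
rewrite subrr normr0 add0r opprD addNKr normrN ah in t2.
rewrite subrr normr0 addr0 addrAC subrr add0r ah in t3.
rewrite subrr normr0 add0r addrAC subrr add0r ah in t4.
rewrite /bdry; apply: le_trans (le_normcD _ _) _.
apply: (@le_trans _ _ (3 * (eta * (L * h)) + eta * (L * h))); last lra.
apply: lerD; last exact: t4.
apply: le_trans (le_normcD _ _) _.
apply: (@le_trans _ _ (2 * (eta * (L * h)) + eta * (L * h))); last lra.
apply: lerD; last exact: t3.
apply: le_trans (le_normcD _ _) _.
by have := t1 erefl; have := t2 erefl; lra.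
Qed.

Variable L : R.
Hypothesis L0 : 0 <= L.
Hypothesis hL : forall P Q, square 0 0 1 P -> square 0 0 1 Q ->
  normc (gam Q - gam P) <= L * dist1 P Q.

(** If the boundary sums did not tend to 0, then a nested sequence of dyadic
    squares would keep a fixed proportion of its area as a lower bound, against
    complex differentiability at the common point. *)
Lemma goursat g :
  (forall P, square 0 0 1 P -> exists l, cdiff g (gam P) l) ->
  forall eta : R, 0 < eta -> exists M, forall m, (M <= m)%N ->
    normc (bdry g m 0 0 1) <= eta.
Proof.
move=> dg eta eta0; apply: contrapT => hM.
pose Bad (q : R * R * R) := forall M, exists2 m, (M <= m)%N &
  eta * q.2 ^+ 2 < normc (bdry g m q.1.1 q.1.2 q.2).
have bad0 : Bad (0, 0, 1).
  move=> M; apply: contrapT => h; apply: hM; exists M => m Mm.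
  rewrite leNgt; apply/negP => h'; apply: h; exists m => //=.
  by rewrite expr1n mulr1.
pose child (q q' : R * R * R) := [/\ q'.2 = q.2 / 2,
  q'.1.1 = q.1.1 \/ q'.1.1 = q.1.1 + q.2 / 2 &
  q'.1.2 = q.1.2 \/ q'.1.2 = q.1.2 + q.2 / 2].
have step q : exists q', Bad q -> child q q' /\ Bad q'.
  case: q => -[s t] h; have [bq|nb] := pselect (Bad (s, t, h)); last first.
    by exists (s, t, h) => /nb.
  apply: contrapT => hn.
  have nbad s' t' : (s' = s \/ s' = s + h / 2) -> (t' = t \/ t' = t + h / 2) ->
      exists M, forall m, (M <= m)%N ->
      normc (bdry g m s' t' (h / 2)) <= eta * (h / 2) ^+ 2.
    move=> hs ht; apply: contrapT => h'; apply: hn; exists (s', t', h / 2) => _.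
    split; first by split.
    move=> M; apply: contrapT => h''; apply: h'; exists M => m Mm.
    by rewrite leNgt; apply/negP => ?; apply: h''; exists m.
  have [M1 h1] := nbad s t (or_introl erefl) (or_introl erefl).
  have [M2 h2] := nbad _ t (or_intror erefl) (or_introl erefl).
  have [M3 h3] := nbad s _ (or_introl erefl) (or_intror erefl).
  have [M4 h4] := nbad _ _ (or_intror erefl) (or_intror erefl).
  have [m] := bq (maxn (maxn M1 M2) (maxn M3 M4)).+1.
  case: m => [//|m]; rewrite ltnS !geq_max => /andP[/andP[m1 m2] /andP[m3 m4]] /=.
  rewrite bdryS; apply/negP; rewrite -leNgt.
  have := h1 m m1; have := h2 m m2; have := h3 m m3; have := h4 m m4.
  move=> g4 g3 g2 g1.
  apply: le_trans (le_normcD _ _) _.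
  have g12 := le_trans (le_normcD _ _) (lerD g1 g2).
  have g123 := le_trans (le_normcD _ _) (lerD g12 g3).
  by apply: le_trans (lerD g123 g4) _; rewrite exprMn exprVn; lra.
have [nx hnx] := choice step.
pose q n := iter n nx (0, 0, 1).
have qbad n : Bad (q n) by elim: n => [//|n /hnx[]].
have qch n : child (q n) (q n.+1) by have [] := hnx _ (qbad n).
have qh n : (q n).2 = 2^-1 ^+ n.
  elim: n => [|n IH]; first by rewrite expr0.
  by have [-> _ _] := qch n; rewrite IH exprS mulrC.
have p2 n : 0 < 2^-1 ^+ n :> R by rewrite exprn_gt0 // invr_gt0.
have half (x y h : R) : 0 < h -> y = x \/ y = x + h / 2 ->
    x <= y /\ y + h / 2 <= x + h by move=> h0 [->|->]; split; lra.
have nest n d : [/\ (q n).1.1 <= (q (n + d)%N).1.1,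
    (q (n + d)%N).1.1 + (q (n + d)%N).2 <= (q n).1.1 + (q n).2,
    (q n).1.2 <= (q (n + d)%N).1.2 &
    (q (n + d)%N).1.2 + (q (n + d)%N).2 <= (q n).1.2 + (q n).2].
  elim: d => [|d [i1 i2 i3 i4]]; first by rewrite addn0.
  rewrite addnS; have [e1 e2 e3] := qch (n + d)%N.
  have hp : 0 < (q (n + d)%N).2 by rewrite qh.
  have [a1 a2] := half _ _ _ hp e2; have [a3 a4] := half _ _ _ hp e3.
  by move: i1 i2 i3 i4 hp a1 a2 a3 a4; rewrite e1; clear; split; lra.
have monotone_limit (x : nat -> R) :
    (forall n d, x n <= x (n + d)%N /\ x (n + d)%N <= x n + 2^-1 ^+ n) ->
    exists l, forall n, x n <= l /\ l <= x n + 2^-1 ^+ n.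
  move=> hx; have hs : has_sup (range x).
    split; first by exists (x 0%N), 0%N.
    by exists (x 0%N + 2^-1 ^+ 0) => _ [n _ <-]; have [] := hx 0%N n.
  exists (sup (range x)) => n; split; first by apply: ub_le_sup; [case: hs|exists n].
  apply: ge_sup; first by case: hs.
  move=> _ [k _ <-]; have [nk|kn] := leqP n k.
    by rewrite -(subnKC nk); have [] := hx n (k - n)%N.
  have [h1 _] := hx k (n - k)%N; rewrite subnKC ?(ltnW kn) // in h1.
  by apply: le_trans h1 _; rewrite lerDl ltW.
have [|ss hss] := monotone_limit (fun n => (q n).1.1).
  move=> n d; have [i1 i2 _ _] := nest n d; split=> //.
  by have := p2 (n + d)%N; rewrite !qh in i2; lra.
have [|tt htt] := monotone_limit (fun n => (q n).1.2).
  move=> n d; have [_ _ i1 i2] := nest n d; split=> //.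
  by have := p2 (n + d)%N; rewrite !qh in i2; lra.
have inq n : square (q n).1.1 (q n).1.2 (q n).2 (ss, tt).
  by rewrite qh; have [? ?] := hss n; have [? ?] := htt n; split.
have sub n P : square (q n).1.1 (q n).1.2 (q n).2 P -> square 0 0 1 P.
  have [i1 i2 i3 i4] := nest 0%N n; rewrite add0n /= in i1 i2 i3 i4.
  by case=> *; split; lra.
have [l hl] := dg _ (sub 0%N _ (inq 0%N)).
set zz := gam (ss, tt) in hl.
pose ep := eta / (16 * (L * L) + 1).
have LL : 0 <= L * L by exact: mulr_ge0.
have ep0 : 0 < ep by rewrite divr_gt0 //; lra.
have [d d0 hd] := hl ep ep0.
have [k hk] : exists k, L * (2 * 2^-1 ^+ k) < d.
  have h2 : (0 : R) <= 2^-1 by rewrite invr_ge0.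
  have h2' : (2^-1 : R) < 1 by lra.
  have L1 : 0 < 2 * L + 1 by have := L0; lra.
  have hd1 : 0 < d / (2 * L + 1) by rewrite divr_gt0.
  have [k] := expr_small h2 h2' hd1.
  rewrite ltr_pdivlMr // => h; exists k.+1.
  by apply: le_lt_trans h; have := p2 k.+1; lra.
set s := (q k).1.1; set t := (q k).1.2; pose h := (q k).2.
have hh : h = 2^-1 ^+ k by exact: qh.
have h0 : 0 < h by rewrite hh.
have [m _] := qbad k 0%N; apply/negP; rewrite -leNgt -/s -/t -/h.
pose aff (z : R[i]) := (g zz - l * zz) + l * z.
(* The affine part of [g] at the common point does not contribute. *)
have bE : bdry g m s t h = bdry (fun z => g z - aff z) m s t h.
  have tE P Q : trap (fun z => g z - aff z) m P Q = trap g m P Q -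
      ((g zz - l * zz) * (gam Q - gam P) + l * (gam Q ^+ 2 - gam P ^+ 2) / 2).
    by rewrite trapB; congr (_ - _); exact: trap_affine.
  by rewrite /bdry !tE; ring.
have close P : square s t h P -> normc (gam P - zz) <= L * (2 * h).
  move=> hP; apply: le_trans (hL (sub 0%N _ (inq 0%N)) (sub _ _ hP)) _.
  apply: ler_wpM2l => //; rewrite /dist1 /=.
  have [i1 i2 i3 i4] := inq k; rewrite /= -/s -/t -/h in i1 i2 i3 i4.
  case: hP => a1 a2 a3 a4.
  have b1 : `|ss - P.1| <= h by rewrite ler_norml; apply/andP; split; lra.
  have b2 : `|tt - P.2| <= h by rewrite ler_norml; apply/andP; split; lra.
  lra.
rewrite bE; apply: (@le_trans _ _ (4 * (ep * (L * (2 * h)) * (L * h)))).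
  apply: bdry_bound; rewrite ?(ltW h0) //.
  - by rewrite mulr_ge0 ?(ltW ep0) // mulr_ge0 // mulr_ge0 // ltW.
  - move=> P hP; have c := close P hP.
    have := hd (gam P - zz) (le_lt_trans c _); rewrite hh => /(_ hk).
    rewrite [zz + _]addrC subrK.
    have -> : g (gam P) - g zz - (gam P - zz) * l = g (gam P) - aff (gam P).
      by rewrite /aff; ring.
    move=> /le_trans; apply; apply: ler_wpM2l; first exact: ltW.
    by rewrite -hh.
  - by move=> P Q hP hQ; exact: hL (sub _ _ hP) (sub _ _ hQ).
have -> : 4 * (ep * (L * (2 * h)) * (L * h)) = ep * (8 * (L * L)) * h ^+ 2 by ring.
apply: ler_wpM2r; first exact: sqr_ge0.
have : ep * (16 * (L * L) + 1) = eta by rewrite /ep divfK // gt_eqF //; lra.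
have := mulr_ge0 (ltW ep0) LL; lra.
Qed.

Lemma trap_pos (P1 a b : R) g m : trap g m (P1, a) (P1, b) =
  \sum_(0 <= j < 2 ^ m) (g (gam (P1, a + (b - a) * (j%:R / (2 ^ m)%:R)))
     + g (gam (P1, a + (b - a) * (j.+1%:R / (2 ^ m)%:R)))) / 2 *
     (gam (P1, a + (b - a) * (j.+1%:R / (2 ^ m)%:R))
      - gam (P1, a + (b - a) * (j%:R / (2 ^ m)%:R))).
Proof.
elim: m a b => [|m IH] a b /=.
  by rewrite expn0 big_nat1 mul0r mulr0 addr0 divr1 mulr1 (addrC a) subrK.
have sp (F : nat -> R[i]) (n : nat) : \sum_(0 <= j < n + n) F j =
    \sum_(0 <= j < n) F j + \sum_(0 <= j < n) F (n + j)%N.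
  by rewrite !big_mkord big_split_ord.
rewrite midp_level1 !IH expnS mul2n -addnn sp.
have p0 : (2 ^ m)%:R != 0 :> R by rewrite pnatr_eq0 expn_eq0.
have dbl : (2 ^ m + 2 ^ m)%:R = 2 * (2 ^ m)%:R :> R by rewrite natrD; ring.
congr (_ + _); apply: eq_bigr => j _.
  have e (i : nat) : a + ((a + b) / 2 - a) * (i%:R / (2 ^ m)%:R) =
      a + (b - a) * (i%:R / (2 ^ m + 2 ^ m)%:R) by rewrite dbl; field.
  by rewrite !e.
have e (i : nat) : (a + b) / 2 + (b - (a + b) / 2) * (i%:R / (2 ^ m)%:R) =
    a + (b - a) * ((2 ^ m + i)%:R / (2 ^ m + 2 ^ m)%:R).
  by rewrite dbl natrD; field.
by rewrite !e addnS.
Qed.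

Lemma trap_periodic g m P Q : P.2 = 0 -> Q.2 = 0 ->
  (forall s, gam (s, 1) = gam (s, 0)) ->
  trap g m (P.1, 1) (Q.1, 1) = trap g m P Q.
Proof.
move=> P0 Q0 per; elim: m P Q P0 Q0 => [|m IH] [s x] [t y] /= -> ->.
  by rewrite !per.
rewrite !midp_level.
by rewrite (IH (s, 0) ((s + t) / 2, 0)) // (IH ((s + t) / 2, 0) (t, 0)).
Qed.

End Goursat.

(** * Points of the circle *)

Section Circle.
Context {R : realType}.
Implicit Types (s t : R) (m n : nat).

Definition cis t : R[i] := Complex (cos (2 * pi * t)) (sin (2 * pi * t)).

Lemma cisD s t : cis (s + t) = cis s * cis t.
Proof. by rewrite /cis mulrDr cosD sinD /=; simpc; congr Complex; ring. Qed.

Lemma cis0 : cis 0 = 1.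
Proof. by rewrite /cis mulr0 cos0 sin0. Qed.

Lemma normc_cis t : normc (cis t) = 1.
Proof. by rewrite /cis /normc cos2Dsin2 sqrtr1. Qed.

Lemma cis_half : cis (1 / 2) = -1.
Proof.
rewrite /cis (_ : 2 * pi * (1 / 2) = pi); last by field.
by rewrite cospi sinpi; apply/eqP; rewrite eq_complex /= oppr0 !eqxx.
Qed.

Lemma cis1 : cis 1 = 1.
Proof. by rewrite (_ : 1 = 1 / 2 + 1 / 2) ?cisD ?cis_half ?mulrNN ?mulr1 //; field. Qed.

Lemma cis_nat n t : cis (n%:R * t) = cis t ^+ n.
Proof.
by elim: n => [|n IH]; rewrite ?mul0r ?cis0 ?expr0 // -natr1 mulrDl mul1r cisD IH exprSr.
Qed.

Lemma lipschitz_of_derive (f df : R -> R) s t :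
  (forall x : R, is_derive x 1 f (df x)) -> (forall x, `|df x| <= 1) ->
  `|f s - f t| <= `|s - t|.
Proof.
move=> hf hd; wlog st : s t / t <= s.
  by move=> h; have [/h //|/ltW/h] := leP t s; rewrite distrC (distrC t).
have [|c _ ->] := @MVT_segment R f df t s st (fun x _ => hf x).
  by apply: derivable_within_continuous => x _; case: (hf x).
by rewrite normrM; apply: ler_piMl.
Qed.

Lemma sin_norm_le1 s : `|sin s| <= 1.
Proof. by rewrite ler_norml sin_geN1 sin_le1. Qed.

Lemma cos_norm_le1 s : `|cos s| <= 1.
Proof. by rewrite ler_norml cos_geN1 cos_le1. Qed.

Lemma cis_lipschitz s t : normc (cis s - cis t) <= 4 * pi * `|s - t|.
Proof.
apply: le_trans (ler_normc_ReIm _) _ => /=.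
have c := @lipschitz_of_derive cos (fun x => - sin x) (2 * pi * s) (2 * pi * t)
  (@is_derive_cos R).
have d := @lipschitz_of_derive sin cos (2 * pi * s) (2 * pi * t) (@is_derive_sin R).
have /(_ _)/le_trans h1 := c _; have /(_ cos_norm_le1)/le_trans h2 := d.
have e : `|2 * pi * s - 2 * pi * t| = 2 * pi * `|s - t|.
  by rewrite -mulrBr normrM ger0_norm // mulr_ge0 // pi_ge0.
rewrite (_ : 4 * pi * _ = 2 * pi * `|s - t| + 2 * pi * `|s - t|); last by ring.
rewrite -e; apply: lerD; [apply: h1 => // x|exact: h2].
by rewrite normrN sin_norm_le1.
Qed.

Definition omega m : R[i] := cis (1 / (2 ^ m)%:R).

Lemma pow2_neq0 m : (2 ^ m)%:R != 0 :> R.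
Proof. by rewrite pnatr_eq0 expn_eq0. Qed.

Lemma cis_omega m j : cis (j%:R / (2 ^ m)%:R) = omega m ^+ j.
Proof. by rewrite -cis_nat mul1r. Qed.

Lemma omegaS m : omega m.+1 ^+ 2 = omega m.
Proof.
rewrite -cis_nat; congr cis; rewrite expnS natrM; field; exact: pow2_neq0.
Qed.

Lemma normc_omega m : normc (omega m) = 1.
Proof. exact: normc_cis. Qed.

Lemma omega_neq0 m : omega m != 0.
Proof. by rewrite -normc_gt0 normc_omega. Qed.

Lemma omega1 : omega 1 = -1.
Proof. exact: cis_half. Qed.

Lemma omega_pow m d : omega (m + d) ^+ (2 ^ d) = omega m.
Proof.
elim: d => [|d IH]; first by rewrite addn0 expr1.
by rewrite addnS expnS exprM omegaS.
Qed.

Lemma omega_order m : omega m ^+ (2 ^ m) = 1.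
Proof. by have := omega_pow 0 m; rewrite add0n => ->; rewrite /omega divr1 cis1. Qed.

Lemma omega_primitive m : (2 ^ m).-primitive_root (omega m).
Proof.
case: m => [|m].
  have [d dp] := prim_order_exists (ltn0Sn 0) (omega_order 0).
  by rewrite dvdn1 => /eqP d1; move: dp; rewrite d1.
have N0 : (0 < 2 ^ m.+1)%N by rewrite expn_gt0.
have [d dp /dvdn_pfactor] := prim_order_exists N0 (omega_order m.+1).
move=> /(_ isT)[k km dk]; rewrite dk in dp.
move: km; rewrite leq_eqVlt => /orP[/eqP ke|]; first by move: dp; rewrite ke.
rewrite ltnS => km.
have : omega m.+1 ^+ (2 ^ m) == 1.
  by rewrite -(prim_order_dvd dp) dvdn_exp2l.
have := omega_pow 1 m; rewrite add1n => ->; rewrite omega1.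
by rewrite -subr_eq0 -opprD oppr_eq0 -(natrD _ 1 1) pnatr_eq0.
Qed.

(** Doubling the order of the root at most halves its distance to 1, since [o^2
    - 1 = (o - 1) (o + 1)]. *)
Lemma omega_dist m : 4 <= (2 ^ m.+1)%:R * normc (omega m.+1 - 1).
Proof.
elim: m => [|m IH].
  rewrite expn1 omega1 -opprD normcN -[1 + 1]/(2%:R) -rc_nat ger0_normcR //.
  by rewrite -natrM.
apply: le_trans IH _; rewrite (expnS 2 m.+1) natrM (mulrC 2) -[leRHS]mulrA.
apply: ler_wpM2l; first exact: ler0n.
rewrite -(omegaS m.+1) -[X in _ - X](expr1n _ 2%N) subr_sqr normcM mulrC.
apply: ler_wpM2r; first exact: normc_ge0.
by apply: le_trans (le_normcD _ _) _; rewrite normc_omega normc1.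
Qed.

Lemma omega_gap m : 8 <= (2 ^ m.+2)%:R * normc (omega m.+2 - (omega m.+2)^-1).
Proof.
have -> : omega m.+2 - (omega m.+2)^-1 = (omega m.+1 - 1) / omega m.+2.
  by rewrite -(omegaS m.+1); field; exact: omega_neq0.
rewrite normcM normcV normc_omega invr1 mulr1 expnS natrM -mulrA.
by have := omega_dist m; lra.
Qed.

Definition cmean m (r : R) (f : R[i] -> R[i]) : R[i] :=
  (\sum_(0 <= j < 2 ^ m) f (r%:C * omega m ^+ j)) / (2 ^ m)%:R.

Lemma pow2c_neq0 m : (2 ^ m)%:R != 0 :> R[i].
Proof. by rewrite pnatr_eq0 expn_eq0. Qed.

Lemma cmean_pow m i j : (i < 2 ^ m)%N -> (j < 2 ^ m)%N ->
  (\sum_(0 <= l < 2 ^ m) (omega m ^+ l) ^+ i * (omega m ^- l) ^+ j) / (2 ^ m)%:R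
  = (i == j)%:R.
Proof.
move=> im jm; set w := omega m.
have w0 : w != 0 by exact: omega_neq0.
have tE l : (w ^+ l) ^+ i * (w ^- l) ^+ j = (w ^+ i / w ^+ j) ^+ l.
  by rewrite expr_div_n -!exprM exprVn -exprM mulnC (mulnC j).
under eq_bigr do rewrite tE.
have [<-|ij] := eqVneq i j.
  rewrite divff ?expf_neq0 // big_mkord.
  under eq_bigr do rewrite expr1n.
  by rewrite sumr_const card_ord divff // pow2c_neq0.
have q1 : w ^+ i / w ^+ j - 1 != 0.
  rewrite subr_eq0; apply/eqP => /(congr1 ( *%R^~ (w ^+ j))).
  rewrite mul1r divfK ?expf_neq0 // => /eqP.
  rewrite (eq_prim_root_expr (omega_primitive m)) !modn_small //.
  by rewrite (negPf ij).
apply/eqP; rewrite mulf_eq0 -(inj_eq (mulfI q1)) mulr0 big_mkord -subrX1.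
rewrite expr_div_n -!exprM (mulnC i) (mulnC j) !exprM omega_order !expr1n.
by rewrite divff ?oner_neq0 // subrr eqxx.
Qed.

End Circle.

(** * Holomorphic functions are sums of power series *)

Section CauchyTaylor.
Context {R : realType}.
Variable f : R[i] -> R[i].
Variable r : R.
Hypotheses (r0 : 0 < r) (r1 : r < 1).
Hypothesis df : forall z, normc z < 1 -> exists l, cdiff f z l.

Definition dquot (w z : R[i]) : R[i] := (f z - f w) * (z - w)^-1.

Lemma cdiff_dquot (w z : R[i]) : normc z < 1 -> z != w -> exists l, cdiff (dquot w) z l.
Proof.
move=> z1 zw; have [l /cdiff_is_derive[fd _]] := df z1.
suff h : derivable (dquot w : CC R -> CC R) (z : CC R) 1.
  by exists ('D_1 (dquot w : CC R -> CC R) (z : CC R)); exact: derivable_cdiff.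
have d1 : derivable ((f : CC R -> CC R) - cst (f w : CC R)) (z : CC R) 1.
  exact: derivableB fd (derivable_cst _ _ _).
have d2 : derivable ((id : CC R -> CC R) - cst (w : CC R)) (z : CC R) 1.
  have di : derivable (id : CC R -> CC R) (z : CC R) 1 by exact: derivable_id.
  exact: derivableB di (derivable_cst _ _ _).
have zw0 : ((id : CC R -> CC R) - cst (w : CC R)) z != 0 by rewrite subr_eq0.
have d3 := @derivableV R[i] (CC R) _ (z : CC R) 1 zw0 d2.
exact: (@derivableM R[i] (CC R) _ _ (z : CC R) 1 d1 d3).
Qed.

(** The map [(s, t) |-> w + (eps + (1 - eps) s) (r cis t - w)] from the unit
    square onto an annular region between the circle of radius [r] and its image
    near [w]. *)
Definition cone (w : R[i]) (eps : R) (P : R * R) : R[i] :=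
  w + (eps + (1 - eps) * P.1)%:C * (r%:C * cis P.2 - w).

Section Point.
Variable w : R[i].
Hypothesis wr : normc w < r.
Variable eps : R.
Hypotheses (e0 : 0 < eps) (e1 : eps <= 1).

Lemma cone_scale P : square 0 0 1 P ->
  0 < eps + (1 - eps) * P.1 /\ eps + (1 - eps) * P.1 <= 1.
Proof.
case=> h1 h2 _ _; have : 0 <= 1 - eps by rewrite subr_ge0.
move=> h; have h3 := mulr_ge0 h h1.
have h4 : (1 - eps) * P.1 <= 1 - eps by rewrite add0r in h2; exact: ler_piMr.
by have := e0; split; lra.
Qed.

Lemma circle_far t : r - normc w <= normc (r%:C * cis t - w).
Proof.
apply: le_trans (ler_normcB _ _).
by rewrite normcM normc_cis mulr1 ger0_normcR // ltW.
Qed.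

Lemma cone_neq P : square 0 0 1 P -> cone w eps P != w.
Proof.
move=> /cone_scale[h _]; rewrite -subr_eq0 /cone addrAC subrr add0r mulf_neq0 //.
  by rewrite -normc_gt0 ger0_normcR // ltW.
by rewrite -normc_gt0; apply: lt_le_trans (circle_far _); rewrite subr_gt0.
Qed.

Lemma cone_norm P : square 0 0 1 P -> normc (cone w eps P) <= r.
Proof.
move=> /cone_scale[h h1]; rewrite /cone; move: h h1; set c := _ + _ => h h1.
have -> : w + c%:C * (r%:C * cis P.2 - w) = (1 - c)%:C * w + (c * r)%:C * cis P.2.
  by rewrite rcB rcM; ring.
apply: le_trans (le_normcD _ _) _; rewrite !normcM normc_cis mulr1.
rewrite !ger0_normcR ?subr_ge0 ?mulr_ge0 ?(ltW h) ?(ltW r0) //.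
have : (1 - c) * normc w <= (1 - c) * r by apply: ler_wpM2l (ltW wr); rewrite subr_ge0.
by lra.
Qed.

Lemma cone_lipschitz P Q : square 0 0 1 P -> square 0 0 1 Q ->
  normc (cone w eps Q - cone w eps P) <= (2 + 4 * pi) * dist1 P Q.
Proof.
move=> hP hQ; have [p1 p2] := cone_scale hP; have [q1 q2] := cone_scale hQ.
rewrite /cone; set c := eps + _ in p1 p2 *; set c' := eps + _ in q1 q2 *.
have -> : w + c'%:C * (r%:C * cis Q.2 - w) - (w + c%:C * (r%:C * cis P.2 - w)) =
    (c' - c)%:C * (r%:C * cis Q.2 - w) + (c * r)%:C * (cis Q.2 - cis P.2).
  by rewrite rcB rcM; ring.
apply: le_trans (le_normcD _ _) _; rewrite [leRHS]mulrDr; apply: lerD; rewrite normcM.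
  rewrite normcR mulrC; apply: ler_pM; rewrite ?normc_ge0 ?normr_ge0 //.
    apply: le_trans (le_normcD _ _) _; rewrite normcN normcM normc_cis mulr1.
    rewrite ger0_normcR ?(ltW r0) //.
    by have := r1; have := wr; have := pi_ge0 R; lra.
  have -> : c' - c = (1 - eps) * (Q.1 - P.1) by rewrite /c /c'; ring.
  rewrite normrM (distrC P.1); apply: ler_piMl; first exact: normr_ge0.
  by rewrite ger0_norm ?subr_ge0 // gerBl ltW.
rewrite ger0_normcR ?mulr_ge0 ?(ltW p1) ?(ltW r0) // distrC.
apply: (@le_trans _ _ (4 * pi * `|Q.2 - P.2|)); last first.
  by apply: ler_wpM2r; rewrite ?lerDr.
apply: le_trans (cis_lipschitz _ _); apply: ler_piMl; first exact: normc_ge0.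
by apply: mulr_ile1; rewrite ?(ltW p1) ?(ltW r0) ?(ltW r1).
Qed.

Lemma cone_per s : cone w eps (s, 1) = cone w eps (s, 0).
Proof. by rewrite /cone /= cis0 cis1. Qed.

Lemma cone_outer t : cone w eps (1, t) = r%:C * cis t.
Proof. by rewrite /cone /= mulr1 [eps + _]addrC subrK mul1r addrC subrK. Qed.

Lemma cone_inner t : cone w eps (0, t) = w + eps%:C * (r%:C * cis t - w).
Proof. by rewrite /cone /= mulr0 addr0. Qed.

End Point.

(** The integral of the difference quotient over the circle vanishes: the cone
    from a small circle around [w] is a square whose two radial sides cancel,
    and on the small circle the quotient is bounded. *)
Lemma dquot_circle w : normc w < r -> forall eta : R, 0 < eta ->
  exists M, forall m, (M <= m)%N ->
  normc (\sum_(0 <= j < 2 ^ m)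
    (dquot w (r%:C * omega m ^+ j) + dquot w (r%:C * omega m ^+ j.+1)) / 2 *
    (r%:C * omega m ^+ j.+1 - r%:C * omega m ^+ j)) <= eta.
Proof.
move=> wr eta eta0.
have [|l hl] := df (z := w); first exact: lt_trans wr r1.
have [d d0 hd] := hl 1 ltr01.
pose K := 1 + normc l.
have K0 : 0 < K by rewrite ltr_wpDr ?normc_ge0.
have p0 : 0 < pi :> R by exact: pi_gt0.
pose L := 2 + 4 * pi : R.
have L0 : 0 < L by rewrite /L; lra.
pose eps := Num.min 1 (Num.min (d / 4) (eta / (2 * (K * L)))).
have KL0 : 0 < 2 * (K * L) by rewrite !mulr_gt0.
have e0 : 0 < eps by rewrite !lt_min ltr01 !divr_gt0.
have e1 : eps <= 1 by rewrite ge_min lexx.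
have e2 : eps <= d / 4 by rewrite !ge_min lexx !orbT.
have e3 : eps * (2 * (K * L)) <= eta.
  by rewrite -ler_pdivlMr // !ge_min lexx !orbT.
have eta2 : 0 < eta / 2 by rewrite divr_gt0.
have hg P : square 0 0 1 P -> exists l, cdiff (dquot w) (cone w eps P) l.
  move=> hP; apply: cdiff_dquot; last exact: cone_neq.
  by apply: le_lt_trans r1; exact: cone_norm.
have [M hM] := goursat (ltW L0) (cone_lipschitz wr e0 e1) hg eta2.
exists M => m /hM; rewrite /bdry !add0r.
have per := @trap_periodic _ (cone w eps) (dquot w) m (0, 0) (1, 0) erefl erefl
  (cone_per w eps).
rewrite /= in per; rewrite (trapC _ _ m (0, 1)) per.
have cancel4 (a b c : R[i]) : a + b - a + c = b + c by ring.
rewrite cancel4 => h.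
set T := trap _ _ _ _ _ in h; set I := trap _ _ _ _ _ in h.
have hI : normc I <= eta / 2.
  pose D (P : R * R) := square 0 0 1 P /\ P.1 = 0.
  have inner P : D P -> cone w eps P = w + eps%:C * (r%:C * cis P.2 - w).
    by case: P => s t [_ /= ->]; rewrite cone_inner.
  have D0 : D (0, 0) by split=> //; split=> //=; lra.
  rewrite /I trapC normcN.
  have D1 : D (0, 1) by split=> //; split=> //=; lra.
  have ep4 : 0 <= eps * (4 * pi) by rewrite mulr_ge0 ?(ltW e0) // mulr_ge0 // ltW.
  apply: (@le_trans _ _ (K * (eps * (4 * pi) * dist1 (0, 0) (0, 1)))).
    apply: (@trap_bound R _ _ _ _ _ D) => //.
    - move=> P Q [hP P0] [hQ Q0]; split; first exact: square_midp.
      by rewrite /= P0 Q0 addr0 mul0r.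
    - exact: ltW.
    - move=> P DP; have := cone_neq wr e0 e1 DP.1; rewrite inner //.
      set z := _ * _ => zw; rewrite /dquot addrAC subrr add0r normcM normcV.
      have z0 : 0 < normc z by rewrite normc_gt0; move: zw; rewrite -subr_eq0 addrAC subrr add0r.
      have zd : normc z < d.
        rewrite /z normcM ger0_normcR ?(ltW e0) //.
        have : normc (r%:C * cis P.2 - w) <= 2.
          apply: le_trans (le_normcD _ _) _; rewrite normcN normcM normc_cis mulr1.
          by rewrite ger0_normcR ?(ltW r0) //; have := r1; have := wr; lra.
        move=> h2; have := ler_wpM2l (ltW e0) h2; lra.
      rewrite ler_pdivrMr // (_ : f (w + z) - f w = f (w + z) - f w - z * l + z * l); last by ring.
      by apply: le_trans (le_normcD _ _) _; rewrite normcM; have := hd z zd; rewrite /K; lra.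
    - move=> P Q DP DQ; rewrite !inner // opprD addrACA subrr add0r -mulrBr opprB addrA subrK.
      rewrite -mulrBr !normcM !ger0_normcR ?(ltW e0) ?(ltW r0) //.
      rewrite -!mulrA; apply: ler_wpM2l; first exact: ltW.
      have hc := cis_lipschitz Q.2 P.2; rewrite distrC in hc.
      have ht : `|P.2 - Q.2| <= dist1 P Q by rewrite lerDr.
      have hc' : normc (cis Q.2 - cis P.2) <= 4 * (pi * dist1 P Q).
        apply: le_trans hc _; rewrite mulrA; apply: ler_wpM2l ht; lra.
      apply: le_trans hc'; apply: ler_piMl; first exact: normc_ge0.
      by have := r1; lra.
  rewrite /dist1 /= subrr normr0 add0r sub0r normrN normr1 mulr1.
  have : 0 <= K * eps by rewrite mulr_ge0 // ltW.
  by move: e3; rewrite /L; lra.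
have hT : normc T <= eta.
  have -> : T = (T + I) - I by ring.
  by apply: le_trans (le_normcD _ _) _; rewrite normcN; lra.
move: hT; rewrite /T trap_pos.
under eq_bigr do rewrite !cone_outer !subr0 !add0r !mul1r !cis_omega.
by [].
Qed.

(** Over the roots of unity the trapezoid sum is a multiple of the mean of
    [g z * z], by cyclic summation by parts. *)
Lemma trap_roots (g : R[i] -> R[i]) m (c : R[i]) :
  \sum_(0 <= j < 2 ^ m) (g (c * omega m ^+ j) + g (c * omega m ^+ j.+1)) / 2 *
    (c * omega m ^+ j.+1 - c * omega m ^+ j) =
  (omega m - (omega m)^-1) / 2 *
    \sum_(0 <= j < 2 ^ m) g (c * omega m ^+ j) * (c * omega m ^+ j).
Proof.
set o := omega m; have o0 : o != 0 by exact: omega_neq0.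
pose B j := g (c * o ^+ j) * (c * o ^+ j).
have per : B (2 ^ m)%N = B 0%N by rewrite /B omega_order expr0.
have tE j : (g (c * o ^+ j) + g (c * o ^+ j.+1)) / 2 * (c * o ^+ j.+1 - c * o ^+ j) =
    (o - o^-1) / 2 * B j + (1 - o^-1) / 2 * (B j.+1 - B j).
  by rewrite /B !exprS; field.
under eq_bigr do rewrite tE.
rewrite big_split /= -!mulr_sumr telescope_sumr //.
by rewrite per subrr mulr0 addr0.
Qed.

Lemma dquot_mean w : normc w < r -> forall eta : R, 0 < eta ->
  exists M, forall m, (M <= m)%N ->
  normc (cmean m r (fun z => dquot w z * z)) <= eta.
Proof.
move=> wr eta eta0; have [M hM] := dquot_circle wr eta0.
exists M.+2 => -[//|[//|m]]; rewrite !ltnS => Mm.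
have := hM m.+2 (leqW (leqW Mm)); rewrite trap_roots /cmean.
set S := \sum_(_ <= _ < _) _; rewrite !normcM !normcV.
rewrite -[(2 ^ m.+2)%:R]rc_nat -[2]rc_nat !ger0_normcR ?ler0n //.
have := omega_gap m (R := R); set n := (2 ^ m.+2)%:R; set x := normc (_ - _).
have n0 : 0 < n by rewrite ltr0n expn_gt0.
move=> h8 h; rewrite ler_pdivrMr //.
have h9 : 8 / n <= x by rewrite ler_pdivrMr // mulrC.
have hS := ler_wpM2r (normc_ge0 S) h9.
have : 8 / n * normc S <= 2 * eta by lra.
rewrite mulrAC ler_pdivrMr // => h10; have : 0 < eta * n by exact: mulr_gt0.
by lra.
Qed.

(** The discrete Fourier coefficients on the circle, which tend to the Taylor
    coefficients. *)
Definition circle_coef m n : R[i] := cmean m r (fun z => f z * z ^- n).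

Lemma normc_circle m j : normc (r%:C * omega m ^+ j) = r.
Proof. by rewrite normcM normcX normc_omega expr1n mulr1 ger0_normcR // ltW. Qed.

(** A discrete Cauchy formula: on the points [z] with [z^N = r^N], the Cauchy
    kernel [z / (z - w)] is a finite geometric sum up to a constant factor. *)
Lemma discrete_cauchy w m : normc w < r ->
  (1 - (w / r%:C) ^+ (2 ^ m)) * cmean m r (fun z => dquot w z * z) =
  pspart (circle_coef m) w (2 ^ m) - f w.
Proof.
move=> wr; set N := (2 ^ m)%N.
have N0 : (0 < N)%N by rewrite expn_gt0.
have o0 := omega_neq0 m (R := R).
have c0 : r%:C != 0 :> R[i] by rewrite -normc_gt0 ger0_normcR // ltW.
pose z j := r%:C * omega m ^+ j.
have z0 j : z j != 0 by rewrite mulf_neq0 ?expf_neq0.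
have zw j : z j - w != 0.
  rewrite -normc_gt0; apply: lt_le_trans (ler_normcB _ _).
  by rewrite normc_circle subr_gt0.
have tE j : (1 - (w / r%:C) ^+ N) * (dquot w (z j) * z j) =
    \sum_(n < N) (f (z j) * z j ^- n) * w ^+ n
    - f w * \sum_(n < N) z j ^- n * w ^+ n.
  have -> : (w / r%:C) ^+ N = (w / z j) ^+ N.
    rewrite /z invfM mulrA [RHS]exprMn exprVn -exprM mulnC exprM omega_order.
    by rewrite expr1n invr1 mulr1.
  under eq_bigr do rewrite -mulrA.
  rewrite -mulr_sumr -mulrBl.
  have -> : \sum_(n < N) z j ^- n * w ^+ n = \sum_(n < N) (w / z j) ^+ n.
    by apply: eq_bigr => n _; rewrite [in RHS]exprMn exprVn mulrC.
  have := subrX1 (w / z j) N; set S := \sum_(_ < _) _ => hS.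
  have -> : 1 - (w / z j) ^+ N = (1 - w / z j) * S.
    by rewrite -opprB hS -mulNr opprB.
  by rewrite /dquot; field; rewrite zw z0.
rewrite /cmean mulrA mulr_sumr.
under eq_bigr do rewrite tE.
rewrite sumrB -mulr_sumr exchange_big /= mulrBl; congr (_ - _).
  rewrite mulr_suml /pspart; apply: eq_bigr => n _.
  by rewrite -mulr_suml /circle_coef /cmean mulrAC.
have mz (n : 'I_N) : (\sum_(0 <= j < N) z j ^- n) / N%:R = (val n == 0%N)%:R.
  have h := cmean_pow N0 (ltn_ord n) (R := R).
  rewrite -/N eq_sym in h; rewrite -[RHS]mul1r.
  have -> : \sum_(0 <= j < N) z j ^- n = r%:C ^- n *
      \sum_(0 <= j < N) (omega m ^+ j) ^+ 0 * (omega m ^- j) ^+ n.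
    rewrite mulr_sumr; apply: eq_bigr => j _.
    by rewrite expr0 mul1r /z exprMn invfM exprVn.
  rewrite -mulrA h; case: eqP => [->|_]; last by rewrite !mulr0.
  by rewrite expr0 invr1.
rewrite exchange_big /= -mulrA mulr_suml.
under eq_bigr do rewrite -mulr_suml mulrAC mz.
rewrite (bigD1 (Ordinal N0)) //= big1 ?addr0 ?expr0 ?mulr1 //.
by move=> n n0; rewrite (_ : (val n == 0%N) = false) ?mul0r //; apply/negbTE.
Qed.

Lemma circle_bound : exists2 B : R, 0 <= B &
  forall m j, (j < 2 ^ m)%N -> normc (f (r%:C * omega m ^+ j)) <= B.
Proof.
pose F t : R := normc (f (r%:C * cis t)).
have cF : continuous F.
  move=> t; apply/cvgrPdist_lt => e e0.
  have z1 : normc (r%:C * cis t) < 1 by rewrite normcM normc_cis mulr1 ger0_normcR // ltW.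
  have [l hl] := df z1; have [d d0 hd] := cdiff_continuous hl e0.
  have p0 : 0 < 4 * pi :> R by rewrite mulr_gt0 // pi_gt0.
  apply/nbhs_ballP; exists (d / (4 * pi)); first by rewrite /= divr_gt0.
  move=> s /=; rewrite distrC => ts.
  have : normc (r%:C * cis s - r%:C * cis t) < d.
    rewrite -mulrBr normcM ger0_normcR ?(ltW r0) //.
    rewrite ltr_pdivlMr // mulrC in ts; apply: le_lt_trans ts.
    apply: le_trans (cis_lipschitz _ _); apply: ler_piMl; first exact: normc_ge0.
    exact: ltW.
  move=> /hd; rewrite /F; set a := f _; set b := f _ => h.
  have h1 := ler_normcB a b; have h2 := ler_normcB b a.
  by rewrite normcB_sym in h2; rewrite ltr_norml; apply/andP; split; lra.
have [c _ hc] := @EVT_max R F 0 1 ler01 (continuous_subspaceT cF).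
exists (F c) => [|m j jm]; first exact: normc_ge0.
rewrite -cis_omega; apply: hc; rewrite in_itv /= divr_ge0 ?ler0n //=.
by rewrite ler_pdivrMr ?mul1r ?ler_nat ?(ltnW jm) // ltr0n expn_gt0.
Qed.

Lemma cmean_bound m g (B : R) :
  (forall j, (j < 2 ^ m)%N -> normc (g (r%:C * omega m ^+ j)) <= B) ->
  normc (cmean m r g) <= B.
Proof.
move=> hg; have n0 : 0 < (2 ^ m)%:R :> R by rewrite ltr0n expn_gt0.
rewrite /cmean normcM normcV -[(2 ^ m)%:R]rc_nat ger0_normcR ?ler0n //.
rewrite ler_pdivrMr // big_mkord; apply: le_trans (normc_sum _ _ _) _.
apply: (@le_trans _ _ (\sum_(i < 2 ^ m) B)); first by apply: ler_sum => i _; exact: hg.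
by rewrite sumr_const card_ord mulr_natr.
Qed.

Lemma cauchy_partial w : normc w < r -> forall e : R, 0 < e ->
  exists M, forall m, (M <= m)%N -> normc (pspart (circle_coef m) w (2 ^ m) - f w) <= e.
Proof.
move=> wr e e0; have [M hM] := dquot_mean wr (divr_gt0 e0 (ltr0Sn _ 1)).
exists M => m /hM h; rewrite -discrete_cauchy // normcM.
have : normc (1 - (w / r%:C) ^+ (2 ^ m)) <= 2.
  apply: le_trans (le_normcD _ _) _; rewrite normcN normc1 normcX.
  have : normc (w / r%:C) <= 1.
    by rewrite normcM normcV ger0_normcR ?(ltW r0) // ler_pdivrMr // mul1r ltW.
  by move=> h1; have := exprn_ile1 (2 ^ m)%N (normc_ge0 _) h1; lra.
move=> h2; apply: le_trans (ler_pM _ _ h2 h) _; rewrite ?normc_ge0 //.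
by rewrite mulrC divfK.
Qed.

Section Coefficients.
Variable B : R.
Hypothesis B0 : 0 <= B.
Hypothesis hB : forall m j, (j < 2 ^ m)%N -> normc (f (r%:C * omega m ^+ j)) <= B.

Lemma circle_coef_bound m n : normc (circle_coef m n) * r ^+ n <= B.
Proof.
have rn : 0 < r ^+ n by exact: exprn_gt0.
rewrite -ler_pdivlMr //; apply: cmean_bound => j jm.
rewrite normcM normcV normcX normc_circle; apply: ler_wpM2r (hB jm).
by rewrite invr_ge0 ltW.
Qed.

Lemma circle_coef_partial w K : normc w < r -> forall e : R, 0 < e ->
  exists M, forall m, (M <= m)%N ->
  normc (pspart (circle_coef m) w K - f w) <= e + B * ((normc w / r) ^+ K / (1 - normc w / r)).
Proof.
move=> wr e e0; have [M hM] := cauchy_partial wr e0.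
exists (maxn M K) => m; rewrite geq_max => /andP[/hM h Km].
have KN : (K <= 2 ^ m)%N by apply: leq_trans (ltnW (ltn_expl m _)).
set q := normc w / r.
have q0 : 0 <= q by rewrite divr_ge0 ?normc_ge0 // ltW.
have q1 : q < 1 by rewrite ltr_pdivrMr // mul1r.
rewrite (_ : _ - f w = (pspart (circle_coef m) w (2 ^ m) - f w) -
  (pspart (circle_coef m) w (2 ^ m) - pspart (circle_coef m) w K)); last by ring.
apply: le_trans (le_normcD _ _) _; apply: lerD => //; rewrite normcN.
rewrite -(subnKC KN) /pspart big_split_ord /= addrAC subrr add0r.
apply: le_trans (normc_sum _ _ _) _.
apply: (@le_trans _ _ (\sum_(i < 2 ^ m - K) B * (q ^+ K * q ^+ i))).
  apply: ler_sum => i _; rewrite normcM normcX -exprD.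
  have -> : normc w ^+ (K + i) = r ^+ (K + i) * q ^+ (K + i).
    by rewrite -exprMn /q mulrC divfK // gt_eqF.
  by rewrite mulrA; apply: ler_wpM2r (circle_coef_bound _ _); exact: exprn_ge0.
rewrite -!mulr_sumr; apply: ler_wpM2l => //; apply: ler_wpM2l; first exact: exprn_ge0.
exact: geom_sum_le.
Qed.

(** The values at [x r] determine the coefficient of order [n] up to [O(x)],
    once the lower coefficients converge. *)
Lemma circle_coef_limit n : exists l, ctends (fun m => circle_coef m n) l.
Proof.
elim/ltn_ind: n => n IH.
pose l i := xget 0 [set l | ctends (fun m => circle_coef m i) l].
have hl i : (i < n)%N -> ctends (fun m => circle_coef m i) (l i).
  by move=> /IH[l' hl']; rewrite /l; case: xgetP => // /(_ l').
apply: complex_cauchy => e e0.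
have rn : 0 < r ^+ n by exact: exprn_gt0.
have B1 : 0 < 8 * (B + 1) by rewrite mulr_gt0 // ltr_wpDl.
(* The tail of the series after order [n] then contributes at most half of [e]
   after division by [(x r)^n]. *)
pose x := Num.min (1 / 2) (e * r ^+ n / (8 * (B + 1))).
have x0 : 0 < x.
  by rewrite lt_min; apply/andP; split; rewrite divr_gt0 // mulr_gt0.
have x2 : x <= 1 / 2 by rewrite ge_min lexx.
have x3 : x * (8 * (B + 1)) <= e * r ^+ n by rewrite -ler_pdivlMr // ge_min lexx orbT.
pose w : R[i] := (x * r)%:C.
have nw : normc w = x * r by rewrite ger0_normcR // mulr_ge0 // ltW.
have wr : normc w < r by rewrite nw -[ltRHS]mul1r ltr_pM2r //; lra.
have qx : normc w / r = x by rewrite nw mulfK // gt_eqF.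
have xr : 0 < x * r by exact: mulr_gt0.
have xn : 0 < (x * r) ^+ n by exact: exprn_gt0.
pose d := e * (x * r) ^+ n / 9.
have d0 : 0 < d by rewrite divr_gt0 // mulr_gt0.
have [s [M1 h1]] : exists s, exists M, forall m, (M <= m)%N ->
    normc (pspart (circle_coef m) w n - s) <= d.
  exists (pspart l w n); rewrite /pspart.
  have : forall k, (k <= n)%N -> exists M, forall m, (M <= m)%N ->
    normc (\sum_(i < k) circle_coef m i * w ^+ i - \sum_(i < k) l i * w ^+ i) <= d.
    move=> k kn; suff : ctends (fun m => \sum_(i < k) circle_coef m i * w ^+ i)
        (\sum_(i < k) l i * w ^+ i).
      by move=> /(_ d d0)[N hN]; exists N => m /hN /ltW.
    elim: k kn => [|k IHk] kn.
      under eq_fun do rewrite big_ord0; rewrite big_ord0; exact: ctends_cst.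
    under eq_fun do rewrite big_ord_recr; rewrite big_ord_recr /=.
    apply: ctendsD; first exact: IHk (ltnW kn).
    by under eq_fun do rewrite mulrC; rewrite mulrC; apply: ctendsM; exact: hl.
  by move=> /(_ n (leqnn n)).
have [M2 h2] := circle_coef_partial n.+1 wr d0.
have T0 : B * (x ^+ n.+1 / (1 - x)) <= 2 * (B * x ^+ n.+1).
  rewrite [B * (_ / _)]mulrA ler_pdivrMr; last lra.
  have : 0 <= B * x ^+ n.+1 by rewrite mulr_ge0 // exprn_ge0 // ltW.
  by move=> h; have : 0 <= (1 / 2 - x) * (B * x ^+ n.+1); [rewrite mulr_ge0 ?subr_ge0|lra].
rewrite qx in h2.
have h3 m : (maxn M1 M2 <= m)%N ->
    normc (circle_coef m n * w ^+ n - (f w - s)) <= 2 * d + 2 * (B * x ^+ n.+1).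
  rewrite geq_max => /andP[/h1 g1 /h2]; rewrite {1}/pspart big_ord_recr /= -/(pspart _ _ _).
  set S := pspart _ _ _ in g1 *; set c := circle_coef m n * _ => g2.
  rewrite (_ : _ - (f w - s) = (S + c - f w) - (S - s)); last by ring.
  by apply: le_trans (le_normcD _ _) _; rewrite normcN; lra.
exists (maxn M1 M2) => p q /h3 hp /h3 hq.
rewrite -(ltr_pM2r xn) -nw -normcX -normcM mulrBl.
rewrite (_ : _ - _ = (circle_coef p n * w ^+ n - (f w - s)) - (circle_coef q n * w ^+ n - (f w - s))); last by ring.
apply: le_lt_trans (le_normcD _ _) _; rewrite normcN.
apply: le_lt_trans (lerD hp hq) _; rewrite normcX nw.
have : x ^+ n.+1 * (8 * (B + 1)) <= e * (x * r) ^+ n.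
  rewrite exprSr -mulrA [(x * r) ^+ n]exprMn (mulrCA e); apply: ler_wpM2l x3.
  by apply: exprn_ge0; exact: ltW.
have xn1 : 0 < x ^+ n.+1 by exact: exprn_gt0.
have ed : 9 * d = e * (x * r) ^+ n by rewrite /d mulrC divfK.
have : 0 < e * (x * r) ^+ n by exact: mulr_gt0.
by rewrite -ed; move: (x ^+ n.+1) xn1 => y; clear; lra.
Qed.

(** The bound of [circle_coef_partial] for the truncations is uniform in the
    number of points, so that it passes to the limit coefficients. *)
Lemma holomorphic_psum : exists a, psum_on r a f.
Proof.
have [a ha] := choice circle_coef_limit; exists a => w wr.
set q := normc w / r.
have q0 : 0 <= q by rewrite divr_ge0 ?normc_ge0 // ltW.
have q1 : q < 1 by rewrite ltr_pdivrMr // mul1r.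
have key K : normc (pspart a w K - f w) <= B * (q ^+ K / (1 - q)).
  have lim : ctends (fun m => pspart (circle_coef m) w K) (pspart a w K).
    rewrite /pspart; elim: K => [|K IHK].
      under eq_fun do rewrite big_ord0; rewrite big_ord0; exact: ctends_cst.
    under eq_fun do rewrite big_ord_recr; rewrite big_ord_recr /=.
    apply: ctendsD; first exact: IHK.
    by under eq_fun do rewrite mulrC; rewrite mulrC; apply: ctendsM; exact: ha.
  apply: (@ler_eps _ 2) => e e0; have [M1 h1] := lim e e0.
  have [M2 h2] := circle_coef_partial K wr e0.
  have := h1 _ (leq_maxl M1 M2); have := h2 _ (leq_maxr M1 M2).
  set m := maxn _ _; rewrite -/q => g2 g1.
  rewrite (_ : _ - f w = (pspart (circle_coef m) w K - f w) - (pspart (circle_coef m) w K - pspart a w K)); last by ring.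
  by apply: le_trans (le_normcD _ _) _; rewrite normcN; lra.
move=> e e0; have B1 : 0 < B + 1 by rewrite ltr_wpDl.
have q1' : 0 < 1 - q by rewrite subr_gt0.
have [n hn] := expr_small q0 q1 (divr_gt0 (mulr_gt0 e0 q1') B1).
exists n.+1 => K nK; apply: le_lt_trans (key K) _.
rewrite ltr_pdivlMr // in hn; rewrite mulrA ltr_pdivrMr //.
apply: le_lt_trans hn; rewrite mulrC; apply: ler_pM => //; first exact: exprn_ge0.
  by apply: ler_wiXn2l => //; exact: ltW.
by rewrite lerDl.
Qed.
End Coefficients.
End CauchyTaylor.

(** ** Taylor series on the disc and the Hardy space *)

Section DiscTaylor.
Context {R : realType}.
Implicit Types (f : disc R -> CC R) (a : nat -> R[i]).

Lemma disc_normc (z : disc R) : normc (val z) < 1.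
Proof. by have := valP z; rewrite normCE ltcR. Qed.

Lemma in_discP (w : R[i]) : normc w < 1 -> `|w| < 1.
Proof. by rewrite normCE ltcR. Qed.

Definition to_disc (w : R[i]) (h : normc w < 1) : disc R := exist _ w (in_discP h).

Lemma holomorphic_psval f (z : disc R) : holomorphic f ->
  psval (taylor f) (val z) (f z).
Proof.
move=> hf.
have df w : normc w < 1 -> exists l, cdiff (ext0 f) w l.
  move=> w1; exists ('D_1 (ext0 f) (w : CC R)).
  exact: derivable_cdiff (hf (to_disc w1)).
have z1 := disc_normc z; have z0 := normc_ge0 (val z).
pose r := (1 + normc (val z)) / 2.
have r0 : 0 < r by rewrite /r; lra.
have r1 : r < 1 by rewrite /r; lra.
have zr : normc (val z) < r by rewrite /r; lra.
have [B B0 hB] := circle_bound r0 r1 df.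
have [a ha] := holomorphic_psum r0 r1 df B0 hB.
have -> : taylor f = a by apply/funext => n; exact: psum_on_taylor ha.
by rewrite -(ext0_val f); exact: ha.
Qed.

Lemma psval_holomorphic a f : (forall z, psval a (val z) (f z)) ->
  holomorphic f /\ taylor f = a.
Proof.
move=> haf.
have ha : psum_on 1 a (ext0 f).
  move=> w w1; have := haf (to_disc w1).
  by rewrite -(ext0_val f).
split=> [z|]; last by apply/funext => n; exact: (psum_on_taylor ltr01 n ha).
exact: psum_on_derivable ha (disc_normc z).
Qed.

Lemma taylor_eq0 f : holomorphic f -> (forall n, taylor f n = 0) -> f = 0.
Proof.
move=> hf h0; apply/funext => z.
apply: (psval_unique (holomorphic_psval z hf)) => e e0; exists 0%N => n _.
by rewrite /pspart big1 ?subrr ?normc0 // => i _; rewrite h0 mul0r.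
Qed.

Lemma l2_series_finite a :
  (\sum_(0 <= n <oo) ((normc (a n)) ^+ 2)%:E < +oo)%E <-> exists B, l2bd a B.
Proof.
have pos n : (0 <= ((normc (a n)) ^+ 2)%:E)%E by rewrite lee_fin sqr_ge0.
have part M : (\sum_(0 <= i < M) ((normc (a i)) ^+ 2)%:E)%E =
    (\sum_(i < M) normc (a i) ^+ 2)%:E.
  by rewrite sumEFin big_mkord.
split=> [h|[B hB]].
  exists (fine (\sum_(0 <= n <oo) ((normc (a n)) ^+ 2)%:E)%E) => M.
  rewrite -lee_fin -part fineK; first exact: nneseries_lim_ge.
  by rewrite ge0_fin_numE //; exact: nneseries_ge0.
apply: (@le_lt_trans _ _ B%:E); last exact: ltry.
apply: lime_le; first exact: is_cvg_nneseries.
by near=> M; rewrite /= part lee_fin; exact: hB.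
Unshelve. all: by end_near.
Qed.

Lemma hardy2P f : hardy2 R f <-> holomorphic f /\ exists B, l2bd (taylor f) B.
Proof. by split=> -[hf /l2_series_finite]. Qed.

Lemma hardy2_of_coef a (B : R) : l2bd a B ->
  exists f, [/\ hardy2 R f, taylor f = a & forall z, psval a (val z) (f z)].
Proof.
move=> hB.
have conv (z : disc R) : exists w, psval a (val z) w.
  apply: (@complex_abs_series _ (fun i => a i * val z ^+ i) (B + (1 - normc (val z) ^+ 2)^-1)) => M.
  have z1 := disc_normc z; have z0 := normc_ge0 (val z).
  have zz : normc (val z) ^+ 2 < 1 by rewrite expr_lt1.
  apply: (@le_trans _ _ (\sum_(i < M) (normc (a i) ^+ 2 + (normc (val z) ^+ 2) ^+ i))).
    apply: ler_sum => i _; rewrite normcM normcX -exprM mulnC exprM.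
    set x := normc (a i); set y := _ ^+ i.
    have := sqr_ge0 (x - y); have := sqr_ge0 (x + y); lra.
  rewrite big_split /=; apply: lerD; first exact: hB.
  by apply: geom_sum_le; rewrite ?sqr_ge0.
have [f hf] := choice conv; exists f.
have [hol tf] := psval_holomorphic hf.
by split=> //; apply/hardy2P; rewrite tf; split=> //; exists B.
Qed.

End DiscTaylor.

(** * An isometric Gelfand transform forces a Szego kernel *)

Section Representation.
Context {R : realType} {X : Type} (H : rkhs (R := R) X) (k : X -> X -> R[i]).
Hypothesis hX : exists x y : X, x <> y.
Variable x0 : X.
Hypotheses (hk : is_kernel H k) (hirr : irreducible_kernel k)
  (hNP : complete_NP H k) (hnorm1 : normalized k x0) (gel : gelfand_isometric H).
Notation kv := (kv hk).
Notation F := (pickF k).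
Notation K y := (nrm (kv y) ^+ 2).

(** By [pickF_rank_one] the coordinate vectors of all points are multiples of
    the one of a point [y], by equality in the Cauchy--Schwarz inequality. *)
Lemma pickF_factor : exists u : X -> R[i],
  [/\ forall x y, F x y = u x * (u y)^*, u x0 = 0 & exists y, u y != 0].
Proof.
have [y yx0] : exists y, y <> x0.
  have [a [b ab]] := hX; have [ax|] := pselect (a = x0); last by exists a.
  by exists b => bx; apply: ab; rewrite ax bx.
have Ky := kernel_gt1 hk hirr hnorm1 yx0.
pose r := Num.sqrt (1 - (K y)^-1).
have iK : (K y)^-1 < 1 by rewrite invf_lt1 // (lt_trans ltr01).
have r0 : 0 < r by rewrite sqrtr_gt0 subr_gt0.
have Fyy : F y y = (r ^+ 2)%:C.
  by rewrite (pickF_diag hk) [in RHS]sqr_sqrtr // subr_ge0 ltW.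
have c0 : r%:C != 0 :> R[i] by rewrite -normc_gt0 ger0_normcR // ltW.
have Fx0 z : F x0 z = 0 by rewrite (pickFC hk z x0) (pickFx0 hnorm1) cj0.
have rk1 z : normc (F z y) ^+ 2 = Re (F z z) * r ^+ 2.
  have [->|zx0] := pselect (z = x0); first by rewrite !Fx0 normc0 mul0r expr0n.
  by rewrite (pickF_rank_one hk hNP hirr hnorm1 gel yx0 zx0) Fyy rcK.
exists (fun x => F x y / r%:C); split; last 2 first.
- by rewrite Fx0 mul0r.
- by exists y; rewrite Fyy rcX mulf_neq0 ?invr_neq0 ?expf_neq0.
move=> x z; rewrite cjM -rcV cjR rcV.
have [d [phi [_ hphi]]] := pick_coords_exist hk hNP hnorm1 hirr.1 [:: x; y; z].
have Fx t := hphi x (or_introl erefl) t.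
have Fy t := hphi y (or_intror (or_introl erefl)) t.
have Fz t := hphi z (or_intror (or_intror (or_introl erefl))) t.
pose c := F x y / (r%:C ^+ 2).
have lin l : mv (phi l) x = c * mv (phi l) y.
  have : \sum_l normc (mv (phi l) x - c * mv (phi l) y) ^+ 2 = 0.
    have cE : (\sum_l normc (mv (phi l) x - c * mv (phi l) y) ^+ 2)%:C =
        F x x - c^* * F x y - c * (F y x - c^* * F y y).
      rewrite rc_sum -(Fx x) -(Fy x) -(Fx y) -(Fy y).
      rewrite !mulr_sumr -!sumrB mulr_sumr -sumrB.
      apply: eq_bigr => i _; rewrite -mulcJ cjB cjM; ring.
    apply/eqP; rewrite -(inj_eq (@complexI R)) cE.
    rewrite (pickFC hk x y) Fyy rcX.
    have Rx : F x x = (Re (F x x))%:C by rewrite (pickF_diag hk) rcK.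
    have -> : F x x = F x y * (F x y)^* / r%:C ^+ 2.
      by rewrite mulcJ rk1 Rx rcM rcX mulfK // expf_neq0.
    by apply/eqP; rewrite /c cjM -rcX -rcV cjR rcV rcX; field.
  move/eqP; rewrite psumr_eq0 => [|i _]; last exact: sqr_ge0.
  move=> /allP/(_ l (mem_index_enum _))/=.
  by rewrite sqrf_eq0 normc_eq0 subr_eq0 => /eqP.
rewrite -Fz; under eq_bigr do rewrite lin -mulrA.
rewrite -mulr_sumr Fz /c -(pickFC hk).
by field.
Qed.

(** The factor of [pickF] is the map [j]. If its range were not a set of
    uniqueness then [l2_vanishing] would contradict [extremal_pow_norm]. *)
Lemma szego_of_isometric : exists (A : set (disc R)) (j : X -> disc R),
  szego_representation k x0 A j.
Proof.
have [u [hF u0 [y uy]]] := pickF_factor.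
have nu x : normc (u x) ^+ 2 = 1 - (K x)^-1.
  apply: (@complexI R); rewrite -mulcJ -hF; exact: pickF_diag.
have Kpos x : 0 < K x.
  rewrite exprn_gt0 // nrm_gt0 // => e.
  by apply: (hirr.1 x x); rewrite -(ev_kv hk) e ev0.
have u1 x : normc (u x) < 1.
  have : normc (u x) ^+ 2 < 1.
    by rewrite nu gtrBl invr_gt0.
  by rewrite expr_lt1 // normc_ge0.
have hku x z : k x z = 1 / (1 - u x * (u z)^*).
  have := k_pickF hirr.1 x z; rewrite hF => h.
  have n0 : 1 - u x * (u z)^* != 0.
    by apply: contra_eq_neq h => ->; rewrite mulr0 eq_sym oner_eq0.
  by apply: (mulIf n0); rewrite h divfK.
pose j x := to_disc (u1 x).
have jinj x z : j x = j z -> x = z.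
  move=> /(congr1 val) /= e; apply: contrapT => xz.
  have [h1 _] : (1 : R[i]) = 0 /\ (-1 : R[i]) = 0.
    apply: (hirr.2 x z xz); apply/funext => t.
    rewrite -[LHS]/(1 * k t x + -1 * k t z) !hku e; ring.
  by move/eqP: h1; rewrite oner_eq0.
exists (range j), j; split=> //.
  move=> f /hardy2P[hf [B hB]] fA.
  apply: taylor_eq0 => // n.
  have [phi [hphi cphi]] := szego_contr_multiplier hk u1 hku.
  apply: (l2_vanishing u0 hku hphi cphi _ hB) => [m|x]; last first.
    by rewrite -(fA (j x)); [exact: (holomorphic_psval (j x) hf)|exists x].
  apply: (extremal_pow_norm hNP hirr hnorm1 gel (y := y)); rewrite ?hphi //.
split=> [x _|x z _ _|_ [x _ <-]].
- by exists x.
- exact: jinj.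
- by exists x.
Qed.

End Representation.

(** * Square means over circles *)

Section SquareMeans.
Context {R : realType}.
Implicit Types (a : nat -> R[i]) (f g : R[i] -> R[i]) (r : R).

Definition sqmean m r f : R :=
  (\sum_(0 <= j < 2 ^ m) normc (f (r%:C * omega m ^+ j)) ^+ 2) / (2 ^ m)%:R.

Definition sqsum a r K : R := \sum_(n < K) normc (a n) ^+ 2 * r ^+ (2 * n).

Lemma sqsum_le a r K L : 0 <= r -> (K <= L)%N -> sqsum a r K <= sqsum a r L.
Proof.
move=> r0 KL; rewrite /sqsum -(subnKC KL) big_split_ord /= lerDl.
by apply: sumr_ge0 => i _; rewrite mulr_ge0 ?sqr_ge0 ?exprn_ge0.
Qed.

Lemma sqsum_le1 a r K : 0 <= r -> r <= 1 ->
  sqsum a r K <= \sum_(n < K) normc (a n) ^+ 2.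
Proof.
move=> r0 r1; apply: ler_sum => i _; apply: ler_piMr; first exact: sqr_ge0.
exact: exprn_ile1.
Qed.

(** Orthogonality of the characters of the cyclic group of order [2 ^ m]. *)
Lemma sqmean_poly a m r K : (K <= 2 ^ m)%N ->
  sqmean m r (fun z => pspart a z K) = sqsum a r K.
Proof.
move=> Km; apply: (@complexI R).
rewrite /sqmean /sqsum rcM rcV rc_nat !rc_sum.
have tE j : (normc (pspart a (r%:C * omega m ^+ j) K) ^+ 2)%:C =
    \sum_(n < K) \sum_(l < K) a n * (a l)^* * r%:C ^+ (n + l) *
      ((omega m ^+ j) ^+ n * (omega m ^- j) ^+ l).
  rewrite -mulcJ /pspart cj_sum mulr_suml; apply: eq_bigr => n _.
  rewrite mulr_sumr; apply: eq_bigr => l _.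
  have cw : (omega m ^+ j)^* = omega m ^- j :> R[i].
    have h : omega m ^+ j * (omega m ^+ j)^* = 1 :> R[i].
      by rewrite mulcJ normcX normc_omega !expr1n.
    have w0 : omega m ^+ j != 0 :> R[i] by rewrite expf_neq0 // omega_neq0.
    by apply: (mulfI w0); rewrite h divff.
  rewrite cjM rmorphXn /= cjM cw cjR !exprMn exprD; ring.
under eq_bigr do rewrite tE.
rewrite exchange_big mulr_suml /=; apply: eq_bigr => n _.
rewrite exchange_big mulr_suml (bigD1 n) //= [X in _ + X]big1 ?addr0; last first.
  move=> l ln; rewrite -mulr_sumr -mulrA cmean_pow; last 2 first.
  - exact: leq_trans (ltn_ord n) Km.
  - exact: leq_trans (ltn_ord l) Km.
  by rewrite (_ : (n == l :> nat) = false) ?mulr0 // eq_sym; apply/negbTE.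
rewrite -mulr_sumr -mulrA cmean_pow ?eqxx; last 2 first.
- exact: leq_trans (ltn_ord n) Km.
- exact: leq_trans (ltn_ord n) Km.
by rewrite mulr1 mulcJ addnn -mul2n -rcX -rcM.
Qed.

Lemma normc_rcircle r m j : 0 <= r -> normc (r%:C * omega m ^+ j : R[i]) = r.
Proof. by move=> r0; rewrite normcM normcX normc_omega expr1n mulr1 ger0_normcR. Qed.

(** On a circle inside the disc a power series is uniformly close to its partial
    sums, for which the square mean is exact. *)
Lemma sqmean_close a f r e : psum_on 1 a f -> 0 < r -> r < 1 -> 0 < e ->
  exists K0, forall K m, (K0 <= K)%N -> (K <= 2 ^ m)%N ->
  `|sqmean m r f - sqsum a r K| <= e.
Proof.
move=> haf r0 r1 e0; pose r' := (r + 1) / 2.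
have r'0 : 0 < r' by rewrite /r'; lra.
have r'1 : r' < 1 by rewrite /r'; lra.
have rr' : r < r' by rewrite /r'; lra.
have [B B0 hB] := psum_on_bound haf r'0 r'1.
pose q := r / r'.
have q0 : 0 <= q by rewrite divr_ge0 // ltW.
have q1 : q < 1 by rewrite ltr_pdivrMr // mul1r.
have q1' : 0 < 1 - q by rewrite subr_gt0.
have term n : normc (a n) * r ^+ n <= B * q ^+ n.
  have -> : r ^+ n = r' ^+ n * q ^+ n by rewrite -exprMn /q mulrC divfK // gt_eqF.
  by rewrite mulrA; apply: ler_wpM2r (hB n); exact: exprn_ge0.
pose T := B / (1 - q).
have T0 : 0 <= T by rewrite divr_ge0 // ltW.
have part K z : normc z = r -> normc (pspart a z K) <= T.
  move=> zr; apply: le_trans (normc_sum _ _ _) _.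
  apply: (@le_trans _ _ (\sum_(i < K) B * q ^+ i)).
    by apply: ler_sum => i _; rewrite normcM normcX zr.
  by rewrite -mulr_sumr; apply: ler_wpM2l => //; exact: geom_sum_le.
have zdisc z : normc z = r -> normc z < 1 by move=> ->.
have fT z : normc z = r -> normc (f z) <= T.
  by move=> zr; apply: (ctends_bound (haf z (zdisc _ zr))) => n; exact: part.
have tail K z : normc z = r -> normc (f z - pspart a z K) <= T * q ^+ K.
  move=> zr; have := ctendsD (haf z (zdisc _ zr)) (@ctends_cst _ (- pspart a z K)).
  have shift : forall n, normc (pspart a z n - pspart a z K) <= T * q ^+ K \/ (n < K)%N.
    move=> n; have [nK|Kn] := ltnP n K; [by right|left].
    rewrite -(subnKC Kn) /pspart big_split_ord /= addrAC subrr add0r.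
    apply: le_trans (normc_sum _ _ _) _.
    apply: (@le_trans _ _ (\sum_(i < n - K) B * (q ^+ K * q ^+ i))).
      by apply: ler_sum => i _; rewrite normcM normcX zr -exprD; exact: term.
    rewrite -!mulr_sumr /T -mulrA; apply: ler_wpM2l => //; rewrite mulrC.
    by apply: ler_wpM2r; [exact: exprn_ge0|exact: geom_sum_le].
  move=> lim; apply: (@ler_eps _ 1) => d d0; have [N hN] := lim d d0.
  have := hN _ (leq_maxl N K); have [h|] := shift (maxn N K); last first.
    by rewrite ltnNge leq_maxr.
  set x := pspart a z (maxn N K) in h *; set y := pspart a z K in h *.
  move=> h2; have := ler_normcB (f z - y) (x - y); rewrite normcB_sym.
  by rewrite normcB_sym in h2; lra.
have TT : 0 < 2 * T * T + 1.
  by rewrite ltr_wpDl // -mulrA mulr_ge0 // mulr_ge0.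
have [M hM] := expr_small q0 q1 (divr_gt0 e0 TT).
exists M.+1 => K m MK Km; rewrite -(sqmean_poly a r Km) /sqmean -mulrBl.
have n0 : 0 < (2 ^ m)%:R :> R by rewrite ltr0n expn_gt0.
rewrite normrM normfV (gtr0_norm n0) ler_pdivrMr // -sumrB big_mkord.
apply: le_trans (ler_norm_sum _ _ _) _.
apply: (@le_trans _ _ (\sum_(i < 2 ^ m) e)); last first.
  by rewrite sumr_const card_ord mulr_natr.
apply: ler_sum => j _; set z := _ * _.
have zr : normc z = r by apply: normc_rcircle; exact: ltW.
rewrite subr_sqr normrM.
have h1 : `|normc (f z) - normc (pspart a z K)| <= T * q ^+ K.
  have := tail K z zr; have := ler_normcB (f z) (pspart a z K).
  have := ler_normcB (pspart a z K) (f z); rewrite normcB_sym ler_norml => *.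
  by apply/andP; split; lra.
have h2 : `|normc (f z) + normc (pspart a z K)| <= 2 * T.
  rewrite ger0_norm ?addr_ge0 ?normc_ge0 //.
  by have := fT z zr; have := part K z zr; lra.
apply: le_trans (ler_pM _ _ h1 h2) _; rewrite ?normr_ge0 //.
have h3 : q ^+ K <= q ^+ M.+1 by apply: ler_wiXn2l => //; exact: ltW.
rewrite ltr_pdivlMr // in hM.
have h4 : q ^+ K * (2 * T * T + 1) <= q ^+ M.+1 * (2 * T * T + 1).
  by apply: ler_wpM2r h3; exact: ltW.
have := exprn_ge0 K q0; move: h4 hM; clear; lra.
Qed.

End SquareMeans.

(** * Bounded holomorphic functions act on square summable series *)

Section BoundedAction.
Context {R : realType}.

Lemma opnorm_leP m (A : 'M[R[i]]_m) (C : R) : 0 <= C ->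
  (opnorm A <= C%:E)%E <-> forall v : 'I_m -> R[i],
  \sum_i normc (\sum_l A i l * v l) ^+ 2 <= C ^+ 2 * \sum_l normc (v l) ^+ 2.
Proof.
move=> C0; have S0 (v : 'I_m -> R[i]) : 0 <= \sum_l normc (v l) ^+ 2.
  by apply: sumr_ge0 => l _; exact: sqr_ge0.
have sE (v : 'cV[R[i]]_m) : l2norm (A *m v) =
    Num.sqrt (\sum_i normc (\sum_l A i l * v l 0) ^+ 2).
  by congr Num.sqrt; apply: eq_bigr => i _; rewrite mxE.
split=> [h v|h]; last first.
  apply: ge_ereal_sup => _ [v v1 <-]; rewrite lee_fin sE.
  rewrite -(@ler_pXn2r _ 2) ?nnegrE ?sqrtr_ge0 // sqr_sqrtr ?S0 //.
  apply: le_trans (h (fun l => v l 0)) _; rewrite -[leRHS]mulr1.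
  apply: ler_wpM2l; first exact: sqr_ge0.
  by rewrite -[X in X <= 1]sqr_sqrtr ?S0 // expr_le1 ?sqrtr_ge0.
have := S0 v; rewrite le_eqVlt => /orP[/eqP v0|vp].
  have vz l : v l = 0.
    apply/eqP; rewrite -normc_eq0 -[_ == 0](@expf_eq0 _ _ 2) /=.
    have := v0 => /esym/eqP; rewrite psumr_eq0 => [|i _]; last exact: sqr_ge0.
    by move=> /allP /(_ l (mem_index_enum _)).
  rewrite -v0 mulr0 big1 // => i _.
  by rewrite big1 ?normc0 ?expr0n // => l _; rewrite vz mulr0.
pose c := Num.sqrt (\sum_l normc (v l) ^+ 2); have cp : 0 < c by rewrite sqrtr_gt0.
have cc : c ^+ 2 = \sum_l normc (v l) ^+ 2 by rewrite sqr_sqrtr.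
have nc : normc (c^-1)%:C = c^-1 by rewrite ger0_normcR // invr_ge0 ltW.
pose w : 'cV[R[i]]_m := \col_l ((c^-1)%:C * v l).
have w1 : l2norm w = 1.
  rewrite /l2norm (_ : \sum_i _ = 1) ?sqrtr1 //.
  under eq_bigr do rewrite mxE normcM nc exprMn.
  by rewrite -mulr_sumr -cc exprVn mulVf // expf_neq0 // gt_eqF.
have : ((l2norm (A *m w))%:E <= C%:E)%E.
  apply: le_trans h; apply: ereal_sup_ubound; exists w => //=.
  by rewrite w1.
rewrite lee_fin sE -(@ler_pXn2r _ 2) ?nnegrE ?sqrtr_ge0 // sqr_sqrtr ?S0 //.
have -> : \sum_i normc (\sum_l A i l * w l 0) ^+ 2 =
    (c^-1) ^+ 2 * \sum_i normc (\sum_l A i l * v l) ^+ 2.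
  rewrite mulr_sumr; apply: eq_bigr => i _; rewrite -nc -exprMn -normcM.
  by rewrite mulr_sumr; congr (normc _ ^+ 2); apply: eq_bigr => l _; rewrite mxE mulrCA.
by rewrite exprVn cc mulrC ler_pdivrMr.
Qed.

Lemma sup_mxnorm_leP (T : Type) m (F : T -> 'M[R[i]]_m) (C : \bar R) :
  (sup_mxnorm F <= C)%E <-> forall t, (opnorm (F t) <= C)%E.
Proof.
split=> [h t|h]; last by apply: ge_ereal_sup => _ [t _ <-]; exact: h.
by apply: le_trans h; apply: ereal_sup_ubound; exists t.
Qed.

(** On each circle the inequality holds between the square means, which tend to
    the weighted sums of squares of the coefficients. Letting the radius tend to
    1 removes the weights. *)
Lemma bounded_action m (Psi : 'I_m -> 'I_m -> disc R -> R[i])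
    (f g : 'I_m -> disc R -> R[i]) (a b : 'I_m -> nat -> R[i]) (C : R) (B : 'I_m -> R) :
  0 <= C ->
  (forall z (v : 'I_m -> R[i]), \sum_i normc (\sum_l Psi i l z * v l) ^+ 2 <=
     C ^+ 2 * \sum_l normc (v l) ^+ 2) ->
  (forall i z, psval (a i) (val z) (f i z)) ->
  (forall i z, psval (b i) (val z) (g i z)) ->
  (forall i z, g i z = \sum_l Psi i l z * f l z) ->
  (forall l, l2bd (a l) (B l)) ->
  forall K, \sum_i \sum_(n < K) normc (b i n) ^+ 2 <= C ^+ 2 * \sum_l B l.
Proof.
move=> C0 hPsi ha hb hg hB K.
have psum c (h : disc R -> R[i]) : (forall z, psval c (val z) (h z)) ->
    psum_on 1 c (ext0 (h : disc R -> CC R)).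
  by move=> hc w w1; have := hc (to_disc w1); rewrite -(ext0_val (h : disc R -> CC R)).
have step r e : 0 < r -> r < 1 -> 0 < e ->
    \sum_i sqsum (b i) r K <= C ^+ 2 * \sum_l B l + (1 + C ^+ 2) * m%:R * e.
  move=> r0 r1 e0.
  have [Ka hKa] := choice (fun i => sqmean_close (psum _ _ (ha i)) r0 r1 e0).
  have [Kb hKb] := choice (fun i => sqmean_close (psum _ _ (hb i)) r0 r1 e0).
  pose N := maxn K (maxn (\max_i Ka i) (\max_i Kb i)).
  have NM : (N <= 2 ^ N)%N by exact: ltnW (ltn_expl _ _).
  have KN : (K <= N)%N by exact: leq_maxl.
  have na i : (Ka i <= N)%N by rewrite !leq_max (leq_bigmax i) orbT.
  have nb i : (Kb i <= N)%N by rewrite !leq_max (leq_bigmax i) !orbT.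
  have h1 i := hKa i N N (na i) NM.
  have h2 i := hKb i N N (nb i) NM.
  apply: (@le_trans _ _ (\sum_i (sqmean N r (ext0 (g i : disc R -> CC R)) + e))).
    apply: ler_sum => i _; apply: le_trans (sqsum_le _ (ltW r0) KN) _.
    by have := h2 i; rewrite ler_norml => /andP[]; lra.
  have mean : \sum_i sqmean N r (ext0 (g i : disc R -> CC R)) <=
      C ^+ 2 * \sum_l sqmean N r (ext0 (f l : disc R -> CC R)).
    have n0 : 0 < (2 ^ N)%:R^-1 :> R by rewrite invr_gt0 ltr0n expn_gt0.
    rewrite /sqmean -!mulr_suml mulrA ler_pM2r // exchange_big [X in _ <= _ * X]exchange_big /=.
    rewrite mulr_sumr; apply: ler_sum => j _.
    have z1 : normc (r%:C * omega N ^+ j : R[i]) < 1 by rewrite normc_rcircle // ltW.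
    have eE h : ext0 (h : disc R -> CC R) (r%:C * omega N ^+ j) = h (to_disc z1) :> R[i].
      by rewrite -(ext0_val (h : disc R -> CC R)).
    have := hPsi (to_disc z1) (fun l => f l (to_disc z1)).
    under [X in X <= _]eq_bigr do rewrite -hg -eE.
    have -> : \sum_l normc (f l (to_disc z1)) ^+ 2 =
        \sum_l normc (ext0 (f l : disc R -> CC R) (r%:C * omega N ^+ j)) ^+ 2.
      by apply: eq_bigr => l _; rewrite eE.
    by [].
  rewrite big_split /= sumr_const card_ord -mulr_natr.
  have hf : \sum_l sqmean N r (ext0 (f l : disc R -> CC R)) <= \sum_l B l + m%:R * e.
    have -> : m%:R * e = \sum_(l < m) e by rewrite sumr_const card_ord mulr_natl.
    rewrite -big_split; apply: ler_sum => l _.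
    apply: (@le_trans _ _ (sqsum (a l) r N + e)).
      by have := h1 l; rewrite ler_norml => /andP[]; lra.
    apply: lerD => //; apply: le_trans (hB l N).
    by apply: sqsum_le1; exact: ltW.
  have := ler_wpM2l (sqr_ge0 C) hf; lra.
have lim r : 0 < r -> r < 1 -> \sum_i sqsum (b i) r K <= C ^+ 2 * \sum_l B l.
  by move=> r0 r1; apply: (@ler_eps _ ((1 + C ^+ 2) * m%:R)) => e; exact: step.
set S := \sum_i _; set D := C ^+ 2 * _ in lim *.
have S0 : 0 <= S by apply: sumr_ge0 => i _; apply: sumr_ge0 => n _; exact: sqr_ge0.
have bern (e : R) n : 0 <= e -> e <= 1 -> 1 - n%:R * e <= (1 - e) ^+ n.
  move=> e0 e1; elim: n => [|n IH]; first by rewrite mul0r subr0 expr0.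
  have h : 0 <= 1 - e by rewrite subr_ge0.
  have := ler_wpM2l h IH; rewrite -exprS; apply: le_trans.
  have : 0 <= n%:R * e * e by rewrite !mulr_ge0 ?ler0n.
  by rewrite -natr1; move: (n%:R : R) => x; lra.
apply: (@ler_eps _ ((2 * K)%:R * S)) => e e0.
pose d := Num.min e (1 / 2).
have d0 : 0 < d by rewrite lt_min e0 divr_gt0.
have d1 : d <= 1 / 2 by rewrite ge_min lexx orbT.
have de : d <= e by rewrite ge_min lexx.
have r0 : 0 < 1 - d by lra.
have r1 : 1 - d < 1 by lra.
have h1 : (1 - d) ^+ (2 * K) * S <= D.
  apply: le_trans (lim _ r0 r1); rewrite mulr_sumr; apply: ler_sum => i _.
  rewrite mulr_sumr; apply: ler_sum => n _; rewrite mulrC; apply: ler_wpM2l.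
    exact: sqr_ge0.
  apply: ler_wiXn2l; rewrite ?(ltW r0) ?(ltW r1) //.
  by rewrite leq_mul2l /= ltnW.
have h2 : (1 - (2 * K)%:R * d) * S <= D.
  by apply: le_trans h1; apply: ler_wpM2r => //; apply: bern; lra.
have : (2 * K)%:R * S * d <= (2 * K)%:R * S * e.
  by apply: ler_wpM2l => //; rewrite mulr_ge0.
by move: h2; move: ((2 * K)%:R : R) => x; lra.
Qed.
End BoundedAction.

(** * Multipliers are bounded *)

Section UniformBoundedness.
Context {R : realType} {X : Type} (H : rkhs (R := R) X).
Implicit Types (g v : hvec H).

(** The gliding hump: if the norms are unbounded then a sum of multiples of
    suitable [v n], with norms [3^-n] and suitable signs, violates pointwise
    boundedness. *)
Lemma uniform_boundedness (V : hvec H -> Prop) :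
  (forall g, exists M : R, forall v, V v -> normc (ip g v) <= M) ->
  exists M : R, forall v, V v -> nrm v <= M.
Proof.
move=> pw; apply: contrapT => nb.
have big (B : R) : exists v, V v /\ B < nrm v.
  apply: contrapT => h; apply: nb; exists B => v Vv.
  by rewrite leNgt; apply/negP => ?; apply: h; exists v.
pose c n : R := 3^-1 ^+ n.
have c0 n : 0 < c n by rewrite exprn_gt0 // invr_gt0.
have cS n : c n.+1 = c n / 3 by rewrite /c exprS mulrC.
have [v hv] := choice (fun n : nat => big (n%:R / c n)).
have nv n : 0 < nrm (v n).
  by apply: le_lt_trans (hv n).2; rewrite divr_ge0 // ltW.
pose d n : hvec H := (c n / nrm (v n))%:C *: v n.
have nd n : nrm (d n) = c n.
  by rewrite nrmZ ger0_normcR ?divr_ge0 ?(ltW (c0 n)) ?nrm_ge0 // divfK // gt_eqF.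
have idv n : normc (ip (d n) (v n)) = c n * nrm (v n).
  rewrite ipZl ipxx -rcM ger0_normcR; last first.
    by rewrite mulr_ge0 ?sqr_ge0 // divr_ge0 ?nrm_ge0 // ltW.
  by field; rewrite gt_eqF.
(* One of the two signs keeps the pairing with [v n] large. *)
pose step n g := if c n * nrm (v n) <= normc (ip (g + d n) (v n))
  then g + d n else g - d n.
have stepP n g : c n * nrm (v n) <= normc (ip (step n g) (v n)).
  rewrite /step; case: ifPn => //; rewrite -ltNge => h.
  have : 2 * (c n * nrm (v n)) <=
      normc (ip (g + d n) (v n)) + normc (ip (g - d n) (v n)).
    have -> : 2 * (c n * nrm (v n)) = normc (2 * ip (d n) (v n)).
      by rewrite normcM idv -[2 in RHS]rc_nat ger0_normcR.
    have -> : 2 * ip (d n) (v n) = ip (g + d n) (v n) - ip (g - d n) (v n).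
      by rewrite !ipDl ipNl; ring.
    by apply: le_trans (le_normcD _ _) _; rewrite normcN.
  by move: h; move: (c n * nrm (v n)) => y; lra.
have stepN n g : nrm (step n g - g) = c n.
  by rewrite /step; case: ifP => _; rewrite addrC addKr ?nrmN.
pose gs n := iteri n step 0.
have gsS n : gs n.+1 = step n (gs n) by [].
have tail n q : nrm (gs (n.+1 + q)%N - gs n.+1) <= c n / 2 - c (n + q)%N / 2.
  elim: q => [|q IH]; first by rewrite !addn0 !subrr nrm0.
  rewrite !addnS gsS; set m := (n.+1 + q)%N in IH *.
  have -> : step m (gs m) - gs n.+1 = (step m (gs m) - gs m) + (gs m - gs n.+1).
    by rewrite addrA subrK.
  apply: le_trans (nrmD _ _) _; rewrite stepN.
  have -> : c m = c (n + q)%N / 3 by rewrite -cS.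
  by lra.
have tail' n p : (n < p)%N -> nrm (gs p - gs n.+1) <= c n / 2.
  move=> np; rewrite -(subnKC np); apply: le_trans (tail _ _) _.
  by rewrite gerBl divr_ge0 // ltW.
have [g hg] : exists g, forall e, 0 < e -> exists N, forall n, (N <= n)%N ->
    nrm (gs n - g) < e.
  apply: hvec_complete => e e0.
  have h3 : 0 <= 3^-1 :> R by rewrite invr_ge0.
  have h3' : 3^-1 < 1 :> R by rewrite invf_lt1 // ltr1n.
  have [N hN] := expr_small h3 h3' e0; exists N.+2 => p q Np Nq.
  rewrite (_ : gs p - gs q = (gs p - gs N.+2) - (gs q - gs N.+2)); last first.
    by rewrite opprB addrA subrK.
  apply: le_lt_trans (nrmB _ _) _.
  have := tail' N.+1 p Np; have := tail' N.+1 q Nq; rewrite -/(c N.+1) in hN; lra.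
have gg n : nrm (g - gs n.+1) <= c n / 2.
  apply: (@ler_eps _ 1) => e e0; have [N hN] := hg e e0.
  have := hN _ (leq_maxl N n.+1); have := tail' n _ (leq_maxr N n.+1).
  set p := maxn _ _ => h1 h2; rewrite nrmB_sym in h2.
  rewrite (_ : g - gs n.+1 = (g - gs p) + (gs p - gs n.+1)); last by rewrite addrA subrK.
  by apply: le_trans (nrmD _ _) _; lra.
have low n : n%:R / 2 < normc (ip g (v n)).
  have h1 := stepP n (gs n); rewrite -gsS in h1.
  have h2 : normc (ip (gs n.+1 - g) (v n)) <= c n / 2 * nrm (v n).
    apply: le_trans (cauchy_schwarz _ _) _; apply: ler_wpM2r; first exact: nrm_ge0.
    by rewrite nrmB_sym.
  have h3 := ler_normcB (ip (gs n.+1) (v n)) (ip g (v n)); rewrite -ipBl in h3.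
  have := (hv n).2; rewrite ltr_pdivrMr // => h4.
  rewrite mulrAC in h2; move: h1 h2 h3 h4; rewrite (mulrC (nrm _)).
  by move: (c n * nrm (v n)) => y; lra.
have [M hM] := pw g.
have M0 : 0 <= M by apply: le_trans (hM _ (hv 0%N).1); exact: normc_ge0.
have := archi_boundP (mulr_ge0 (ler0n R 2) M0); set n := Num.bound _ => h.
by have := hM _ (hv n).1; have := low n; lra.
Qed.

(** The adjoint is explicit on combinations of kernel functions, and its values
    on the unit ball are pointwise bounded as functionals. *)
Lemma multiplier_bounded (k : X -> X -> R[i]) (hk : is_kernel H k) (theta : mult H) :
  exists2 C : R, 0 <= C & forall g, nrm (mact theta g) <= C * nrm g.
Proof.
pose adj s := lcomb hk (scale_pts (fun x => (mv theta x)^*) s).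
have [M hM] : exists M : R, forall v,
    (exists s, nrm (lcomb hk s) <= 1 /\ v = adj s) -> nrm v <= M.
  apply: uniform_boundedness => g; exists (nrm (mact theta g)) => _ [s [s1 ->]].
  rewrite -ip_mact_lcomb; apply: le_trans (cauchy_schwarz _ _) _.
  by apply: ler_piMr; first exact: nrm_ge0.
have M0 : 0 <= M.
  apply: le_trans (nrm_ge0 (adj [::])) _; apply: hM; exists [::]; split=> //.
  by rewrite /lcomb big_nil nrm0.
have hadj s : nrm (adj s) <= M * nrm (lcomb hk s).
  apply: (@ler_eps _ M) => e e0; set n := nrm _.
  have n0 : 0 < nrm (lcomb hk s) + e by rewrite ltr_wpDl ?nrm_ge0.
  pose t := (nrm (lcomb hk s) + e)^-1; have t0 : 0 < t by rewrite invr_gt0.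
  have adjE : adj (scale_pts (fun=> t%:C) s) = t%:C *: adj s.
    rewrite /adj -lcomb_cst; congr lcomb; rewrite /scale_pts -!map_comp.
    by apply: eq_map => p /=; rewrite -!mulrA [t%:C * _]mulrC.
  have : t * n <= M.
    rewrite /n -[t](ger0_normcR (ltW t0)) -nrmZ -adjE; apply: hM.
    exists (scale_pts (fun=> t%:C) s); split=> //.
    rewrite lcomb_cst nrmZ ger0_normcR ?(ltW t0) // /t mulrC ler_pdivrMr // mul1r.
    by rewrite lerDl ltW.
  by rewrite mulrC ler_pdivrMr // mulrDr.
exists M => // g; apply: (ip_lcomb_bound (hk := hk)) => [|s].
  by rewrite mulr_ge0 ?nrm_ge0.
rewrite ip_mact_lcomb; apply: le_trans (cauchy_schwarz _ _) _.
rewrite (mulrC M) -mulrA; apply: ler_wpM2l; first exact: nrm_ge0.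
exact: hadj.
Qed.

End UniformBoundedness.

(** * The Hardy space on a set of uniqueness *)

Section HardyIsomorphism.
Context {R : realType} {X : Type} (H : rkhs (R := R) X) (k : X -> X -> R[i]).
Hypothesis hk : is_kernel H k.
Variables (x0 : X) (A : set (disc R)) (j : X -> disc R).
Hypothesis hrep : szego_representation k x0 A j.
Variable phi : mult H.
Hypotheses (hphi : forall x, mv phi x = val (j x)) (cphi : contr phi).
Notation coef := (hcoef hk x0 phi).
Notation one := (kv hk x0).
Implicit Types (g h : hvec H) (w z : disc R).

Let hu0 : val (j x0) = 0. Proof. by case: hrep. Qed.

Let hku x y : k x y = 1 / (1 - val (j x) * (val (j y))^*).
Proof. by case: hrep => _ _ _; apply. Qed.

Let hu1 x : normc (val (j x)) < 1. Proof. exact: disc_normc. Qed.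

(** The series is the Taylor series of an element of the Hardy space that
    vanishes on [A]. *)
Lemma coef_unique a (B : R) : l2bd a B -> (forall x, psval a (val (j x)) 0) ->
  a = fun=> 0.
Proof.
move=> ha a0; have [f [Hf tf pf]] := hardy2_of_coef ha.
have [uA [_ _ hA] _ _] := hrep.
have f0 : f = 0.
  apply: uA => // z /hA[x _ <-].
  exact: psval_unique (pf _) (a0 x).
have z0 : forall z, psval (fun=> 0 : R[i]) (val z) ((0 : disc R -> CC R) z).
  move=> z e e0; exists 0%N => n _.
  by rewrite /pspart big1 ?subrr ?normc0 // => i _; rewrite mul0r.
by rewrite -tf f0 (psval_holomorphic z0).2.
Qed.

Lemma coef_bd g : l2bd (coef g) (nrm g ^+ 2).
Proof. by have [] := hcoef_spec hk hu1 hu0 hku hphi cphi g. Qed.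

Lemma coef_psval g x : psval (coef g) (val (j x)) (ev g x).
Proof. by have [_] := hcoef_spec hk hu1 hu0 hku hphi cphi g. Qed.

Lemma coefE a (B : R) g : l2bd a B -> (forall x, psval a (val (j x)) (ev g x)) ->
  coef g = a.
Proof.
move=> ha hag.
have h0 x : psval (fun n => coef g n - a n) (val (j x)) 0.
  by rewrite -(subrr (ev g x)); apply: psvalB => //; exact: coef_psval.
have := coef_unique (l2bdB (coef_bd g) ha) h0 => e.
apply/funext => n; apply/eqP; rewrite -subr_eq0; apply/eqP.
exact: (congr1 (fun f => f n) e).
Qed.

Lemma coef_hpart g (e : R) : 0 < e -> exists N, forall n, (N <= n)%N ->
  nrm (hpart hk x0 phi (coef g) n - g) < e.
Proof.
have [g' [hg' _ lim]] := l2_composition hk hu0 hku hphi cphi (coef_bd g).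
have -> : g = g' by apply: hvec_ext => x; apply: psval_unique (coef_psval g x) (hg' x).
rewrite (coefE (coef_bd g) hg'); exact: lim.
Qed.

Lemma ip_hpart a n h : ip (hpart hk x0 phi a n) h = \sum_(i < n) a i * (coef h i)^*.
Proof. by rewrite ip_suml; apply: eq_bigr => i _; rewrite ipZl /hcoef -ipC. Qed.

Lemma parseval g h :
  ctends (fun n => \sum_(i < n) coef g i * (coef h i)^*) (ip g h).
Proof.
move=> e e0; have h1 : 0 < nrm h + 1 by rewrite ltr_wpDl ?nrm_ge0.
have [N hN] := coef_hpart g (divr_gt0 e0 h1); exists N => n /hN.
rewrite -ip_hpart -ipBl ltr_pdivlMr // => h2.
apply: le_lt_trans (cauchy_schwarz _ _) _; apply: le_lt_trans h2.
by apply: ler_wpM2l; [exact: nrm_ge0|rewrite lerDl].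
Qed.

(** This element represents evaluation at the point [w], which need not be in
    the range of [j]. *)
Lemma point_vector_exists w : exists g, coef g = fun n => (val w)^* ^+ n.
Proof.
have bd := @geometric_l2bd R (disc R) val (@disc_normc R) w.
have [g [hg _ _]] := l2_composition hk hu0 hku hphi cphi bd.
by exists g; exact: coefE bd hg.
Qed.

Definition point_vector w : hvec H := sval (cid (point_vector_exists w)).

Lemma coef_point w : coef (point_vector w) = fun n => (val w)^* ^+ n.
Proof. exact: (svalP (cid (point_vector_exists w))). Qed.

(** The holomorphic function on the disc whose composition with [j] is [g]. *)
Definition extension g w : R[i] := ip g (point_vector w).

Lemma extension_psval g w : psval (coef g) (val w) (extension g w).
Proof.
have := parseval g (point_vector w); rewrite coef_point; congr (ctends _ _).
apply/funext => n; apply: eq_bigr => i _.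
by rewrite rmorphXn /= cjK.
Qed.

Lemma extensionE a (B : R) g (f : disc R -> R[i]) : l2bd a B ->
  (forall z, psval a (val z) (f z)) -> (forall x, ev g x = f (j x)) ->
  forall z, extension g z = f z.
Proof.
move=> ha haf hgf z; apply: psval_unique (extension_psval g z) _.
by rewrite (coefE (g := g) ha) // => x; rewrite hgf.
Qed.

Lemma extension_ev g x : extension g (j x) = ev g x.
Proof. exact: psval_unique (extension_psval g _) (coef_psval g x). Qed.

Lemma extension_hardy g : hardy2 R (extension g : disc R -> CC R) /\
  taylor (extension g : disc R -> CC R) = coef g.
Proof.
have [hol tg] := psval_holomorphic (extension_psval g).
by split=> //; apply/hardy2P; split=> //; rewrite tg; exists (nrm g ^+ 2); exact: coef_bd.
Qed.

Lemma hardy_composition (f : disc R -> CC R) : hardy2 R f ->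
  exists g, [/\ forall x, ev g x = f (j x), coef g = taylor f
    & forall z, extension g z = f z].
Proof.
move=> /hardy2P[hf [B hB]].
have pf z := holomorphic_psval z hf.
have [g [hg _ _]] := l2_composition hk hu0 hku hphi cphi hB.
have gE x : ev g x = f (j x) by exact: psval_unique (hg x) (pf _).
exists g; split=> //; first exact: coefE hB hg.
exact: extensionE hB pf gE.
Qed.

Lemma ctends_cvg (s : nat -> R[i]) l : ctends s l ->
  (fun n => s n : CC R) @ \oo --> (l : CC R).
Proof.
move=> h; apply/cvgrPdist_lt => e e0.
have er : e = (Re e)%:C by rewrite RRe_real // gtr0_real.
have er0 : 0 < Re e by rewrite -ltcR -er.
have [N hN] := h _ er0; exists N => // n /= Nn.
by rewrite distrC normCE er ltcR; exact: hN.
Qed.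

Lemma hardy_inner (f g : disc R -> CC R) (f' g' : hvec H) :
  coef f' = taylor f -> coef g' = taylor g -> inner (hardy2 R) f g = ip f' g'.
Proof.
move=> hf hg.
have sE : (fun n => \sum_(i < n) taylor f i * (taylor g i)^* : CC R) =
    series (fun n => taylor f n * (taylor g n)^* : CC R).
  by apply/funext => n; rewrite /series /= big_mkord.
have := ctends_cvg (parseval f' g'); rewrite hf hg sE => /cvg_lim.
by apply; exact: norm_hausdorff.
Qed.

Lemma composition_unitary : unitary_op (hardy2 R) H (fun f => f \o j).
Proof.
have compE (f : disc R -> CC R) g : (forall x, ev g x = f (j x)) -> f \o j = hfun g.
  by move=> e; apply/funext => x; rewrite -[hfun g x]/(ev g x) e.
split=> //.
- by move=> f /hardy_composition[g [/compE -> _ _]]; exact: hvecH.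
- move=> f g /hardy_composition[f' [ef cf _]] /hardy_composition[g' [eg cg _]].
  by rewrite (hardy_inner cf cg) (compE _ _ ef) (compE _ _ eg).
- move=> g Hg; have [hg _] := extension_hardy (mkh Hg).
  exists (extension (mkh Hg) : disc R -> CC R) => //.
  by apply/funext => x; exact: extension_ev.
Qed.

(** ** Bounded holomorphic functions and multipliers *)

Implicit Type psi : hinf R.

Lemma hinf_holomorphic psi : holomorphic (psi : disc R -> CC R).
Proof. by have /asboolP[] := hinfP psi. Qed.

Lemma hinf_bounded psi : exists2 M : R, 0 <= M & forall z, normc (psi z) <= M.
Proof.
have /asboolP[_ [M hM]] := hinfP psi; exists M => //.
exact: le_trans (normc_ge0 _) (hM (j x0)).
Qed.

Lemma holomorphic_sum m (F : 'I_m -> disc R -> CC R) :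
  (forall l, holomorphic (F l)) -> holomorphic (fun z => \sum_l F l z).
Proof.
move=> hF; have -> : (fun z => \sum_l F l z) = \sum_l F l.
  by apply/funext => z; rewrite fct_sumE.
elim: (index_enum _) => [|i r IH]; first by rewrite big_nil; exact: holomorphic0.
by rewrite big_cons; apply: holomorphicD IH; exact: hF.
Qed.

Definition pointwise_bound m (Psi : 'M[hinf R]_m) (C : R) :=
  forall z (v : 'I_m -> R[i]), \sum_i normc (\sum_l Psi i l z * v l) ^+ 2 <=
    C ^+ 2 * \sum_l normc (v l) ^+ 2.

Lemma ctends_sum m (s : 'I_m -> nat -> R[i]) (l : 'I_m -> R[i]) :
  (forall i, ctends (s i) (l i)) -> ctends (fun n => \sum_i s i n) (\sum_i l i).
Proof.
move=> hs; elim: (index_enum _) => [|i r IH].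
  by under eq_fun do rewrite big_nil; rewrite big_nil; exact: ctends_cst.
by under eq_fun do rewrite big_cons; rewrite big_cons; exact: ctendsD.
Qed.

(** The product of the matrix with the extensions has square summable
    coefficients by [bounded_action], and Parseval's identity carries the
    estimate over to the space. *)
Lemma hinf_action m (Psi : 'M[hinf R]_m) C (h : 'I_m -> hvec H) : 0 <= C ->
  pointwise_bound Psi C -> exists G : 'I_m -> hvec H,
  (forall i z, extension (G i) z = \sum_l Psi i l z * extension (h l) z) /\
  tnrm2 G <= C ^+ 2 * tnrm2 h.
Proof.
move=> C0 hC.
pose g i z := \sum_l Psi i l z * extension (h l) z.
have hg i : holomorphic (g i : disc R -> CC R).
  apply: holomorphic_sum => l; apply: holomorphicM; first exact: hinf_holomorphic.
  by have [/hardy2P[]] := extension_hardy (h l).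
pose b i := taylor (g i : disc R -> CC R).
have hb i z : psval (b i) (val z) (g i z) := holomorphic_psval z (hg i).
pose D := C ^+ 2 * tnrm2 h.
have bd K : \sum_i \sum_(n < K) normc (b i n) ^+ 2 <= D.
  exact: (bounded_action (Psi := fun i l => (Psi i l : disc R -> R[i])) C0 hC
    (fun l z => extension_psval (h l) z) hb (fun i z => erefl) (fun l => coef_bd (h l)) K).
have S0 i K : 0 <= \sum_(n < K) normc (b i n) ^+ 2.
  by apply: sumr_ge0 => n _; exact: sqr_ge0.
have bB i : l2bd (b i) D.
  move=> K; apply: le_trans (bd K); rewrite (bigD1 i) //= lerDl.
  by apply: sumr_ge0 => l _; exact: S0.
have [G hG] : exists G : 'I_m -> hvec H,
    forall i x, psval (b i) (val (j x)) (ev (G i) x).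
  have ex i : exists g', forall x, psval (b i) (val (j x)) (ev g' x).
    by have [g' [hg' _ _]] := l2_composition hk hu0 hku hphi cphi (bB i); exists g'.
  by have [G hG] := choice ex; exists G.
exists G; split=> [i z|].
  apply: (extensionE (bB i) (hb i)) => x.
  exact: psval_unique (hG i x) (hb i (j x)).
have cG i : coef (G i) = b i := coefE (bB i) (hG i).
have lim := ctends_sum (fun i => parseval (G i) (G i)).
have : normc (\sum_i ip (G i) (G i)) <= D.
  apply: (ctends_bound lim) => n.
  have -> : \sum_i \sum_(l < n) coef (G i) l * (coef (G i) l)^* =
      (\sum_i \sum_(l < n) normc (b i l) ^+ 2)%:C.
    rewrite rc_sum; apply: eq_bigr => i _; rewrite rc_sum; apply: eq_bigr => l _.
    by rewrite mulcJ cG.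
  by rewrite ger0_normcR ?bd //; apply: sumr_ge0 => i _; exact: S0.
have -> : \sum_i ip (G i) (G i) = (tnrm2 G)%:C.
  by rewrite rc_sum; apply: eq_bigr => i _; rewrite ipxx.
by rewrite ger0_normcR ?tnrm2_ge0.
Qed.

Lemma hinf_action1 psi g : exists g', forall z,
  extension g' z = psi z * extension g z.
Proof.
have [M M0 hM] := hinf_bounded psi.
have [|G [hG _]] := @hinf_action 1 (const_mx psi) M (fun=> g) M0.
  move=> z v; rewrite !big_ord1 mxE normcM exprMn.
  apply: ler_wpM2r; first exact: sqr_ge0.
  by rewrite ler_pXn2r ?nnegrE ?normc_ge0.
by exists (G 0) => z; rewrite hG big_ord1 mxE.
Qed.

Lemma composition_multiplier psi : multiplier_pred H (psi \o j : X -> CC R).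
Proof.
apply/asboolP => f Hf; have [g' hg'] := hinf_action1 psi (mkh Hf).
have -> : (psi \o j : X -> CC R) * f = hfun g'; last exact: hvecH.
apply/funext => x; rewrite -[hfun g' x]/(ev g' x) -extension_ev hg' extension_ev.
by [].
Qed.

Definition comp_mult psi : mult H := Mult (composition_multiplier psi).

Lemma mv_comp psi x : mv (comp_mult psi) x = psi (j x). Proof. by []. Qed.

Lemma extension_mact psi g z :
  extension (mact (comp_mult psi) g) z = psi z * extension g z.
Proof.
have [g' hg'] := hinf_action1 psi g.
rewrite -hg'; congr extension; apply: hvec_ext => x.
by rewrite ev_mact -extension_ev -[ev g' x]extension_ev hg'.
Qed.

Lemma extensionD g h z : extension (g + h) z = extension g z + extension h z.
Proof. exact: ipDl. Qed.

Lemma extensionZ a g z : extension (a *: g) z = a * extension g z.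
Proof. exact: ipZl. Qed.

Lemma extension_sum (I : Type) (r : seq I) (P : pred I) (F : I -> hvec H) z :
  extension (\sum_(i <- r | P i) F i) z = \sum_(i <- r | P i) extension (F i) z.
Proof. exact: ip_suml. Qed.

Lemma point_vector_gt0 z : 0 < nrm (point_vector z).
Proof.
apply: nrm_gt0 => e; have := congr1 (fun f => f 0%N) (coef_point z).
by rewrite e /hcoef ip0l expr0 => /esym/eqP; rewrite oner_eq0.
Qed.

Lemma extension_point z :
  extension (point_vector z) z = (nrm (point_vector z) ^+ 2)%:C.
Proof. exact: ipxx. Qed.

Lemma extension_one z : extension one z = 1.
Proof.
have evone x := ev_one hk (szego_normalized (u := fun x => val (j x)) hu0 hku) x.
pose a n : R[i] := (n == 0%N)%:R.
have pa w : psval a (val w) 1.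
  move=> e e0; exists 1%N => -[//|n] _.
  rewrite /pspart big_ord_recl big1 ?addr0 ?mulr1 ?subrr ?normc0 //.
  by move=> i _; rewrite mul0r.
have la : l2bd a 1.
  case=> [|n]; first by rewrite big_ord0.
  by rewrite big_ord_recl big1 ?addr0 ?normc1 ?expr1n // => i _; rewrite normc0 expr0n.
exact: (extensionE (f := fun=> 1) la pa).
Qed.

(** A bound for the pointwise norms bounds the operator by [hinf_action].
    Conversely the operator is tested on multiples of a point vector. *)
Lemma mult_mxnorm_compP m (Psi : 'M[hinf R]_m) (C : R) : 0 <= C ->
  (mult_mxnorm (map_mx comp_mult Psi) <= C%:E)%E <-> pointwise_bound Psi C.
Proof.
move=> C0; split=> [/(mult_mxnorm_leP _ C0) hC z v|hC]; last first.
  apply/mult_mxnorm_leP => // h; have [G [hG nG]] := hinf_action h C0 hC.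
  apply: le_trans nG; rewrite le_eqVlt; apply/orP; left; apply/eqP.
  apply: eq_bigr => i _; congr (nrm _ ^+ 2); apply: hvec_ext => x.
  rewrite -[RHS]extension_ev hG ev_sum; apply: eq_bigr => l _.
  by rewrite mxE ev_mact mv_comp extension_ev.
(* The vectors [v l *: point_vector z] realise the value of the matrix at [z]. *)
pose p := point_vector z; pose n := nrm p.
have n0 : 0 < n := point_vector_gt0 z.
pose h l := v l *: p.
have := hC h.
have -> : tnrm2 h = \sum_l normc (v l) ^+ 2 * n ^+ 2.
  by apply: eq_bigr => l _; rewrite nrmZ exprMn.
rewrite -mulr_suml => hle.
have val i : extension (mapp (map_mx comp_mult Psi) h i) z =
    (\sum_l Psi i l z * v l) * (n ^+ 2)%:C.
  rewrite extension_sum mulr_suml; apply: eq_bigr => l _.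
  by rewrite mxE extension_mact extensionZ extension_point mulrA.
have low : \sum_i normc (\sum_l Psi i l z * v l) ^+ 2 * n ^+ 2 <=
    tnrm2 (mapp (map_mx comp_mult Psi) h).
  apply: ler_sum => i _; rewrite -(ler_pM2r (exprn_gt0 2 n0)).
  rewrite -!exprMn ler_pXn2r ?nnegrE ?mulr_ge0 ?normc_ge0 ?nrm_ge0 //.
  rewrite -mulrA -expr2 -[n ^+ 2]ger0_normcR ?sqr_ge0 // -normcM -val.
  exact: cauchy_schwarz.
rewrite -(ler_pM2r (exprn_gt0 2 n0)) mulr_suml.
by apply: le_trans low _; rewrite -mulrA.
Qed.

Lemma coordinate_hinf : exists psi : hinf R, forall z, psi z = val z.
Proof.
pose a n : R[i] := (n == 1%N)%:R.
have pa (w : disc R) : psval a (val w) (val w).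
  move=> e e0; exists 2%N => -[//|[//|n]] _.
  rewrite /pspart big_ord_recl mul0r add0r big_ord_recl expr1 mul1r.
  by rewrite big1 ?addr0 ?subrr ?normc0 // => i _; rewrite mul0r.
have [hol _] := psval_holomorphic (f := val : disc R -> CC R) pa.
have h : hinf_pred (val : disc R -> CC R).
  by apply/asboolP; split=> //; exists 1 => z; exact/ltW/disc_normc.
by exists (Hinf h).
Qed.

Lemma extension_phi g z : extension (mact phi g) z = val z * extension g z.
Proof.
have [psi hpsi] := coordinate_hinf; rewrite -hpsi -extension_mact.
by congr extension; congr mact; apply: mult_ext => x; rewrite hphi mv_comp hpsi.
Qed.

Lemma extension_phiX g n z : extension (mact (phi ^+ n) g) z = val z ^+ n * extension g z.
Proof.
elim: n => [|n IH]; first by rewrite expr0 mact1 mul1r.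
by rewrite exprS mactM extension_phi IH exprS mulrA.
Qed.

Lemma extension_hpart theta a n z :
  extension (mact theta (hpart hk x0 phi a n)) z =
  extension (mact theta one) z * pspart a (val z) n.
Proof.
rewrite mact_sumr extension_sum /pspart mulr_sumr; apply: eq_bigr => i _.
rewrite mactZr extensionZ -mactM [theta * _]mulrC mactM extension_phiX; ring.
Qed.

(** With a polynomial in [phi] in place of the point vector as first factor this
    is the multiplicativity of the extension; the multiplication operator is
    bounded and polynomials approximate the point vector. *)
Lemma multiplier_extension theta z :
  ip (mact theta (point_vector z)) (point_vector z) =
  extension (mact theta one) z * (nrm (point_vector z) ^+ 2)%:C.
Proof.
set p := point_vector z; set f := extension _ z.
have [C C0 hC] := multiplier_bounded hk theta.
apply/eqP; rewrite -subr_eq0 -normc_eq0 eq_le normc_ge0 andbT.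
apply: (@ler_eps _ ((C + normc f) * nrm p)) => e e0; rewrite add0r.
have [N /(_ N (leqnn N))] := coef_hpart p e0.
set q := hpart _ _ _ _ N => hq.
have fq : extension q z = pspart (coef p) (val z) N.
  by have := extension_hpart 1 (coef p) N z; rewrite !mact1 extension_one mul1r.
have -> : ip (mact theta p) p - f * (nrm p ^+ 2)%:C =
    ip (mact theta (p - q)) p - f * ip (p - q) p.
  rewrite mactBr !ipBl -ipxx -[ip (mact theta q) p]/(extension _ z).
  rewrite extension_hpart -fq -/f -[ip q p]/(extension q z); ring.
apply: le_trans (le_normcD _ _) _; rewrite normcN normcM -mulrA mulrDl.
have hq' : nrm (p - q) <= e by rewrite nrmB_sym ltW.
apply: lerD.
  apply: le_trans (cauchy_schwarz _ _) _; rewrite [nrm p * e]mulrC mulrA.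
  apply: ler_wpM2r; first exact: nrm_ge0.
  by apply: le_trans (hC _) _; apply: ler_wpM2l.
apply: ler_wpM2l; first exact: normc_ge0.
apply: le_trans (cauchy_schwarz _ _) _; rewrite mulrC.
by apply: ler_wpM2l => //; exact: nrm_ge0.
Qed.

(** By [multiplier_extension] the values of the extension of [theta 1] are
    bounded by the norm of the multiplication operator. *)
Lemma comp_mult_surjective theta : exists psi, comp_mult psi = theta.
Proof.
pose f : disc R -> CC R := extension (mact theta one).
have [C C0 hC] := multiplier_bounded hk theta.
have fC z : normc (f z) <= C.
  have n0 := point_vector_gt0 z; set p := point_vector z in n0.
  have := cauchy_schwarz (mact theta p) p.
  rewrite multiplier_extension normcM -/p ger0_normcR ?sqr_ge0 // => h.
  rewrite -(ler_pM2r (exprn_gt0 2 n0)); apply: le_trans h _.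
  by rewrite expr2 mulrA; apply: ler_wpM2r (hC p); exact: nrm_ge0.
have hf : hinf_pred f.
  apply/asboolP; split; last by exists C.
  by have [/hardy2P[]] := extension_hardy (mact theta one).
exists (Hinf hf); apply: mult_ext => x.
rewrite mv_comp -[Hinf hf (j x)]/(extension (mact theta one) (j x)) extension_ev ev_mact.
by rewrite (ev_one hk (szego_normalized (u := fun x => val (j x)) hu0 hku)) mulr1.
Qed.

Lemma comp_mult_injective : injective comp_mult.
Proof.
move=> psi psi' e; apply: val_inj; apply/funext => z.
have := extension_mact psi one z; have := extension_mact psi' one z.
by rewrite e extension_one !mulr1 => -> .
Qed.

Lemma comp_mult_zmod : zmod_morphism comp_mult.
Proof. by move=> a b; apply: mult_ext. Qed.

Lemma comp_mult_monoid : monoid_morphism comp_mult.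
Proof. by split=> [|a b]; apply: mult_ext. Qed.

Lemma comp_mult_scalable : scalable comp_mult.
Proof. by move=> c a; apply: mult_ext. Qed.

Lemma ereal_le_fin (x y : \bar R) : (0 <= y)%E ->
  (forall C : R, 0 <= C -> (y <= C%:E)%E -> (x <= C%:E)%E) -> (x <= y)%E.
Proof.
case: y => [r| |] //; first by rewrite lee_fin => r0 h; apply: h.
by move=> _ _; exact: leey.
Qed.

Lemma ereal_eq_fin (x y : \bar R) : (0 <= x)%E -> (0 <= y)%E ->
  (forall C : R, 0 <= C -> (x <= C%:E)%E <-> (y <= C%:E)%E) -> x = y.
Proof.
move=> x0' y0 h; apply/eqP; rewrite eq_le; apply/andP; split.
  by apply: ereal_le_fin => // C C0 /h; apply.
by apply: ereal_le_fin => // C C0 /h; apply.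
Qed.

Lemma opnorm_ge0 m (M : 'M[R[i]]_m) : (0 <= opnorm M)%E.
Proof.
apply: (@le_trans _ _ (l2norm (M *m 0))%:E); first by rewrite lee_fin sqrtr_ge0.
apply: ereal_sup_ubound; exists 0 => //=.
rewrite /l2norm big1 ?sqrtr0 // => i _; by rewrite mxE normc0 expr0n.
Qed.

Lemma sup_mxnorm_ge0 (T : Type) (t : T) m (F : T -> 'M[R[i]]_m) : (0 <= sup_mxnorm F)%E.
Proof.
by apply: le_trans (opnorm_ge0 (F t)) _; apply: ereal_sup_ubound; exists t.
Qed.

Lemma mult_mxnorm_ge0 m (Phi : 'M[mult H]_m) : (0 <= mult_mxnorm Phi)%E.
Proof.
pose F : 'cV[X -> CC R]_m := \col_i hfun (0 : hvec H).
apply: (@le_trans _ _ (tensor_norm H (map_mx (@mult_fun R X H) Phi *m F))%:E).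
  by rewrite lee_fin sqrtr_ge0.
apply: ereal_sup_ubound; exists F => //; split.
  by move=> i; rewrite mxE; exact: hvecH.
rewrite (tensor_normE (fun=> 0 : hvec H)) /tnrm2 big1 ?sqrtr0 // => i _.
by rewrite nrm0 expr0n.
Qed.

Lemma hinf_mxnorm_leP m (Psi : 'M[hinf R]_m) (C : R) : 0 <= C ->
  (hinf_mxnorm Psi <= C%:E)%E <-> pointwise_bound Psi C.
Proof.
move=> C0; have e z (v : 'I_m -> R[i]) :
    \sum_i normc (\sum_l map_mx (fun psi : hinf R => psi z) Psi i l * v l) ^+ 2 =
    \sum_i normc (\sum_l Psi i l z * v l) ^+ 2.
  apply: eq_bigr => i _; congr (normc _ ^+ 2); apply: eq_bigr => l _.
  by rewrite mxE.
split=> [/sup_mxnorm_leP h z v|h].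
  by have /opnorm_leP := h z; move=> /(_ C0 v); rewrite e.
by apply/sup_mxnorm_leP => z; apply/opnorm_leP => // v; rewrite e.
Qed.

Lemma comp_mult_isometric : completely_isometric (@hinf_mxnorm R) (@mult_mxnorm R X H) comp_mult.
Proof.
move=> m Psi; apply: ereal_eq_fin.
- exact: mult_mxnorm_ge0.
- exact: sup_mxnorm_ge0 (j x0) _ _.
- move=> C C0; split; first by move/(mult_mxnorm_compP _ C0)/(hinf_mxnorm_leP _ C0).
  by move/(hinf_mxnorm_leP _ C0)/(mult_mxnorm_compP _ C0).
Qed.

Lemma composition_isomorphism : hinf_composition_isomorphism H j.
Proof.
pose T : {rmorphism hinf R -> mult H} := HB.pack comp_mult
  (GRing.isZmodMorphism.Build _ _ comp_mult comp_mult_zmod)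
  (GRing.isMonoidMorphism.Build _ _ comp_mult comp_mult_monoid).
exists T; split=> //.
- exact: comp_mult_scalable.
- have [S hS] := choice comp_mult_surjective.
  exists S => a; last exact: hS.
  by apply: comp_mult_injective; exact: hS.
- exact: comp_mult_isometric.
Qed.

(** ** Characters of the multiplier algebra *)

(** A number [la] of modulus greater than the supremum of [psi] would make [la -
    psi] invertible among the bounded holomorphic functions, whereas a character
    that maps [psi] to [la] annihilates [la - psi]. *)
Lemma char_bound (chi : Delta H) psi (c : R) : (forall z, normc (psi z) <= c) ->
  normc (chv chi (comp_mult psi)) <= c.
Proof.
move=> hc; rewrite leNgt; apply/negP => cl.
set la := chv chi _ in cl.
pose f : disc R -> CC R := fun z => (la - psi z)^-1.
have far z : normc la - c <= normc (la - psi z).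
  by apply: le_trans (ler_normcB _ _); rewrite lerD2l lerN2.
have d0 : 0 < normc la - c by rewrite subr_gt0.
have nz z : la - psi z != 0 by rewrite -normc_gt0; exact: lt_le_trans (far z).
have hol : holomorphic f.
  pose g : disc R -> CC R := cst (la : CC R) - (psi : disc R -> CC R).
  have hg : holomorphic g.
    by apply: holomorphicB; [exact: holomorphic_cst|exact: hinf_holomorphic].
  have fg : ext0 f = fun t : CC R => ((ext0 g t : R[i])^-1 : CC R).
    apply/funext => t; rewrite /ext0; case: insub => [z|] /=; last by rewrite invr0.
    by [].
  move=> z; rewrite fg; apply: (@derivableV R[i] (CC R) (ext0 g)) (hg z).
  by rewrite ext0_val; exact: nz.
have hf : hinf_pred f.
  apply/asboolP; split=> //; exists (normc la - c)^-1 => z.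
  by rewrite /f normcV lef_pV2 ?posrE ?normc_gt0.
have inv1 : comp_mult (Hinf hf) * (la *: (1 : mult H) - comp_mult psi) = 1.
  apply: mult_ext => x; rewrite mvM mvB mvZ mv1 !mv_comp mulr1.
  by rewrite -[Hinf hf (j x)]/((la - psi (j x))^-1) mulVf.
have := chv1 chi; rewrite -inv1 chvM chvB chvZ chv1 mulr1 subrr mulr0.
by move/eqP; rewrite eq_sym oner_eq0.
Qed.

Lemma point_evaluation_character w :
  is_character (fun theta => extension (mact theta one) w : CC R).
Proof.
split=> [a theta theta'|theta theta'|].
- by rewrite mactDl mactZl extensionD extensionZ.
- have [psi <-] := comp_mult_surjective theta.
  by rewrite mactM !extension_mact extension_one mulr1.
- by exists 1; rewrite mact1 extension_one; exact/eqP/oner_neq0.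
Qed.

Definition point_character w : Delta H :=
  SigSub (mem_set (point_evaluation_character w)).

Lemma chv_point w psi : chv (point_character w) (comp_mult psi) = psi w.
Proof.
rewrite -[LHS]/(extension (mact (comp_mult psi) one) w).
by rewrite extension_mact extension_one mulr1.
Qed.

Lemma hinf_sumE (I : Type) (r : seq I) (F : I -> hinf R) z :
  (\sum_(i <- r) F i) z = \sum_(i <- r) F i z.
Proof.
elim: r => [|i r IH]; first by rewrite !big_nil.
by rewrite !big_cons -IH.
Qed.

(** The matrix case reduces to [char_bound], by pairing the vector to be
    estimated with itself; point evaluations give the converse. *)
Lemma gelfand_mxnorm_leP m (Psi : 'M[hinf R]_m) (C : R) : 0 <= C ->
  (cts_mxnorm (map_mx (@gelfand R X H) (map_mx comp_mult Psi)) <= C%:E)%E <->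
  pointwise_bound Psi C.
Proof.
move=> C0.
have entry (chi : Delta H) i l : map_mx (fun g : continuousType (Delta H) (CC R) => g chi)
    (map_mx (@gelfand R X H) (map_mx comp_mult Psi)) i l = chv chi (comp_mult (Psi i l)).
  by rewrite !mxE.
have e (chi : Delta H) (v : 'I_m -> R[i]) :
    \sum_i normc (\sum_l map_mx (fun g : continuousType (Delta H) (CC R) => g chi)
      (map_mx (@gelfand R X H) (map_mx comp_mult Psi)) i l * v l) ^+ 2 =
    \sum_i normc (\sum_l chv chi (comp_mult (Psi i l)) * v l) ^+ 2.
  apply: eq_bigr => i _; congr (normc _ ^+ 2); apply: eq_bigr => l _.
  by rewrite entry.
split=> [/sup_mxnorm_leP h z v|hC].
  have /opnorm_leP := h (point_character z); move=> /(_ C0 v); rewrite e.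
  congr (_ <= _); apply: eq_bigr => i _; congr (normc _ ^+ 2).
  by apply: eq_bigr => l _; rewrite chv_point.
apply/sup_mxnorm_leP => chi; apply/opnorm_leP => // v; rewrite e.
pose y i := \sum_l chv chi (comp_mult (Psi i l)) * v l.
pose S := \sum_i normc (y i) ^+ 2; pose V := \sum_l normc (v l) ^+ 2.
pose psi : hinf R := \sum_i (y i)^* *: \sum_l v l *: Psi i l.
have psiE z : psi z = \sum_i (y i)^* * \sum_l Psi i l z * v l.
  rewrite hinf_sumE; apply: eq_bigr => i _.
  rewrite -[LHS]/((y i)^* * (\sum_l v l *: Psi i l) z) hinf_sumE.
  by congr (_ * _); apply: eq_bigr => l _; exact: mulrC.
have cE : comp_mult psi = \sum_i (y i)^* *: \sum_l v l *: comp_mult (Psi i l).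
  apply: mult_ext => x; rewrite mv_comp psiE mv_sum; apply: eq_bigr => i _.
  rewrite mvZ mv_sum; congr (_ * _); apply: eq_bigr => l _.
  by rewrite mvZ mulrC.
have chE : chv chi (comp_mult psi) = S%:C.
  rewrite cE chv_sum rc_sum; apply: eq_bigr => i _.
  rewrite chvZ chv_sum -mulJc; congr (_ * _); apply: eq_bigr => l _.
  by rewrite chvZ mulrC.
have S0 : 0 <= S by apply: sumr_ge0 => i _; exact: sqr_ge0.
have : normc (chv chi (comp_mult psi)) <= (S + C ^+ 2 * V) / 2.
  apply: char_bound => z; rewrite psiE.
  apply: le_trans (normc_sum _ _ _) _.
  apply: (@le_trans _ _ (\sum_i (normc (y i) ^+ 2 +
      normc (\sum_l Psi i l z * v l) ^+ 2) / 2)).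
    apply: ler_sum => i _; rewrite normcM normc_conj.
    have := sqr_ge0 (normc (y i) - normc (\sum_l Psi i l z * v l)); lra.
  rewrite -mulr_suml ler_pM2r // big_split lerD2l; exact: hC.
rewrite chE ger0_normcR // -/V -[X in X <= _ -> _]/S.
by move: (C ^+ 2 * V) => W; rewrite -/S; lra.
Qed.

Lemma cts_mxnorm_ge0 m (Phi : 'M[mult H]_m) :
  (0 <= cts_mxnorm (map_mx (@gelfand R X H) Phi))%E.
Proof. exact: sup_mxnorm_ge0 (point_character (j x0)) _ _. Qed.

Lemma szego_gelfand_completely_isometric : gelfand_completely_isometric H.
Proof.
move=> m Phi; have [S hS] := choice comp_mult_surjective.
have -> : Phi = map_mx comp_mult (map_mx S Phi).
  by apply/matrixP => i l; rewrite !mxE hS.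
apply: ereal_eq_fin => [||C C0]; [exact: cts_mxnorm_ge0|exact: mult_mxnorm_ge0|].
split; first by move/(gelfand_mxnorm_leP _ C0)/(mult_mxnorm_compP _ C0).
by move/(mult_mxnorm_compP _ C0)/(gelfand_mxnorm_leP _ C0).
Qed.

Lemma szego_gelfand_isometric : gelfand_isometric H.
Proof.
move=> theta; have [psi <-] := comp_mult_surjective theta.
have one_by_one (C : R) : 0 <= C -> (pointwise_bound (const_mx psi : 'M[hinf R]_1) C <->
    (forall z, normc (psi z) <= C)).
  move=> C0; split=> h z; last first.
    move=> v; rewrite !big_ord1 mxE normcM exprMn.
    apply: ler_wpM2r; first exact: sqr_ge0.
    by rewrite ler_pXn2r ?nnegrE ?normc_ge0.
  have := h z (fun=> 1); rewrite !big_ord1 mxE mulr1 normc1 expr1n mulr1.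
  by rewrite ler_pXn2r ?nnegrE ?normc_ge0.
apply: ereal_eq_fin => [||C C0].
- apply: (@le_trans _ _ (normc (chv (point_character (j x0)) (comp_mult psi)))%:E).
    by rewrite lee_fin normc_ge0.
  by apply: ereal_sup_ubound; exists (point_character (j x0)).
- apply: (@le_trans _ _ (nrm (mact (comp_mult psi) 0))%:E); first by rewrite lee_fin nrm_ge0.
  apply: ereal_sup_ubound; exists (hfun (0 : hvec H)) => //; split; first exact: hvecH.
  by rewrite -[hnorm H _]/(nrm (0 : hvec H)) nrm0.
split=> [h|/(mult_norm_leP _ C0) h].
  apply/mult_norm_leP => // g.
  have hz z : normc (psi z) <= C.
    rewrite -chv_point -lee_fin; apply: le_trans h; apply: ereal_sup_ubound.
    by exists (point_character z).
  have /(mult_mxnorm_compP _ C0)/(mult_mxnorm_leP _ C0) := (one_by_one C C0).2 hz.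
  move=> /(_ (fun=> g)); rewrite /tnrm2 /mapp !big_ord1 !mxE -exprMn.
  by rewrite ler_pXn2r ?nnegrE ?mulr_ge0 ?nrm_ge0.
apply: ge_ereal_sup => _ [chi _ <-]; rewrite lee_fin; apply: char_bound.
apply/one_by_one => //; apply/mult_mxnorm_compP => //; apply/mult_mxnorm_leP => // g.
rewrite /tnrm2 /mapp !big_ord1 !mxE -exprMn.
by rewrite ler_pXn2r ?nnegrE ?mulr_ge0 ?nrm_ge0 //; exact: h.
Qed.

End HardyIsomorphism.

Theorem theorem1p1 (R : realType) (X : Type) (hX : exists x y : X, x <> y)
    (x0 : X) (H : rkhs (R := R) X) (k : X -> X -> R[i])
    (hk : is_kernel H k) (hirr : irreducible_kernel k) (hNP : complete_NP H k)
    (hnorm1 : normalized k x0) :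
  (gelfand_isometric H <->
     exists (A : set (disc R)) (j : X -> disc R), szego_representation k x0 A j)
  /\
  (forall (A : set (disc R)) (j : X -> disc R), szego_representation k x0 A j ->
     [/\ unitary_op (hardy2 R) H (fun f => f \o j),
         hinf_composition_isomorphism H j
       & gelfand_completely_isometric H]).
Proof.
have coordinate (A : set (disc R)) (j : X -> disc R) : szego_representation k x0 A j ->
    exists phi : mult H, (forall x, mv phi x = val (j x)) /\ contr phi.
  by case=> _ _ _ hku; apply: (szego_contr_multiplier hk (fun x => disc_normc (j x)) hku).
split; first split=> [gel|[A [j rep]]]; first exact: (szego_of_isometric hX hk hirr hNP hnorm1 gel).
  have [phi [hphi cphi]] := coordinate A j rep.
  exact (szego_gelfand_isometric hk rep hphi cphi).
move=> A j rep; have [phi [hphi cphi]] := coordinate A j rep.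
split; first exact (composition_unitary hk rep hphi cphi).
  exact (composition_isomorphism hk rep hphi cphi).
exact (szego_gelfand_completely_isometric hk rep hphi cphi).
Qed.
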